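(* (i) There exist quartic polynomials $f,g\in\mathbb{Z}[X]$ of squarefree discriminant whose invariant orders $R_f$ and $R_g$ are isomorphic as rings but such that $f$ and $g$ are not Hermite equivalent. (ii) For each integer $n\geq 4$ and for each of the following three sets of polynomials in $\mathbb{Z}[X]$ of degree $n$: (a) properly non-monic irreducible polynomials, (b) monic irreducible polynomials, (c) monic reducible polynomials, there exist infinitely many Hermite equivalence classes of polynomials in that set that split into more than one $\mathrm{GL}_2(\mathbb{Z})$-equivalence class; that is, infinitely many Hermite equivalence classes containing two polynomials from that set that are not $\mathrm{GL}_2(\mathbb{Z})$-equivalent to each other.
   Context: Let $f(X)=f_0X^n+f_1X^{n-1}+\cdots+f_n=f_0\prod_{i=1}^n(X-\alpha_i)\in\mathbb{Z}[X]$ have degree $n$ ($f_0\neq 0$, $\alpha_i\in\mathbb{C}$). Its discriminant is $D(f)=f_0^{2n-2}\prod_{1\le i<j\le n}(\alpha_i-\alpha_j)^2$. Hermite equivalence: put $[f](X_1,\ldots,X_n)=f_0^{n-1}\prod_{i=1}^n(\alpha_i^{n-1}X_1+\alpha_i^{n-2}X_2+\cdots+X_n)$. Polynomials $f,g\in\mathbb{Z}[X]$ of degree $n$ are Hermite equivalent if there is $U\in\mathrm{GL}_n(\mathbb{Z})$ with $[g](U\underline{X})=\pm[f](\underline{X})$, where $\underline{X}=(X_1,\ldots,X_n)^T$. $\mathrm{GL}_2(\mathbb{Z})$-equivalence: $f,g\in\mathbb{Z}[X]$ of degree $n$ are $\mathrm{GL}_2(\mathbb{Z})$-equivalent if $g(X)=\pm(cX+d)^nf\left(\frac{aX+b}{cX+d}\right)$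 for some $\begin{pmatrix}a&b\\c&d\end{pmatrix}\in\mathrm{GL}_2(\mathbb{Z})$ and some sign. A polynomial is properly non-monic if it is not $\mathrm{GL}_2(\mathbb{Z})$-equivalent to a monic polynomial. Invariant order: for $f$ of degree $n\ge2$ and nonzero discriminant, let $K_f=\mathbb{Q}[X]/(f)$ and let $\alpha$ be the residue class of $X$. The invariant order $R_f\subset K_f$ is the ring with $\mathbb{Z}$-basis $1,\ f_0\alpha,\ f_0\alpha^2+f_1\alpha,\ \ldots,\ f_0\alpha^{n-1}+f_1\alpha^{n-2}+\cdots+f_{n-2}\alpha$. *)

(* Defs.v *)
From HB Require Import structures.
From mathcomp Require Import all_boot all_order all_algebra all_field.
From mathcomp Require Import qpoly fraction.
From mathcomp Require Import boolp classical_sets functions cardinality.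
From mathcomp Require Import mpoly.

Set Implicit Arguments.
Unset Strict Implicit.
Unset Printing Implicit Defensive.

Import GRing.Theory Num.Theory.

Local Open Scope classical_set_scope.
Local Open Scope ring_scope.

(* A polynomial f has degree n iff size f = n.+1; then f_k, the coefficient of
   'X^(n - k) in the usual notation f_0 X^n + ... + f_n, is f`_(n - k), and
   f_0 = lead_coef f. *)
Definition has_degree (n : nat) (f : {poly int}) : Prop := size f = n.+1.

(* The complex roots of f, with multiplicity (in an unspecified order).  They
   all lie in algC. *)
Definition complex_roots (f : {poly int}) : seq algC :=
  sval (closed_field_poly_normal (map_poly intr f : {poly algC})).

Lemma complex_rootsP (f : {poly int}) :
  map_poly intr f =
  ((lead_coef f)%:~R : algC) *: \prod_(a <- complex_roots f) ('X - a%:P).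
Proof.
have lead_f : lead_coef (map_poly intr f : {poly algC}) = (lead_coef f)%:~R.
  by rewrite lead_coef_map_inj //; exact: intr_inj.
rewrite -lead_f /complex_roots.
by case: closed_field_poly_normal.
Qed.

Definition disc (f : {poly int}) : algC :=
  let n := (size f).-1 in
  (lead_coef f)%:~R ^+ (2 * n - 2) *
  \prod_(i < n) \prod_(j < n | (i < j)%N) 
    ((complex_roots f)`_i - (complex_roots f)`_j) ^+ 2.

Definition squarefree (d : int) : Prop :=
  forall m : int, (m ^+ 2 %| d)%Z -> m \is a GRing.unit.

Definition squarefree_disc (f : {poly int}) : Prop :=
  exists2 d : int, disc f = d%:~R & squarefree d.

(* The variables X_1, ..., X_n are 'X_0, ..., 'X_(n-1), so that X_(j+1) has
   coefficient a ^+ (n - 1 - j). *)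
Definition hermite_form (n : nat) (f : {poly int}) : {mpoly algC[n]} :=
  ((lead_coef f)%:~R ^+ n.-1 : algC) *:
  \prod_(a <- complex_roots f) \sum_(j < n) (a ^+ (n.-1 - j)) *: 'X_j.

Definition lin_subst (n : nat) (U : 'M[int]_n) (p : {mpoly algC[n]}) :
    {mpoly algC[n]} :=
  comp_mpoly [tuple \sum_(j < n) ((U i j)%:~R : algC) *: 'X_j | i < n] p.

Definition hermite_equiv (n : nat) (f g : {poly int}) : Prop :=
  [/\ has_degree n f, has_degree n g &
      exists2 U : 'M[int]_n, U \in unitmx &
      exists e : bool,
        lin_subst U (hermite_form n g) = (-1) ^+ e *: hermite_form n f].

Definition hermite_class (n : nat) (f : {poly int}) : set {poly int} :=
  [set g | hermite_equiv n f g].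

(* The identity g(X) = +- (cX + d)^n f((aX + b) / (cX + d)) is stated in the
   field of rational functions Frac(Z[X]). *)
Definition gl2_equiv (n : nat) (f g : {poly int}) : Prop :=
  [/\ has_degree n f, has_degree n g &
      exists2 M : 'M[int]_2, M \in unitmx &
      exists e : bool,
        let num := tofrac (M 0 0 *: 'X + (M 0 1)%:P) in
        let den := tofrac (M 1 0 *: 'X + (M 1 1)%:P) in
        tofrac g =
        (-1) ^+ e * den ^+ n * (map_poly (@tofrac _ \o polyC) f).[num / den]].

Definition properly_nonmonic (n : nat) (f : {poly int}) : Prop :=
  ~ exists2 h : {poly int}, h \is monic & gl2_equiv n f h.

(* Irreducibility in the ring Z[X] (so f is in particular primitive), and not
   irreducible_poly, which over int ignores constant factors. *)
Definition irreducible_Z (f : {poly int}) : Prop :=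
  [/\ f != 0, f \isn't a GRing.unit &
      forall g h : {poly int},
        f = g * h -> g \is a GRing.unit \/ h \is a GRing.unit].

Definition reducible_Z (f : {poly int}) : Prop :=
  [/\ f != 0, f \isn't a GRing.unit & ~ irreducible_Z f].

(* {poly %/ p} is the quotient by the ideal (p) only for p monic of positive
   degree, hence the normalization, which does not change the ideal. *)
Definition monic_rat (f : {poly int}) : {poly rat} :=
  ((lead_coef f)%:~R)^-1 *: map_poly intr f.

Lemma mk_monic_rat (n : nat) (f : {poly int}) :
  (0 < n)%N -> has_degree n f -> mk_monic (monic_rat f) = monic_rat f.
Proof.
move=> n_gt0 sz_f; have f0 : lead_coef f != 0.
  by rewrite lead_coef_eq0 -size_poly_eq0 sz_f.
have f0Q : (lead_coef f)%:~R != 0 :> rat by rewrite intr_eq0.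
rewrite /mk_monic size_scale ?invr_eq0 // size_map_inj_poly //; last first.
  exact: intr_inj.
rewrite sz_f ltnS n_gt0 /= monicE lead_coefZ lead_coef_map_inj //; last first.
  exact: intr_inj.
by rewrite mulVf // eqxx.
Qed.

(* K_f = Q[X] / (f), and the class of X *)
Notation Kalg f := {poly %/ monic_rat f}.

Definition alpha (f : {poly int}) : Kalg f := qpolyX (monic_rat f).

(* omega_0 = 1 and
   omega_i = f_0 alpha^i + f_1 alpha^(i-1) + ... + f_(i-1) alpha for i > 0. *)
Definition omega (f : {poly int}) (i : nat) : Kalg f :=
  if i is 0 then 1
  else \sum_(k < i) alpha f ^+ (i - k) *~ f`_((size f).-1 - k).

Definition invariant_order (f : {poly int}) : set (Kalg f) :=
  [set x | exists c : 'I_(size f).-1 -> int,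
     x = \sum_(i < (size f).-1) omega f i *~ c i].
Arguments invariant_order : clear implicits.

(* Ring isomorphisms R_f -> R_g, given as functions on K_f of which only the
   restriction to R_f matters. *)
Definition invariant_orders_isomorphic (f g : {poly int}) : Prop :=
  exists phi : Kalg f -> Kalg g,
    [/\ set_bij (invariant_order f) (invariant_order g) phi,
        phi 1 = 1,
        forall x y, invariant_order f x -> invariant_order f y ->
          phi (x + y) = phi x + phi y
      & forall x y, invariant_order f x -> invariant_order f y ->
          phi (x * y) = phi x * phi y].

(* The Hermite classes in degree n containing two polynomials of S that are
   not GL_2(Z)-equivalent to each other. *)
Definition split_classes (n : nat) (S : set {poly int}) :
    set (set {poly int}) :=
  [set C | exists2 h, has_degree n h & C = hermite_class n h /\
     exists f g, [/\ S f, S g, C f, C g & ~ gl2_equiv n f g]].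

(* Main.v *)
Require Import Defs.
From Stdlib Require Import ZArith.
From HB Require Import structures.
From mathcomp Require Import all_boot all_order all_algebra all_field all_fingroup.
From mathcomp Require Import boolp classical_sets functions cardinality.
From mathcomp Require Import cyclic mpoly qpoly fraction.
From mathcomp Require Import ring lra zify ssrZ.

Set Implicit Arguments.
Unset Strict Implicit.
Unset Printing Implicit Defensive.

Import Order.TTheory GRing.Theory Num.Theory.

Local Open Scope classical_set_scope.
Local Open Scope ring_scope.

Local Notation ev p x := ((map_poly intr p : {poly algC}).[x]).

(**
Attach to the complex roots al_1, ..., al_n of f the matrix A with rows
(al_i^(n-1), ..., al_i, 1).  The Hermite form of f is, up to the factor
f_0^(n-1), the product of the linear forms given by the rows of A.  So if g has
the same leading coefficient and a root matrix A W with W unimodular, then f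
and g are Hermite equivalent.  Conversely a Hermite equivalence identifies two
products of n linear forms; these factor uniquely, so the root matrices agree up
to a monomial matrix whose determinant is controlled, and the discriminant is an
invariant of the Hermite class.  Therefore a set of polynomials has infinitely
many split classes as soon as it contains pairs (f, g) that are Hermite
equivalent, not GL_2(Z)-equivalent, and of unbounded discriminant
([disc_hermite_equiv], [infinite_split_classes]).

Irreducible pairs.  Let U and V be the polynomials with
x^n - y^n = (x - y) U(xy) and x^n + y^n = V(xy) whenever x + y = 1, and put
f = c X^n + k U(cX - c^2 X^2).  With u = c x and K = c^(n-1) k one has
c^(n-1) f(x) = u^n + K U(u(1-u)), and at 1/c - x the term u^n is replaced by
(1-u)^n.  The product of the two is symmetric in u and 1-u, hence a
polynomial in u(1-u): up to scaling it is g(x - c x^2) for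
g = c X^n + k (U V + K U^2)(cX), whose roots are thus be_i = al_i - c al_i^2.
The powers of be_i are integral combinations of 1, ..., al_i^(n-1), because
c al_i^n is one.  The resulting integral matrix W has
det W^2 = prod_(i<j) (1 - c (al_i + al_j))^2, and
prod_j (1 - c al_i - c al_j) = c^(n-1) f(1/c - al_i) = (1 - 2 u_i) U(u_i(1-u_i));
the factor 1 - 2 u_i is the one with j = i, and the remaining product of the
U(u_i(1-u_i)) = - u_i^n / K is 1 or -1 ([fam_hermite]).  Choosing k divisible
exactly once by a large prime p not dividing c makes both polynomials Eisenstein.
A GL_2(Z)-equivalence between them is triangular modulo p, and comparing
the coefficients of 1, X and X^2 forces 2 a^4 = 2 - n^2 modulo p with
a^n = 1 or -1, which fails for large p ([fam_not_gl2]).  The discriminant is a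
nonzero integer times c^(n-1) k^(n-1) ([fam_disc]).  For c = 1 the pairs are
monic.  For general c both are congruent to k modulo c, so a leading coefficient
of a GL_2(Z)-transform is congruent to k r^n or - k r^n; if k times an n-th power
is never 1 or -1 modulo c, the pairs are properly non-monic
([power_residue_obstruction], [properly_nonmonic_mod]).

Reducible pairs.  X^n + a X^2 + X and X^n + a X^(n-1) + X have the common root 0
and otherwise mutually inverse roots.  Both maps al -> be and be -> al are given by
integral polynomials, so they are Hermite equivalent; an elementary look at the
coefficients of 1 and X^2 excludes GL_2(Z)-equivalence when a > 2 and n - 1 does
not divide a ([recip_hermite], [recip_not_gl2]).

The quartics.  f = X^4 + 5 X^2 + X + 4 and g = 2 X^4 + X^3 + 4 X^2 + X + 3 both
have the prime discriminant 7537.  If be is a root of g then 2 be^2 + be + 2 is a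
root of f, and this substitution maps the basis of R_f to a basis of R_g.  A
Hermite equivalence would yield integers x_0, ..., x_3 where the Hermite form of g
takes the value 1 or -1, since the form of f takes the value 1 at (0, 0, 0, 1).
This is impossible: over the reals the form of g is 8 N N' for two positive
definite binary quadratic forms N and N' in linear forms of x, which a unit of R_g
rescales by about 9.9 and its inverse.  Hence a representation of 1 can be
balanced until N and N' are both small, which leaves a finite box without
solutions ([nonmonic_form_neq_sign]).
*)

(** * Hermite forms and discriminants in terms of roots *)

(** Roots are indexed by ordinals, in any order, so that they can label the
    rows of a matrix. *)
Definition has_roots (n : nat) (f : {poly int}) (al : 'I_n -> algC) : Prop :=
  map_poly intr f = (lead_coef f)%:~R *: \prod_(i < n) ('X - (al i)%:P).

Definition rootmx (n : nat) (al : 'I_n -> algC) : 'M[algC]_n :=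
  \matrix_(i, j) al i ^+ (n.-1 - j).

Lemma lead_neq0 n f : has_degree n f -> (lead_coef f)%:~R != 0 :> algC.
Proof. by move=> sz; rewrite intr_eq0 lead_coef_eq0 -size_poly_eq0 sz. Qed.

Lemma size_complex_roots n f : has_degree n f -> size (complex_roots f) = n.
Proof.
move=> sz; have := congr1 (fun p : {poly algC} => size p) (complex_rootsP f).
rewrite size_scale ?(lead_neq0 sz) // size_prod_XsubC size_map_inj_poly //.
  by rewrite sz => -[].
exact: intr_inj.
Qed.

Lemma complex_roots_has_roots n f : has_degree n f ->
  @has_roots n f (fun i => (complex_roots f)`_i).
Proof.
move=> sz; rewrite /has_roots complex_rootsP; congr (_ *: _).
by rewrite (big_nth 0) (size_complex_roots sz) big_mkord.
Qed.

Lemma has_roots_perm n f (al : 'I_n -> algC) : has_degree n f ->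
  has_roots f al -> perm_eq (complex_roots f) (codom al).
Proof.
move=> sz; rewrite /has_roots complex_rootsP => /(scalerI (lead_neq0 sz)).
by move=> h; apply: prod_XsubC_eq; rewrite h big_image.
Qed.

Lemma has_roots_horner n f (al : 'I_n -> algC) (x : algC) : has_roots f al ->
  (map_poly intr f).[x] = (lead_coef f)%:~R * \prod_(i < n) (x - al i).
Proof.
move=> ->; rewrite hornerZ horner_prod; congr (_ * _).
by apply: eq_bigr => i _; rewrite !hornerE.
Qed.

Lemma has_roots_root n f (al : 'I_n -> algC) i : has_roots f al ->
  (map_poly intr f).[al i] = 0.
Proof.
by move=> h; rewrite (has_roots_horner _ h) (bigD1 i) //= subrr mul0r mulr0.
Qed.

Lemma hermite_formE n f (al : 'I_n -> algC) : has_degree n f -> has_roots f al ->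
  hermite_form n f = ((lead_coef f)%:~R ^+ n.-1 : algC) *:
    \prod_(i < n) \sum_(j < n) (al i ^+ (n.-1 - j)) *: 'X_j.
Proof.
move=> sz h; rewrite /hermite_form; congr (_ *: _).
by rewrite (perm_big _ (has_roots_perm sz h)) /= big_image.
Qed.

Lemma hermite_form_eval n f (al : 'I_n -> algC) (v : 'cV[algC]_n) :
  has_degree n f -> has_roots f al ->
  (hermite_form n f).@[fun i => v i 0] =
    (lead_coef f)%:~R ^+ n.-1 * \prod_(i < n) (rootmx al *m v) i 0.
Proof.
move=> sz h; rewrite (hermite_formE sz h) mevalZ rmorph_prod; congr (_ * _).
apply: eq_bigr => i _ /=; rewrite raddf_sum /= !mxE; apply: eq_bigr => j _.
by rewrite mevalZ mevalXU mxE.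
Qed.

Lemma lin_subst_eval n (U : 'M[int]_n) (p : {mpoly algC[n]}) (v : 'cV[algC]_n) :
  (lin_subst U p).@[fun i => v i 0] =
  p.@[fun i => (map_mx intr U *m v) i 0].
Proof.
rewrite /lin_subst comp_mpoly_meval; apply: meval_eq => i.
rewrite tnth_mktuple raddf_sum /= mxE; apply: eq_bigr => j _.
by rewrite mevalZ mevalXU mxE.
Qed.

Lemma hermite_equiv_roots n f g (al be : 'I_n -> algC) (W : 'M[int]_n) :
  has_degree n f -> has_degree n g -> has_roots f al -> has_roots g be ->
  lead_coef f = lead_coef g -> W \in unitmx ->
  rootmx be = rootmx al *m map_mx intr W ->
  hermite_equiv n g f.
Proof.
move=> szf szg hf hg eql Wu eqW; split=> //; exists W => //.
exists false; rewrite expr0 scale1r.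
rewrite (hermite_formE szf hf) (hermite_formE szg hg) eql /lin_subst comp_mpolyZ.
congr (_ *: _); rewrite rmorph_prod /=; apply: eq_bigr => i _.
rewrite raddf_sum /=.
under eq_bigr => k _ do rewrite comp_mpolyZ comp_mpolyXU -tnth_nth tnth_mktuple scaler_sumr.
rewrite exchange_big /=; apply: eq_bigr => j _.
have := congr1 (fun M : 'M_n => M i j) eqW; rewrite !mxE => ->.
by rewrite scaler_suml; apply: eq_bigr => k _; rewrite !mxE scalerA.
Qed.

Lemma hermite_equiv_refl n f : has_degree n f -> hermite_equiv n f f.
Proof.
move=> sz; have h := complex_roots_has_roots sz.
apply: (hermite_equiv_roots sz sz h h) => //; first exact: unitmx1.
by rewrite map_mx1 mulmx1.
Qed.

Lemma det_rootmx_sqr n (al : 'I_n -> algC) :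
  \det (rootmx al) ^+ 2 =
  \prod_(i < n) \prod_(j < n | (i < j)%N) (al i - al j) ^+ 2.
Proof.
have -> : rootmx al =
    (row_perm (perm (@rev_ord_inj n)) (Vandermonde n (\row_i al i)))^T.
  apply/matrixP=> i j; rewrite !mxE permE /=; congr (_ ^+ _).
  by case: j => j /= lt_jn; lia.
rewrite det_tr row_permE det_mulmx det_perm exprMn sqrr_sign mul1r det_Vandermonde.
rewrite -prodrXl; apply: eq_bigr => i _; rewrite -prodrXl; apply: eq_bigr => j _.
by rewrite !mxE -sqrrN opprB.
Qed.

Lemma discE n f (al : 'I_n -> algC) : has_degree n f -> has_roots f al ->
  disc f = (lead_coef f)%:~R ^+ (2 * n - 2) * \det (rootmx al) ^+ 2.
Proof.
move=> sz h; rewrite /disc (sz : size f = _) /=; congr (_ * _).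
rewrite -(det_rootmx_sqr (fun i => (complex_roots f)`_i)).
have szr := size_complex_roots sz.
have := has_roots_perm sz h.
have -> : codom al = [tuple al i | i < n] by rewrite /= codomE.
move=> /tuple_permP[s eqs].
have -> : rootmx (fun i => (complex_roots f)`_i) = row_perm s (rootmx al).
  apply/matrixP=> i j; rewrite !mxE; congr (_ ^+ _).
  by rewrite eqs -tnth_nth !tnth_mktuple.
by rewrite row_permE det_mulmx det_perm exprMn sqrr_sign mul1r.
Qed.

Lemma unitz_sqr (u : int) : (u \is a GRing.unit) = (u ^+ 2 == 1).
Proof. by rewrite sqrf_eq1. Qed.

(** A nonzero polynomial cannot vanish at all natural numbers. *)
Lemma poly_algC_ext (p q : {poly algC}) : (forall z, p.[z] = q.[z]) -> p = q.
Proof.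
move=> h; apply/eqP; rewrite -subr_eq0; apply/negPn/negP => nz.
pose s : seq algC := [seq m%:R | m <- iota 0 (size (p - q)%R)].
have : (size s < size (p - q)%R)%N.
  apply: max_poly_roots => //.
    by apply/allP => t _; rewrite rootE hornerD hornerN h subrr.
  rewrite map_inj_uniq ?iota_uniq //; exact: (@mulrIn algC 1 (oner_neq0 _)).
by rewrite size_map size_iota ltnn.
Qed.

(** Unique factorization of x_1 ... x_n: each coordinate divides one of the forms
    on the left, so T is a monomial matrix, and its determinant is up to sign the
    product k of its entries.  The divisibility is found by substituting powers of
    one parameter for all coordinates but one: a product of polynomials in one
    variable vanishes, so one of them does. *)
Lemma prod_linear_forms n (T : 'M[algC]_n) (k : algC) : k != 0 ->
  (forall y : 'cV[algC]_n, \prod_i (T *m y) i 0 = k * \prod_i y i 0) ->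
  \det T ^+ 2 = k ^+ 2.
Proof.
move=> k0 hT.
(* The i-th form at the point with j-th coordinate 0 and m-th coordinate X^m. *)
pose P (j i : 'I_n) : {poly algC} := \poly_(l < n)
  (if insub l is Some m then if m == j then 0 else T i m else 0).
have hP j : exists i, P j i == 0.
  suff /eqP : \prod_i P j i = 0 by case/prodf_eq0 => i _; exists i.
  apply: poly_algC_ext => t; rewrite horner0 horner_prod.
  have := hT (\col_m (if m == j then 0 else t ^+ m)).
  rewrite [X in _ = _ * X -> _](bigD1 j) //= mxE eqxx mul0r mulr0 => <-.
  apply: eq_bigr => i _; rewrite horner_poly mxE; apply: eq_bigr => m _.
  rewrite !mxE valK; case: eqP; by rewrite ?mul0r ?mulr0.
pose row j := xchoose (hP j).
have rowP j m : m != j -> T (row j) m = 0.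
  move=> mj; have /eqP/(congr1 (fun p : {poly algC} => p`_m)) := xchooseP (hP j).
  by rewrite coef0 coef_poly ltn_ord valK (negbTE mj).
have hT1 := hT (const_mx 1); move: hT1.
rewrite [X in _ = _ * X -> _]big1 => [hT1|i _]; last by rewrite mxE.
have nz i : (T *m (const_mx 1 : 'cV_n)) i 0 != 0.
  apply/negP => /eqP e; move: hT1; rewrite (bigD1 i) //= e mul0r mulr1 => /esym/eqP.
  exact/negP.
have Trow j : (T *m (const_mx 1 : 'cV_n)) (row j) 0 = T (row j) j.
  rewrite mxE (bigD1 j) //= mxE mulr1 big1 ?addr0 // => m mj.
  by rewrite rowP // mul0r.
have row_inj : injective row.
  move=> j j' e; apply/eqP/negPn/negP => jj'.
  have := nz (row j); rewrite Trow e rowP ?eqxx //.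
pose s := perm row_inj.
have eT : row_perm s T = diag_mx (\row_j T (row j) j).
  apply/matrixP=> i j; rewrite !mxE permE; case: (eqVneq i j) => [->|ij] //.
  by rewrite rowP 1?eq_sym.
have := congr1 (fun M : 'M_n => \det M ^+ 2) eT.
rewrite row_permE det_mulmx det_perm exprMn sqrr_sign mul1r => ->.
congr (_ ^+ 2); rewrite det_diag -[k]mulr1 -hT1 [RHS](reindex_inj row_inj) /=.
by apply: eq_bigr => j _; rewrite mxE Trow.
Qed.

(** The two root matrices A and B satisfy prod (B y)_i = k prod (A y)_i, so that
    A B^-1 is monomial; the power of the leading coefficients in k is the one by
    which the discriminant is normalized. *)
Lemma disc_hermite_equiv n f g : hermite_equiv n f g -> disc g != 0 ->
  disc f = disc g.
Proof.
case=> szf szg [U Uu [e]] eqU dg.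
have hf := complex_roots_has_roots szf; have hg := complex_roots_has_roots szg.
set al := (fun i => _) in hf; set be := (fun i => _) in hg.
pose a : algC := (lead_coef f)%:~R; pose b : algC := (lead_coef g)%:~R.
have a0 : a != 0 := lead_neq0 szf.
have b0 : b != 0 := lead_neq0 szg.
have dB : \det (rootmx be) != 0.
  apply: contraNneq dg => d0.
  by rewrite (discE szg hg) d0 expr0n mulr0.
pose A := rootmx al; pose B := rootmx be *m map_mx intr U.
have dU : (\det (map_mx intr U : 'M[algC]_n)) ^+ 2 = 1.
  by rewrite det_map_mx -rmorphXn /=; move: Uu; rewrite unitmxE unitz_sqr => /eqP ->.
have dBU : B \in unitmx.
  rewrite unitmxE unitfE /B det_mulmx mulf_neq0 //.
  by apply: contra_eq_neq dU => ->; rewrite expr0n eq_sym oner_eq0.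
pose k := (-1) ^+ e * (a ^+ n.-1 / b ^+ n.-1).
have a1 : a ^+ n.-1 != 0 by rewrite expf_neq0.
have b1 : b ^+ n.-1 != 0 by rewrite expf_neq0.
have hT (y : 'cV[algC]_n) :
    \prod_i (B *m y) i 0 = k * \prod_i (A *m y) i 0.
  have := congr1 (fun p : {mpoly algC[n]} => p.@[fun i => y i 0]) eqU.
  rewrite /= lin_subst_eval [RHS]mevalZ (hermite_form_eval y szf hf).
  rewrite (hermite_form_eval (map_mx intr U *m y) szg hg) mulmxA -/B -/A -/a -/b => eqk.
  by apply: (mulfI b1); rewrite eqk /k; field.
have k0 : k != 0 by rewrite /k !mulf_neq0 ?signr_eq0 ?invr_eq0.
have hT' (y : 'cV[algC]_n) :
    \prod_i ((A *m invmx B) *m y) i 0 = k^-1 * \prod_i y i 0.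
  by rewrite -mulmxA; apply: (mulfI k0); rewrite -hT mulKVmx // mulVKf.
have := prod_linear_forms (invr_neq0 k0) hT'.
rewrite det_mulmx det_inv exprMn => eqd.
rewrite (discE szf hf) (discE szg hg) -/a -/b -/A.
have e2 : (2 * n - 2 = n.-1 * 2)%N by lia.
have dB2 : \det B ^+ 2 = \det (rootmx be) ^+ 2 by rewrite det_mulmx exprMn dU mulr1.
have dB0 : \det B != 0 by move: dBU; rewrite unitmxE unitfE.
have -> : \det A ^+ 2 = k^-1 ^+ 2 * \det B ^+ 2.
  by rewrite -eqd exprVn divfK // expf_neq0.
rewrite e2 dB2 !exprM /k invfM exprMn exprVn sqrr_sign invr1 mul1r invf_div.
by field.
Qed.

Lemma ev_coef n (p : {poly int}) (x : algC) : (size p <= n)%N ->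
  ev p x = \sum_(k < n) (p`_k)%:~R * x ^+ k.
Proof.
move=> sz; rewrite (@horner_coef_wide _ n) ?(leq_trans (size_poly _ _)) //.
by apply: eq_bigr => k _; rewrite coef_map.
Qed.

(** The weights [la] cover both uses: constant 1 for a change of roots, and
    multiplication by an element of the order. *)
Lemma rootmx_poly n (la al be : 'I_n -> algC) :
  (forall j, (j < n)%N -> exists2 w : {poly int}, (size w <= n)%N &
     forall i, la i * be i ^+ j = ev w (al i)) ->
  exists W : 'M[int]_n, diag_mx (\row_i la i) *m rootmx be = rootmx al *m map_mx intr W.
Proof.
move=> h; pose P (j : 'I_n) (w : {poly int}) :=
  [/\ (size w <= n)%N & forall i, la i * be i ^+ (n.-1 - j) = ev w (al i)].
have /choice[w hw] : forall j, exists w, P j w.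
  by move=> j; have [|w sw ew] := h (n.-1 - j)%N; [case: j => j /=; lia|exists w].
exists (\matrix_(k, j) (w j)`_(n.-1 - k)); apply/matrixP=> i j.
have [sw ew] := hw j; rewrite mul_diag_mx !mxE ew (ev_coef _ sw).
rewrite (reindex_inj rev_ord_inj) /=; apply: eq_bigr => k _.
have -> : (n - k.+1 = n.-1 - k)%N by lia.
by rewrite !mxE mulrC.
Qed.

Lemma poly_mod_monic n (f p : {poly int}) : has_degree n f -> f \is monic ->
  exists2 w : {poly int}, (size w <= n)%N &
    forall x : algC, ev f x = 0 -> ev p x = ev w x.
Proof.
move=> sz mf; exists (Pdiv.CommonRing.rmodp p f).
  by rewrite -ltnS -(sz : size f = _) Pdiv.CommonRing.ltn_rmodp monic_neq0.
move=> x fx; rewrite {1}(Pdiv.RingMonic.rdivp_eq mf p).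
by rewrite rmorphD rmorphM /= hornerD hornerM fx mulr0 add0r.
Qed.

Lemma det_rootmx_neq0 n (al : 'I_n -> algC) : injective al -> \det (rootmx al) != 0.
Proof.
move=> inj; rewrite -sqrf_eq0 det_rootmx_sqr; apply/prodf_neq0 => i _.
apply/prodf_neq0 => j ij; rewrite expf_neq0 // subr_eq0 (inj_eq inj).
by apply: contraTneq ij => ->; rewrite ltnn.
Qed.

(** Distinct roots make the root matrix invertible over the field, where the two
    integral matrices are therefore inverse to each other. *)
Lemma unitmx_of_inverse n (al be : 'I_n -> algC) (W W' : 'M[int]_n) : injective al ->
  rootmx be = rootmx al *m map_mx intr W ->
  rootmx al = rootmx be *m map_mx intr W' -> W \in unitmx.
Proof.
move=> inj -> /(congr1 determinant); rewrite !det_mulmx -mulrA => e.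
have : \det (map_mx intr W : 'M[algC]_n) * \det (map_mx intr W' : 'M[algC]_n) = 1.
  by apply: (mulfI (det_rootmx_neq0 inj)); rewrite mulr1.
rewrite !det_map_mx -rmorphM /= -[RHS](rmorph1 intr) => /intr_inj dW.
by rewrite unitmxE; apply/unitrPr; exists (\det W').
Qed.

(** The absolute value of the discriminant of a representative with nonzero
    discriminant does not depend on the representative, hence would take finitely
    many values on a finite set of classes. *)
Lemma infinite_split_classes n (S : set {poly int}) :
  (forall N : nat, exists f g : {poly int},
    [/\ S f /\ S g, hermite_equiv n g f, ~ gl2_equiv n f g & N%:R < `|disc f|]) ->
  infinite_set (split_classes n S).
Proof.
move=> h fin.
pose d (C : set {poly int}) : algC :=
  `|disc (xget 0 [set f | C f /\ disc f != 0])|.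
have /finite_seqP[s es] := finite_image d fin.
(* A bound for all values of d on the finite set of classes. *)
pose B : algC := \sum_(x <- s) `|x|.
have B0 : 0 <= B by apply: sumr_ge0.
have [f [g [[Sf Sg] gf ngl bf]]] := h (Num.bound B).
have df : disc f != 0.
  by rewrite -normr_gt0; apply: le_lt_trans bf; rewrite ler0n.
have [szg szf _] := gf.
have : d (hermite_class n g) \in s.
  have : (d @` split_classes n S) (d (hermite_class n g)).
    exists (hermite_class n g) => //; exists g => //; split=> //.
    exists f, g; split=> //; exact: hermite_equiv_refl.
  by rewrite es.
have -> : d (hermite_class n g) = `|disc f|.
  rewrite /d; case: xgetP => [f' _ [gf' df']|/(_ f)]; last by case; split.
  by rewrite -(disc_hermite_equiv gf df) -(disc_hermite_equiv gf' df').
move=> ins; have : `|disc f| <= B.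
  by rewrite /B (big_rem _ ins) /= normr_id lerDl sumr_ge0.
by move=> /(lt_le_trans bf)/lt_trans/(_ (archi_boundP B0)); rewrite ltxx.
Qed.

Lemma det_mx22 (R : comPzRingType) (M : 'M[R]_2) :
  \det M = M 0 0 * M 1 1 - M 0 1 * M 1 0.
Proof.
rewrite (expand_det_row _ 0) !big_ord_recl big_ord0 addr0 /cofactor.
rewrite !det_mx11 !mxE /= expr0 expr1 mul1r mulN1r mulrN.
by congr (M _ _ * M _ _ - M _ _ * M _ _); apply/val_inj.
Qed.

(** Clearing denominators in the field of fractions. *)
Lemma gl2_equiv_poly n f g : gl2_equiv n f g ->
  exists a b r s : int, exists e : bool, (a * s - b * r) ^+ 2 = 1 /\
    g = (-1) ^+ e *: \sum_(i < n.+1)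
      f`_i *: ((a *: 'X + b%:P) ^+ i * (r *: 'X + s%:P) ^+ (n - i)).
Proof.
case=> szf szg [M Mu [e]] /= eqg.
exists (M 0 0), (M 0 1), (M 1 0), (M 1 1), e.
set a := M 0 0 in eqg *; set b := M 0 1 in eqg *.
set r := M 1 0 in eqg *; set s := M 1 1 in eqg *.
have dM : (a * s - b * r) ^+ 2 = 1.
  by move: Mu; rewrite unitmxE unitz_sqr det_mx22 => /eqP.
split=> //.
have den0 : r *: 'X + s%:P != 0 :> {poly int}.
  apply: contra_eq_neq dM => /polyP e0; have := e0 0%N; have := e0 1%N.
  rewrite !coefD !coefZ !coefX !coefC /= mulr1 mulr0 addr0 add0r => -> ->.
  by rewrite !mulr0 subr0 expr0n.
apply/eqP; rewrite -tofrac_eq; apply/eqP.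
have tden : tofrac (r *: 'X + s%:P) != 0 by rewrite tofrac_eq0.
rewrite eqg -mulrA mulr_sign scaler_sign; set S := (X in _ = tofrac (if _ then - X else X)).
suff eS : tofrac S = tofrac (r *: 'X + s%:P) ^+ n * (map_poly (@tofrac _ \o polyC) f).[
    tofrac (a *: 'X + b%:P) / tofrac (r *: 'X + s%:P)].
  by rewrite -eS; case: (e); rewrite // tofracN.
rewrite (@horner_coef_wide _ n.+1); last first.
  by rewrite (leq_trans (size_poly _ _)) // szf.
rewrite mulr_sumr rmorph_sum; apply: eq_bigr => i _.
rewrite coef_map_id0 /=; last exact: tofrac0.
rewrite -mul_polyC tofracM tofracM !tofracXn expr_div_n.
have -> : tofrac (r *: 'X + s%:P) ^+ n =
   tofrac (r *: 'X + s%:P) ^+ i * tofrac (r *: 'X + s%:P) ^+ (n - i).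
  by rewrite -exprD subnKC // -ltnS.
have := expf_neq0 i tden.
move: (tofrac (r *: 'X + s%:P) ^+ i) (tofrac (r *: 'X + s%:P) ^+ (n - i)).
move: (tofrac (a *: 'X + b%:P) ^+ i) (tofrac (f`_i)%:P) => u v w z w0.
by rewrite [RHS]mulrCA; congr (_ * _); rewrite [RHS]mulrC -mulrA mulKf.
Qed.

(** * The discriminant through the derivative *)

Lemma prod_offdiag n (t : 'I_n -> 'I_n -> algC) :
  \prod_i \prod_(j | j != i) t i j =
  \prod_(i < n) \prod_(j < n | (i < j)%N) (t i j * t j i).
Proof.
have -> : \prod_i \prod_(j | j != i) t i j =
   (\prod_(i < n) \prod_(j < n | (i < j)%N) t i j) *
   \prod_(i < n) \prod_(j < n | (j < i)%N) t i j.
  rewrite -big_split /=; apply: eq_bigr => i _.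
  rewrite (bigID (fun j : 'I_n => (i < j)%N)) /=; congr (_ * _); apply: eq_bigl => j.
    by rewrite -(inj_eq val_inj) /=; lia.
  by rewrite -(inj_eq val_inj) /=; lia.
rewrite [X in _ * X](exchange_big_dep xpredT) //= -big_split /=.
by apply: eq_bigr => i _; rewrite big_split.
Qed.

Lemma ev_deriv (f : {poly int}) (x : algC) :
  (map_poly intr f : {poly algC})^`().[x] = ev f^`() x.
Proof. by rewrite deriv_map. Qed.

Lemma has_roots_deriv n f (al : 'I_n -> algC) i : has_roots f al ->
  ev f^`() (al i) = (lead_coef f)%:~R * \prod_(j | j != i) (al i - al j).
Proof.
move=> h; rewrite -ev_deriv h derivZ hornerZ (bigD1 i) //= derivM !hornerE.
rewrite derivXsubC hornerC mul1r subrr mul0r addr0 horner_prod; congr (_ * _).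
by apply: eq_bigr => j _; rewrite !hornerE.
Qed.

(** Each pair i < j occurs twice in the product of the derivatives. *)
Lemma norm_disc n f (al : 'I_n -> algC) : (2 <= n)%N -> has_degree n f ->
  has_roots f al ->
  `|disc f| = `|(lead_coef f)%:~R| ^+ (n - 2) * \prod_i `|ev f^`() (al i)|.
Proof.
move=> n2 sz h; rewrite (discE sz h) det_rootmx_sqr.
under [X in _ = _ * X]eq_bigr => i _ do rewrite (has_roots_deriv i h) normrM.
rewrite big_split /= prodr_const card_ord mulrA -exprD normrM normrX.
have -> : (n - 2 + n = 2 * n - 2)%N by lia.
congr (_ * _); rewrite -normr_prod prod_offdiag !normr_prod.
apply: eq_bigr => i _; rewrite !normr_prod; apply: eq_bigr => j _.
by rewrite normrX normrM [`|al j - _|]distrC expr2.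
Qed.

(** A multiple root is a common root of f and its derivative, which are coprime
    over the rationals. *)
Lemma irreducible_roots_inj n f (al : 'I_n -> algC) : has_degree n f -> 
  irreducible_poly f -> has_roots f al -> injective al.
Proof.
move=> sz irr h i j eij; apply/eqP/negPn/negP => ij.
pose fQ : {poly rat} := map_poly intr f.
have irrQ : irreducible_poly fQ by apply/irreducible_rat_int.
have fQC : map_poly ratr fQ = map_poly intr f :> {poly algC}.
  by rewrite -map_poly_comp; apply: eq_map_poly => x /=; rewrite ratr_int.
have cop : coprimep fQ fQ^`().
  have s1 : (1 < size fQ)%N by case: irrQ.
  have f0 : fQ != 0 by rewrite -size_poly_gt0 (ltn_trans _ s1).
  have d0 : fQ^`() != 0.
    apply/eqP => /polyP/(_ (size fQ).-2); rewrite coef_deriv coef0 => /eqP.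
    rewrite mulrn_eq0 /=; have -> : (size fQ).-2.+1 = (size fQ).-1 by lia.
    by rewrite -lead_coefE lead_coef_eq0 (negbTE f0).
  rewrite irreducible_poly_coprime //; apply/negP => /dvdp_leq-/(_ d0).
  by rewrite leqNgt lt_size_deriv.
have copC : coprimep (map_poly ratr fQ : {poly algC}) (map_poly ratr fQ^`()).
  by rewrite coprimep_map.
have := coprimep_root copC; rewrite fQC => /(_ (al i)).
rewrite rootE (has_roots_root i h) eqxx => /(_ isT).
rewrite -deriv_map fQC ev_deriv (has_roots_deriv i h) (bigD1 j) /=; last by rewrite eq_sym.
by rewrite eij subrr mul0r mulr0 eqxx.
Qed.

(** * Lucas polynomials and the irreducible family *)

(** The companion sequences U_n and V_n of Lucas with parameters 1 and X, as
    polynomials in the second parameter. *)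
Fixpoint lucU (n : nat) : {poly int} :=
  match n with
  | 0 => 0
  | 1 => 1
  | (m.+1 as k).+1 => lucU k - 'X * lucU m
  end.

Definition lucV (n : nat) : {poly int} := lucU n.+1 *+ 2 - lucU n.

Lemma lucUSS n : lucU n.+2 = lucU n.+1 - 'X * lucU n. Proof. by []. Qed.

Arguments lucU : simpl never.

Lemma nat_ind2 (P : nat -> Prop) :
  P 0%N -> P 1%N -> (forall n, P n -> P n.+1 -> P n.+2) -> forall n, P n.
Proof.
move=> P0 P1 PS n; suff : P n /\ P n.+1 by case.
by elim: n => [|n [Pn Pn1]]; split=> //; apply: PS.
Qed.

Lemma evD p q (x : algC) : ev (p + q) x = ev p x + ev q x.
Proof. by rewrite rmorphD hornerD. Qed.
Lemma evN p (x : algC) : ev (- p) x = - ev p x.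
Proof. by rewrite rmorphN hornerN. Qed.
Lemma evM p q (x : algC) : ev (p * q) x = ev p x * ev q x.
Proof. by rewrite rmorphM hornerM. Qed.
Lemma evXn p n (x : algC) : ev (p ^+ n) x = ev p x ^+ n.
Proof. by rewrite rmorphXn horner_exp. Qed.
Lemma evX (x : algC) : ev 'X x = x.
Proof. by rewrite map_polyX hornerX. Qed.
Lemma ev_Xn n (x : algC) : ev 'X^n x = x ^+ n.
Proof. by rewrite map_polyXn hornerXn. Qed.
Lemma evC c (x : algC) : ev c%:P x = c%:~R.
Proof. by rewrite map_polyC hornerC. Qed.
Lemma evZ c p (x : algC) : ev (c *: p) x = c%:~R * ev p x.
Proof. by rewrite linearZ hornerZ. Qed.
Lemma evMn p n (x : algC) : ev (p *+ n) x = ev p x *+ n.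
Proof. by rewrite rmorphMn hornerMn. Qed.
Lemma ev_comp p q (x : algC) : ev (p \Po q) x = ev p (ev q x).
Proof. by rewrite map_comp_poly horner_comp. Qed.
Lemma ev0 (x : algC) : ev 0 x = 0.
Proof. by rewrite rmorph0 horner0. Qed.
Lemma ev1 (x : algC) : ev 1 x = 1.
Proof. by rewrite rmorph1 hornerC. Qed.

Definition evE := (evD, evN, evM, evXn, ev_Xn, evX, evC, evZ, evMn, ev_comp, ev0, ev1).

Lemma lucUE n (x : algC) :
  x ^+ n - (1 - x) ^+ n = (x *+ 2 - 1) * ev (lucU n) (x * (1 - x)).
Proof.
elim/nat_ind2: n => [||n IH0 IH1].
- by rewrite !evE mulr0 subrr.
- by rewrite !evE; ring.
rewrite lucUSS !evE mulrBr mulrCA -IH0 -IH1 !exprS; ring.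
Qed.

Lemma lucVE n (x : algC) :
  x ^+ n + (1 - x) ^+ n = ev (lucV n) (x * (1 - x)).
Proof.
rewrite /lucV; elim/nat_ind2: n => [||n IH0 IH1].
- by rewrite /= !evE; ring.
- by rewrite /= !evE; ring.
transitivity (x ^+ n.+1 + (1 - x) ^+ n.+1 - x * (1 - x) * (x ^+ n + (1 - x) ^+ n)).
  by rewrite !exprS; ring.
by rewrite IH0 IH1 !lucUSS !evE; ring.
Qed.

Lemma size_lucU n : ((size (lucU n)).*2 <= n.+1)%N.
Proof.
elim/nat_ind2: n => [||n IH0 IH1]; rewrite ?size_poly0 ?size_poly1 //.
rewrite lucUSS.
have := size_polyD (lucU n.+1) (- ('X * lucU n)); rewrite size_polyN.
have := size_polyMleq 'X (lucU n); rewrite size_polyX.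
move: IH0 IH1; set a := size (lucU n); set b := size (lucU n.+1).
set m := size ('X * _); set t := size (lucU n.+1 - 'X * lucU n) => ha hb hm ht.
lia.
Qed.

Lemma size_lucV n : ((size (lucV n)).*2 <= n.+2)%N.
Proof.
rewrite /lucV -scaler_nat.
have := size_polyD (2%:R *: lucU n.+1) (- lucU n); rewrite size_polyN.
have := size_scale_leq (2%:R : int) (lucU n.+1).
have := size_lucU n; have := size_lucU n.+1.
set a := size (lucU n); set b := size (lucU n.+1).
set m := size (2%:R *: lucU n.+1); set t := size (2%:R *: lucU n.+1 - lucU n).
lia.
Qed.

Lemma coefXl (p : {poly int}) i : ('X * p)`_i.+1 = p`_i.
Proof. by rewrite mulrC coefMX. Qed.
Lemma coefXl0 (p : {poly int}) : ('X * p)`_0 = 0.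
Proof. by rewrite mulrC coefMX. Qed.

Lemma lucU_coef0 n : (lucU n.+1)`_0 = 1.
Proof.
elim/nat_ind2: n => [||n IH0 IH1]; rewrite ?lucUSS.
- by rewrite coef1.
- by rewrite coefD coefN coefXl0 coef1.
by rewrite coefD coefN coefXl0 subr0.
Qed.

Lemma lucU_coef1 n : (lucU n.+2)`_1 = - (n%:R : int).
Proof.
elim: n => [|n IH]; rewrite lucUSS coefD coefN coefXl ?coef0 ?coef1 //.
by rewrite lucU_coef0 IH; lia.
Qed.

Lemma lucU_coef2 n : (lucU n.+3)`_2 *+ 2 = n%:R * (n%:R - 1) :> int.
Proof.
elim: n => [|n IH].
  by rewrite !lucUSS !(coefD, coefN, coefXl, coef1, coef0).
by rewrite lucUSS coefD coefN coefXl mulrnBl IH lucU_coef1; lia.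
Qed.

Lemma lucV_coef0 n : (lucV n.+1)`_0 = 1.
Proof. by rewrite coefB coefMn !lucU_coef0. Qed.
Lemma lucV_coef1 n : (lucV n.+2)`_1 = - (n.+2%:R : int).
Proof. by rewrite coefB coefMn !lucU_coef1; lia. Qed.
Lemma lucV_coef2 n : (lucV n.+3)`_2 *+ 2 = n%:R * n.+3%:R :> int.
Proof. by rewrite coefB coefMn mulrnBl !lucU_coef2; lia. Qed.

Definition fam_q n (c : int) : {poly int} := lucU n \Po (c *: 'X - c ^+ 2 *: 'X^2).
Definition fam_f n (c k : int) : {poly int} := c *: 'X^n + k *: fam_q n c.
Definition fam_r n (c k : int) : {poly int} :=
  (lucU n * lucV n + (c ^+ n.-1 * k) *: lucU n ^+ 2) \Po (c *: 'X).
Definition fam_g n (c k : int) : {poly int} := c *: 'X^n + k *: fam_r n c k.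

Lemma size_fam_q n c : (0 < n)%N -> (size (fam_q n c) <= n)%N.
Proof.
move=> n0; have := size_comp_poly_leq (lucU n) (c *: 'X - c ^+ 2 *: 'X^2).
have : (size (c *: 'X - c ^+ 2 *: 'X^2)%R <= 3)%N.
  apply: leq_trans (size_polyD _ _) _; rewrite size_polyN geq_max.
  by rewrite !(leq_trans (size_scale_leq _ _)) // ?size_polyX ?size_polyXn.
set s := size (c *: 'X - c ^+ 2 *: 'X^2); set t := size (lucU n \Po _).
have := size_lucU n; set u := size (lucU n) => hu hs ht.
apply: leq_trans ht _; have : (u.-1 * s.-1 <= u.-1 * 2)%N by rewrite leq_mul2l; lia.
lia.
Qed.

Lemma size_fam_r n c k : (0 < n)%N -> (size (fam_r n c k) <= n)%N.
Proof.
move=> n0; set p := lucU n * lucV n + (c ^+ n.-1 * k) *: lucU n ^+ 2.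
have hp : (size p <= n)%N.
  apply: leq_trans (size_polyD _ _) _; rewrite geq_max; apply/andP; split.
    apply: leq_trans (size_polyMleq _ _) _.
    have := size_lucU n; have := size_lucV n; lia.
  apply: leq_trans (size_scale_leq _ _) _; rewrite expr2.
  apply: leq_trans (size_polyMleq _ _) _.
  have := size_lucU n; lia.
apply: leq_trans (size_comp_poly_leq _ _) _.
have : (size (c *: 'X)%R <= 2)%N by rewrite (leq_trans (size_scale_leq _ _)) ?size_polyX.
rewrite -/p; set s := size (c *: 'X); set t := size p in hp * => hs.
have : (t.-1 * s.-1 <= t.-1 * 1)%N by rewrite leq_mul2l; lia.
lia.
Qed.

Section AddLow.
Variables (n : nat) (c k : int) (q : {poly int}).
Hypotheses (c0 : c != 0) (szq : (size q <= n)%N).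
Let f := c *: 'X^n + k *: q.

Lemma low_lt : (size (k *: q)%R < size (c *: 'X^n : {poly int})%R)%N.
Proof.
rewrite [X in (_ < X)%N]size_scale // size_polyXn ltnS.
exact: leq_trans (size_scale_leq _ _) szq.
Qed.
Lemma low_has_degree : has_degree n f.
Proof. by rewrite /has_degree size_polyDl ?low_lt // size_scale // size_polyXn. Qed.
Lemma low_lead : lead_coef f = c.
Proof. by rewrite lead_coefDl ?low_lt // lead_coefZ lead_coefXn mulr1. Qed.
End AddLow.

Lemma poly_split0 (p : {poly int}) :
  exists2 p' : {poly int}, p = (p`_0)%:P + 'X * p' & forall i, p'`_i = p`_i.+1.
Proof.
exists (drop_poly 1 p) => [|i]; last by rewrite coef_drop_poly addn1.
by apply/polyP => -[|i]; rewrite coefD coefC ?coefXl0 ?addr0 // coefXl coef_drop_poly addn1 add0r.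
Qed.

Lemma coef_comp_low (p : {poly int}) (a b : int) :
  let h := p \Po (a *: 'X + b *: 'X^2) in
  [/\ h`_0 = p`_0, h`_1 = p`_1 * a & h`_2 = p`_1 * b + p`_2 * a ^+ 2].
Proof.
have [p1 ep c1] := poly_split0 p; have [p2 ep1 c2] := poly_split0 p1.
have [p3 ep2 c3] := poly_split0 p2; rewrite /=.
have eq : a *: 'X + b *: 'X^2 = 'X * (a%:P + b *: 'X) :> {poly int}.
  by rewrite mulrDr -!mul_polyC expr2; ring.
rewrite [in _ \Po _]ep [in _ \Po _]ep1 [in _ \Po _]ep2 eq.
rewrite !(comp_polyD, comp_polyM, comp_polyC, comp_polyX).
set q := a%:P + b *: 'X; set z := p3 \Po _.
have q0 : q`_0 = a by rewrite coefD coefC coefZ coefX mulr0 addr0.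
have q1 : q`_1 = b by rewrite coefD coefC coefZ coefX mulr1 add0r.
rewrite -!mulrA; set D := q * ((p2`_0)%:P + _).
have D0 : D`_0 = a * p2`_0 by rewrite coef0M q0 coefD coefC coefXl0 addr0.
split; first by rewrite coefD coefC coefXl0 addr0.
  by rewrite coefD coefC coefXl add0r coef0M q0 coefD coefC coefXl0 addr0 c1 mulrC.
rewrite coefD coefC coefXl add0r mulrDr mulrCA coefD coefXl coefMC coef0M.
by rewrite q0 q1 D0 c2 !c1; ring.
Qed.

Lemma fam_qE n c : fam_q n c = lucU n \Po (c *: 'X + (- c ^+ 2) *: 'X^2).
Proof. by rewrite scaleNr. Qed.

(** Only the residues of these coefficients matter, but twice the quadratic one is
    simpler to write than the quotient. *)
Lemma fam_q_coef n c :
  [/\ (fam_q n.+3 c)`_0 = 1, (fam_q n.+3 c)`_1 = - (c * n.+1%:R)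
    & (fam_q n.+3 c)`_2 *+ 2 = c ^+ 2 * (n%:R * (n%:R - 1) + n.+1%:R *+ 2)].
Proof.
rewrite fam_qE; have /= [-> -> ->] := coef_comp_low (lucU n.+3) c (- c ^+ 2).
rewrite lucU_coef0 lucU_coef1 mulrnDl -[_ *+ 2 in X in _ + X]mulrnAl lucU_coef2.
rewrite -natr1; move: (n%:R : int) => N; clear.
by split; [|ring|ring].
Qed.

(** Modulo k only the product U V contributes, and the constant coefficient is
    needed exactly for the Eisenstein criterion. *)
Lemma fam_r_coef n c k (p := lucU n.+3 * lucV n.+3) : exists y1 y2 : int,
  [/\ (fam_r n.+3 c k)`_0 = 1 + c ^+ n.+2 * k,
    (fam_r n.+3 c k)`_1 = - (c * (2 * n.+2)%N%:R) + k * y1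
    & (fam_r n.+3 c k)`_2 = c ^+ 2 * (n.+1 * n.*2.+3)%:R + k * y2].
Proof.
have -> : fam_r n.+3 c k = (p + (c ^+ n.+2 * k) *: lucU n.+3 ^+ 2) \Po (c *: 'X + 0 *: 'X^2).
  by rewrite scale0r addr0.
exists (c * c ^+ n.+2 * (lucU n.+3 ^+ 2)`_1), (c ^+ 2 * c ^+ n.+2 * (lucU n.+3 ^+ 2)`_2).
have /= [-> -> ->] := coef_comp_low (p + (c ^+ n.+2 * k) *: lucU n.+3 ^+ 2) c 0.
have [u1 eu u1c] := poly_split0 (lucU n.+3).
have [v1 ev v1c] := poly_split0 (lucV n.+3).
have p0 : p`_0 = 1 by rewrite /p coef0M lucU_coef0 lucV_coef0.
have p1 : p`_1 = - (2 * n.+2)%N%:R.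
  rewrite /p eu ev lucU_coef0 lucV_coef0 mulrDl mul1r mulrDr mulr1 -mulrA.
  rewrite !coefD !coefXl coefC /= add0r coef0M coefXl0 mulr0 addr0 u1c v1c.
  by rewrite lucU_coef1 lucV_coef1; lia.
have p2 : p`_2 = (n.+1 * n.*2.+3)%:R.
  rewrite /p eu ev lucU_coef0 lucV_coef0 mulrDl mul1r mulrDr mulr1 -mulrA.
  rewrite !coefD !coefXl coefC /= add0r mulrCA coefXl coef0M u1c v1c.
  have := lucU_coef2 n; have := lucV_coef2 n; rewrite u1c v1c.
  rewrite lucU_coef1 lucV_coef1; lia.
rewrite !coefD !coefZ p0 p1 p2 [in X in [/\ X, _ & _]]expr2 coef0M lucU_coef0.
move: (_`_1) (_`_2) (c ^+ n.+2) (_%:R) (_%:R) => X1 X2 C N1 N2; clear.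
by split; ring.
Qed.

(** * Hermite equivalence within the family *)

(** With S = Q(u), T = Q'(u) and E = al^(N-1) this is
    al f'(al) = k (u Q'(u) - N Q(u)), for C al^N + k Q(u) = 0. *)
Lemma euler_operator_identity (a C E T k S : algC) (N : nat) : C * (a * E) = - (k * S) ->
  a * (C * (E *+ N) + k * (T * C)) = k * (C * a * T - S *+ N).
Proof.
move=> e; rewrite -[E *+ N]mulr_natr -[S *+ N]mulr_natr.
move: (N%:R : algC) => M.
have -> : a * (C * (E * M) + k * (T * C)) = M * (C * (a * E)) + k * (C * a * T) by ring.
by rewrite e; ring.
Qed.

Section Family.
Variables (n : nat) (c k : int) (al : 'I_n -> algC).
Hypotheses (n2 : (2 <= n)%N) (c0 : 0 < c) (k0 : 0 < k).
Let f := fam_f n c k.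
Let g := fam_g n c k.
Hypothesis (hf : has_roots f al) (inj : injective al).

Let C : algC := c%:~R.
Let K : algC := C ^+ n.-1 * k%:~R.
Let be i := al i - C * al i ^+ 2.
Let u i := C * al i.
Let Un (z : algC) := ev (lucU n) z.

Let n0 : (0 < n)%N. Proof. exact: ltnW. Qed.
Let cn0 : c != 0. Proof. by rewrite gt_eqF. Qed.
Let C0 : 0 < C. Proof. by rewrite /C ltr0z. Qed.
Let Cn0 : C != 0. Proof. by rewrite gt_eqF. Qed.
Let K0 : 0 < K. Proof. by rewrite mulr_gt0 ?exprn_gt0 ?ltr0z. Qed.

Lemma fam_f_degree : has_degree n f.
Proof. exact: low_has_degree cn0 (size_fam_q c n0). Qed.
Lemma fam_g_degree : has_degree n g.
Proof. exact: low_has_degree cn0 (size_fam_r c k n0). Qed.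
Lemma fam_f_lead : lead_coef f = c.
Proof. exact: low_lead cn0 (size_fam_q c n0). Qed.
Lemma fam_g_lead : lead_coef g = c.
Proof. exact: low_lead cn0 (size_fam_r c k n0). Qed.

Let Un0 : Un 0 = 1.
Proof.
rewrite /Un horner_coef0 coef_map /=.
by have := lucU_coef0 n.-1; rewrite prednK // => ->.
Qed.

Lemma fam_q_ev x : ev (fam_q n c) x = Un (C * x * (1 - C * x)).
Proof.
rewrite /fam_q !evE /Un; congr (_.[_]).
by rewrite rmorphXn /= -/C; ring.
Qed.

Lemma fam_f_scaled x :
  C ^+ n.-1 * ev f x = (C * x) ^+ n + K * Un (C * x * (1 - C * x)).
Proof.
rewrite /f /fam_f evD !evZ ev_Xn fam_q_ev -/C mulrDr mulrA -exprSr prednK //.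
by rewrite exprMn /K mulrA.
Qed.

(** The value of g at x(1-x)/c, as the product of the values of f at the two
    preimages of this point. *)
Lemma fam_g_scaled y (x := C * y) :
  C ^+ n.-1 * ev g (y - C * y ^+ 2) =
  ((C * y) ^+ n + K * Un (x * (1 - x))) * ((1 - x) ^+ n + K * Un (x * (1 - x))).
Proof.
have e : C * (y - C * y ^+ 2) = x * (1 - x) by rewrite /x; ring.
rewrite /g /fam_g /fam_r evD !evZ ev_Xn ev_comp evZ evX evD evZ evXn evM -/C e -lucVE.
rewrite mulrDr mulrA -exprSr prednK // -exprMn e -/(Un _) rmorphM rmorphXn /= -/C.
rewrite [C ^+ n.-1 * (k%:~R * _)]mulrA -/K exprMn -/x; ring.
Qed.

Lemma fam_shift x : C ^+ n.-1 * ev f (C^-1 - x) =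
  (1 - C * x) ^+ n + K * Un (C * x * (1 - C * x)).
Proof.
rewrite fam_f_scaled mulrBr divff //; congr (_ + _ * Un _); ring.
Qed.

(** Every z is of the form y - c y^2, where g(z) factors into values of f, and
    likewise z - be_i = (y - al_i) c (1/c - y - al_i). *)
Lemma fam_g_roots : has_roots g be.
Proof.
apply: poly_algC_ext => z.
have [x ez] : exists x, z = x - C * x ^+ 2.
  pose p : {poly algC} := C *: 'X^2 + (z%:P - 'X).
  have sp : size p != 1%N.
    rewrite /p size_polyDl size_scale // size_polyXn //.
    by apply: leq_ltn_trans (size_polyD _ _) _; rewrite size_polyN size_polyX size_polyC; case: eqP.
  have [x ex] : exists x, p.[x] = 0 by have /closed_rootP[x /eqP] := sp; exists x.
  exists x; rewrite -[RHS]addr0 -ex /p !hornerD hornerZ hornerXn hornerN hornerC hornerX; ring.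
apply: (mulfI (expf_neq0 n.-1 Cn0)).
rewrite {1}ez fam_g_scaled -fam_shift -fam_f_scaled !(has_roots_horner _ hf).
rewrite hornerZ horner_prod fam_f_lead fam_g_lead -/C ez.
under [in RHS]eq_bigr => i _.
  rewrite hornerXsubC.
  have -> : x - C * x ^+ 2 - be i = (x - al i) * (C * (C^-1 - x - al i)).
    by rewrite /be; field; exact: Cn0.
  over.
rewrite !big_split /= prodr_const card_ord.
have -> : C ^+ n = C * C ^+ n.-1 by rewrite -exprS prednK.
set P := \prod_i _; set Q := \prod_i _; ring.
Qed.

Let rt i : C * al i ^+ n = - (k%:~R * Un (u i * (1 - u i))).
Proof.
have := has_roots_root i hf; rewrite /f /fam_f evD !evZ ev_Xn fam_q_ev -/C.
by move=> /eqP; rewrite addr_eq0 => /eqP.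
Qed.

(** The relation c al^n = - k q(al) has integral coefficients, so each factor c
    pays for lowering the exponent once. *)
Lemma fam_pow_red m : exists2 w : {poly int}, (size w <= n)%N &
  forall i, C ^+ m * al i ^+ (n.-1 + m) = ev w (al i).
Proof.
elim: m => [|m [w sw ew]].
  by exists 'X^(n.-1) => [|i]; rewrite ?size_polyXn ?prednK // addn0 mul1r ev_Xn.
exists (c *: ('X * take_poly n.-1 w) - (w`_(n.-1) * k) *: fam_q n c) => [|i].
  apply: leq_trans (size_polyD _ _) _; rewrite size_polyN geq_max.
  rewrite !(leq_trans (size_scale_leq _ _)) ?size_fam_q //.
  apply: leq_trans (size_polyMleq _ _) _; rewrite size_polyX.
  have := size_take_poly n.-1 w; lia.
have ewl : w = take_poly n.-1 w + w`_(n.-1) *: 'X^(n.-1).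
  apply/polyP => j; rewrite coefD coef_take_poly coefZ coefXn.
  case: ltngtP => [_|h|->]; rewrite ?mulr0 ?addr0 ?mulr1 ?add0r //.
  by rewrite nth_default // (leq_trans sw) //; lia.
rewrite addnS !exprS mulrACA ew [in LHS]ewl evD evZ ev_Xn.
rewrite !(evD, evN, evZ, evM, evX) fam_q_ev -/C rmorphM /=.
have := rt i; rewrite -(prednK n0) exprS prednK //.
set E := al i ^+ _; set T := ev _ _; set W := (w`_ _)%:~R => e.
rewrite mulrDr; congr (_ + _); first by ring.
by rewrite mulrCA -mulrA e mulrN -mulrA.
Qed.

Let rep (F : 'I_n -> algC) := exists2 w : {poly int}, (size w <= n)%N &
  forall i, F i = ev w (al i).

(** In (al (1 - c al))^j the power al^(j+l) comes with the factor c^l, enough to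
    reduce it below n. *)
Lemma fam_be_pow j : (j < n)%N -> rep (fun i => 1 * be i ^+ j).
Proof.
move=> jn.
have repD F G : rep F -> rep G -> rep (fun i => F i + G i).
  move=> [w sw ew] [v sv ev']; exists (w + v) => [|i].
    by rewrite (leq_trans (size_polyD _ _)) // geq_max sw.
  by rewrite evD ew ev'.
have repZ (z : int) F : rep F -> rep (fun i => z%:~R * F i).
  move=> [w sw ew]; exists (z *: w) => [|i]; last by rewrite evZ ew.
  exact: leq_trans (size_scale_leq _ _) sw.
have repS (G : nat -> 'I_n -> algC) m : (forall l, (l < m)%N -> rep (G l)) ->
    rep (fun i => \sum_(l < m) G l i).
  elim: m => [|m IH] hG.
    by exists 0 => [|i]; rewrite ?size_poly0 // big_ord0 ev0.
  have [w sw ew] := repD _ _ (IH (fun l h => hG l (ltnW h))) (hG m (ltnSn m)).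
  by exists w => // i; rewrite big_ord_recr /= ew.
have repM l : (l <= j)%N -> rep (fun i => C ^+ l * al i ^+ (j + l)).
  move=> lj; case: (ltnP (j + l) n) => h.
    exists (c ^+ l *: 'X^(j + l)) => [|i]; last by rewrite evZ ev_Xn rmorphXn.
    by rewrite (leq_trans (size_scale_leq _ _)) // size_polyXn.
  pose m := (j + l - n.-1)%N.
  have [w sw ew] := repZ (c ^+ (l - m)) _ (fam_pow_red m).
  exists w => // i; rewrite -ew rmorphXn /= -/C mulrA -exprD; congr (_ ^+ _ * _ ^+ _).
    by rewrite /m; lia.
  by rewrite /m; lia.
have [w sw ew] := repS (fun l i => ((-1) ^+ l * ('C(j, l))%:R : int)%:~R *
    (C ^+ l * al i ^+ (j + l))) j.+1 (fun l h => repZ _ _ (repM l h)).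
exists w => // i; rewrite -ew mul1r.
have -> : be i = al i * (1 - u i) by rewrite /be /u; ring.
rewrite exprMn exprBn mulr_sumr; apply: eq_bigr => l _.
rewrite expr1n mulr1 -mulr_natr exprMn exprD rmorphM rmorphXn /= rmorphN1 rmorph_nat.
ring.
Qed.

Let onemu i : 1 - u i *+ 2 != 0.
Proof.
apply/eqP => e.
have eu : u i = 2^-1.
  by apply: (mulIf (x := 2)); rewrite ?pnatr_eq0 // mulVf ?pnatr_eq0 // mulr_natr; apply/esym/eqP; rewrite -subr_eq0 e.
have := rt i; move/(congr1 (fun z => C ^+ n.-1 * z)).
rewrite mulrA -exprSr prednK // -exprMn -/(u i) mulrN mulrA -/K eu.
have -> : 2^-1 * (1 - 2^-1) = 4^-1 :> algC by field.
(* At x = y = 1/2 the limit of (x^m - y^m) / (x - y) is positive. *)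
have lucq m : ev (lucU m) 4^-1 = m%:R * 2 / 2 ^+ m.
  elim/nat_ind2: m => [||m IH0 IH1]; first by rewrite ev0 !mul0r.
    by rewrite ev1; field.
  rewrite lucUSS evD evN evM evX IH0 IH1 -!natr1 !exprS; field.
  by rewrite expf_neq0 // add0r -[1]/(1%:R) -natrD pnatr_eq0.
rewrite /Un lucq exprVn => /eqP; rewrite -subr_eq0 opprK; apply/negP.
rewrite gt_eqF // ltr_wpDr ?invr_gt0 ?exprn_gt0 ?ltr0n //.
by rewrite mulr_ge0 ?(ltW K0) // divr_ge0 ?exprn_ge0 ?mulr_ge0 ?ler0n.
Qed.

(** det W^2 is computed by splitting be_i - be_j = (al_i - al_j)(1 - c(al_i + al_j)).
    The full products over j are values of f, and their diagonal factors cancel. *)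
Lemma fam_matrix : exists2 W : 'M[int]_n,
  W \in unitmx & rootmx be = rootmx al *m map_mx intr W.
Proof.
have [W eW] := rootmx_poly fam_be_pow.
have {}eW : rootmx be = rootmx al *m map_mx intr W.
  rewrite -eW -[LHS]mul1mx; congr (_ *m _).
  by rewrite -diag_const_mx; congr diag_mx; apply/rowP=> i; rewrite !mxE.
exists W => //; rewrite unitmxE unitz_sqr.
(* be_i - be_j = (al_i - al_j) t_ij, and t_ii = 1 - 2 u_i. *)
pose t i j := 1 - C * (al i + al j).
have cst (x : algC) : x ^+ n = \prod_(i < n) x by rewrite prodr_const card_ord.
have dW : (\det W)%:~R ^+ 2 = \prod_(i < n) \prod_(j < n | (i < j)%N) t i j ^+ 2.
  have := det_rootmx_sqr be; rewrite eW det_mulmx exprMn det_map_mx.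
  under eq_bigr => i _.
    under eq_bigr => j _.
      have -> : be i - be j = (al i - al j) * t i j by rewrite /be /t; ring.
      rewrite exprMn; over.
    rewrite big_split; over.
  rewrite big_split /= -det_rootmx_sqr; apply: mulfI.
  by rewrite expf_neq0 // det_rootmx_neq0.
have tprod i : \prod_j t i j = (1 - u i *+ 2) * Un (u i * (1 - u i)).
  have -> : \prod_j t i j = C ^+ n.-1 * ev f (C^-1 - al i).
    rewrite (has_roots_horner _ hf) fam_f_lead -/C mulrA -exprSr prednK //.
    rewrite (cst C) -big_split; apply: eq_bigr => j _ /=.
    by rewrite /t; field; exact: Cn0.
  rewrite fam_shift -/(u i).
  have := lucUE n (u i); rewrite -/(Un _) => e.
  have := congr1 (fun z => C ^+ n.-1 * z) (rt i).
  rewrite mulrA -exprSr prednK // -exprMn -/(u i) mulrN mulrA -/K => eu.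
  rewrite -[LHS]opprK opprD -eu addrC e; ring.
(* The product left when the diagonal factors are cancelled. *)
pose D : algC := \prod_i Un (u i * (1 - u i)).
have dWD : (\det W)%:~R ^+ 2 = D.
  have nz : \prod_i (1 - u i *+ 2) != 0 by apply/prodf_neq0 => i _.
  apply: (mulfI nz); rewrite dW /D -[RHS]big_split /=.
  under [in RHS]eq_bigr => i _ do rewrite -tprod.
  under [in RHS]eq_bigr => i _ do rewrite (bigD1 i) //=.
  rewrite [RHS]big_split /= prod_offdiag; congr (_ * _).
    by apply: eq_bigr => i _; rewrite /t /u; ring.
  apply: eq_bigr => i _; apply: eq_bigr => j _.
  by rewrite expr2 [t j i](_ : _ = t i j) // /t [al j + _]addrC.
(* D (-K)^n = prod u_i^n, and prod u_i = K or - K from the constant coefficient. *)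
have KD : (D * (- K) ^+ n) ^+ 2 = (K ^+ n) ^+ 2.
  have -> : D * (- K) ^+ n = (\prod_i u i) ^+ n.
    rewrite (cst (- K)) -big_split -prodrXl.
    apply: eq_bigr => i _ /=.
    have := congr1 (fun z => C ^+ n.-1 * z) (rt i).
    by rewrite mulrA -exprSr prednK // -exprMn -/(u i) => ->; rewrite /K; ring.
  have -> : \prod_i u i = (-1) ^+ n * K.
    have := has_roots_horner 0 hf.
    rewrite fam_f_lead -/C => e; rewrite /u big_split prodr_const card_ord /=.
    have -> : \prod_i al i = (-1) ^+ n * \prod_i (0 - al i).
      rewrite (cst (-1)) -big_split /=.
      by apply: eq_bigr => i _; rewrite mulN1r sub0r opprK.
    rewrite mulrCA; congr (_ * _).
    have -> : C ^+ n = C ^+ n.-1 * C by rewrite -exprSr prednK.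
    rewrite -mulrA -e fam_f_scaled !mulr0 mul0r expr0n gtn_eqF // add0r.
    by rewrite Un0 mulr1.
  by rewrite !exprMn [(_ ^+ n) ^+ 2 in X in X * _]exprAC sqrr_sign expr1n mul1r.
have : (D ^+ 2 == 1).
  rewrite -dWD in KD *; move: KD; rewrite exprMn -!exprM mulnC [(- K) ^+ _]exprM sqrrN -exprM.
  by rewrite -[RHS]mul1r => /(mulIf (expf_neq0 _ (lt0r_neq0 K0))) ->.
rewrite -dWD -!rmorphXn /= -[1](rmorph1 intr) eqr_int sqrf_eq1.
by case/orP => // /eqP e; have := sqr_ge0 (\det W); rewrite e.
Qed.

Lemma fam_hermite : hermite_equiv n g f.
Proof.
have [W Wu eW] := fam_matrix.
apply: (hermite_equiv_roots fam_f_degree fam_g_degree hf fam_g_roots _ Wu eW).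
by rewrite fam_f_lead fam_g_lead.
Qed.

(** Euler's operator replaces al f'(al) by k r(c al) with r integral; the c al_i are
    integral over Z, so the product of the r(c al_i) is a determinant of an integral
    matrix, and it is nonzero because f has simple roots. *)
Lemma fam_disc : k%:~R <= `|disc f|.
Proof.
pose Q := fam_q n 1; pose phi := fam_f n 1 (c ^+ n.-1 * k).
have mphi : phi \is monic.
  by rewrite monicE /phi /fam_f low_lead ?oner_eq0 // size_fam_q.
have dphi : has_degree n phi by apply: low_has_degree; rewrite ?oner_eq0 ?size_fam_q.
have Qev x : ev Q x = Un (x * (1 - x)).
  by rewrite /Q /fam_q !evE /Un; congr (_.[_]); rewrite rmorphXn rmorph1 /=; ring.
have phiu i : ev phi (u i) = 0.
  rewrite /phi /fam_f evD !evZ ev_Xn Qev rmorph1 mul1r rmorphM rmorphXn /= -/C -/K.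
  have := congr1 (fun z => C ^+ n.-1 * z) (rt i).
  by rewrite mulrA -exprSr prednK // -exprMn -/(u i) mulrN mulrA -/K => ->; rewrite addNr.
have qE : fam_q n c = Q \Po (c *: 'X).
  rewrite /Q /fam_q -comp_polyA; congr (_ \Po _).
  rewrite expr1n !scale1r comp_polyB comp_polyX comp_Xn_poly.
  by rewrite exprZn.
move: qE Qev; move: Q => Q qE Qev.
pose r := 'X * Q^`() - Q *+ n.
have fr i : al i * ev f^`() (al i) = k%:~R * ev r (u i).
  rewrite /f /fam_f qE derivD !derivZ derivXn deriv_comp derivZ derivX.
  rewrite !(evD, evZ, evMn, evM, evN, ev_Xn, evX, ev_comp, ev1) -/C -/(u i) mulr1.
  have := rt i; rewrite -Qev -(prednK n0) exprS prednK //.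
  exact: euler_operator_identity.
have [W eW] : exists W : 'M[int]_n,
    diag_mx (\row_i ev r (u i)) *m rootmx u = rootmx u *m map_mx intr W.
  apply: rootmx_poly => j _.
  have [w sw ew] := poly_mod_monic (r * 'X^j) dphi mphi.
  by exists w => // i; rewrite -(ew _ (phiu i)) evM ev_Xn.
have injU : injective u by move=> i j /(mulfI Cn0)/inj.
have dW : \prod_i ev r (u i) = (\det W)%:~R.
  apply: (mulIf (det_rootmx_neq0 injU)).
  have := congr1 determinant eW; rewrite !det_mulmx det_diag det_map_mx [RHS]mulrC => <-.
  by congr (_ * _); apply: eq_bigr => i _; rewrite mxE.
have aln : \prod_i `|al i| = k%:~R / C.
  have := congr1 Num.norm (has_roots_horner 0 hf).
  rewrite fam_f_lead -/C normrM normr_prod gtr0_norm //.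
  under eq_bigr => i _ do rewrite sub0r normrN.
  move=> e; apply: (mulfI Cn0); rewrite -e mulrCA divff // mulr1.
  have := fam_f_scaled 0; rewrite !mulr0 mul0r expr0n gtn_eqF // add0r Un0.
  rewrite mulr1 => /(mulfI (expf_neq0 _ Cn0)) ->.
  by rewrite gtr0_norm // ltr0z.
have kR : (0 : algC) < k%:~R by rewrite ltr0z.
have eq : `|disc f| = C ^+ n.-1 * k%:~R ^+ n.-1 * `|(\det W)%:~R|.
  apply: (mulIf (x := \prod_i `|al i|)); first by rewrite aln mulf_neq0 ?invr_eq0 // gt_eqF.
  rewrite {1}(norm_disc n2 fam_f_degree hf) fam_f_lead -/C gtr0_norm // -[LHS]mulrA.
  rewrite -[X in _ * X = _]big_split /=.
  under eq_bigr => i _ do rewrite mulrC -normrM fr normrM gtr0_norm //.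
  rewrite big_split /= prodr_const card_ord -normr_prod dW aln.
  have -> : C ^+ n.-1 = C * C ^+ (n - 2) by rewrite -exprS; congr (_ ^+ _); lia.
  have -> : (k%:~R : algC) ^+ n = k%:~R * k%:~R ^+ n.-1 by rewrite -exprS prednK.
  by field; exact: Cn0.
have nzW : \det W != 0.
  rewrite -(intr_eq0 algC) -dW; apply/prodf_neq0 => i _.
  have : ev f^`() (al i) != 0.
    rewrite (has_roots_deriv i hf) mulf_neq0 ?fam_f_lead //.
    by apply/prodf_neq0 => j ji; rewrite subr_eq0 (inj_eq inj) eq_sym.
  move=> nz; apply/eqP => e; have := fr i; rewrite e mulr0 => /eqP.
  rewrite mulf_eq0 (negbTE nz) orbF => /eqP a0.
  have : \prod_i `|al i| = 0 by rewrite (bigD1 i) //= a0 normr0 mul0r.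
  by rewrite aln => /eqP; rewrite mulf_eq0 invr_eq0 (negbTE Cn0) orbF gt_eqF.
have C1 : 1 <= C by rewrite /C -[1](rmorph1 intr) ler_int; lia.
have k1 : 1 <= (k%:~R : algC) by rewrite -[1](rmorph1 intr) ler_int; lia.
rewrite eq -intr_norm.
have W1 : 1 <= (`|\det W|)%:~R :> algC.
  by rewrite -[1](rmorph1 intr) ler_int; move: nzW; rewrite -normr_gt0; lia.
have k2 : (k%:~R : algC) <= k%:~R ^+ n.-1 by rewrite ler_eXnr //; lia.
have k3 : 0 <= (k%:~R : algC) ^+ n.-1 by rewrite exprn_ge0 // ltW.
have C2 : 1 <= C ^+ n.-1 by rewrite exprn_ege1.
apply: le_trans k2 _; apply: le_trans (ler_peMl k3 C2) _.
by rewrite ler_peMr // mulr_ge0 // (le_trans ler01).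
Qed.

End Family.

(** * Irreducibility and inequivalence within the family *)

Lemma const_dvd_unit (f g h : {poly int}) : coprimez (lead_coef f) f`_0 ->
  f = g * h -> size g = 1%N -> g \is a GRing.unit.
Proof.
move=> cop e /eqP/size_poly1P[d d0 eg]; rewrite poly_unitE eg size_polyC d0 /= coefC /=.
have dl : (d %| lead_coef f)%Z by rewrite e eg mul_polyC lead_coefZ dvdz_mulr.
have d1 : (d %| f`_0)%Z by rewrite e eg mul_polyC coefZ dvdz_mulr.
have : (d %| gcdz (lead_coef f) f`_0)%Z by rewrite dvdz_gcd dl.
by rewrite (eqP cop) dvdz1 unitz_sqr; lia.
Qed.

(** Coprimality of two coefficients makes f primitive, so no constant factor is
    left besides the units. *)
Lemma irreducible_Z_of_coprime (f : {poly int}) : irreducible_poly f ->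
  coprimez (lead_coef f) f`_0 -> irreducible_Z f.
Proof.
move=> irr cop; have [s1 hf] := irr; have f0 := irredp_neq0 irr.
split=> //.
  by rewrite poly_unitE; case: eqP => // e; rewrite e in s1.
move=> g h e.
have [sg|sg] := eqVneq (size g) 1%N; first by left; apply: const_dvd_unit cop e sg.
right; have eh : f = h * g by rewrite mulrC.
apply: const_dvd_unit cop eh _.
have gf : g %| f by rewrite e dvdp_mulIl.
have := eqp_size (hf g sg gf); move: f0; rewrite e mulf_eq0 negb_or => /andP[g0 h0].
rewrite size_mul // => es; move: es; rewrite (polySpred h0) (polySpred g0) /=; lia.
Qed.

Section Eisenstein.
Variables (n : nat) (p : nat) (c k : int) (q : {poly int}).
Hypotheses (n1 : (0 < n)%N) (pp : prime p) (szq : (size q <= n)%N).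
Hypotheses (pc : ~~ (p %| c)%Z) (pk : (p %| k)%Z) (pk2 : ~~ (p ^+ 2 %| k * q`_0)%Z).
Hypothesis (cop : coprimez c (k * q`_0)).
Let f := c *: 'X^n + k *: q.

Lemma low_neq0 : c != 0.
Proof. by apply: contraNneq pc => ->; rewrite dvdz0. Qed.

Lemma low_coef i : (i < n)%N -> f`_i = k * q`_i.
Proof. by move=> h; rewrite coefD !coefZ coefXn ltn_eqF // mulr0 add0r. Qed.

Lemma low_irreducible : irreducible_poly f.
Proof.
have sz := low_has_degree k low_neq0 szq.
apply: (@eisenstein_crit p) => //.
- by rewrite (sz : size f = _); lia.
- by rewrite low_lead // low_neq0.
- by rewrite low_coef.
by move=> i; rewrite (sz : size f = _) /= => h; rewrite low_coef // dvdz_mulr.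
Qed.

Lemma low_irreducible_Z : irreducible_Z f.
Proof.
apply: irreducible_Z_of_coprime; first exact: low_irreducible.
by rewrite low_coef // low_lead // low_neq0.
Qed.
End Eisenstein.

Lemma coef_lin_pow (R : comNzRingType) (a b : R) n j :
  ((a *: 'X + b%:P) ^+ n)`_j = a ^+ j * b ^+ (n - j) *+ 'C(n, j).
Proof.
rewrite addrC exprDn coef_sum.
have -> : \sum_(i < n.+1) (b%:P ^+ (n - i) * (a *: 'X) ^+ i *+ 'C(n, i))`_j =
  \sum_(i < n.+1) (if i == j :> nat then a ^+ j * b ^+ (n - j) *+ 'C(n, j) else 0).
  apply: eq_bigr => i _; rewrite coefMn exprZn -polyC_exp mul_polyC !coefZ coefXn.
  by rewrite eq_sym; case: eqP => [->|]; rewrite ?mulr0 ?mul0rn // mulr1 mulrC.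
rewrite -big_mkcond; case: (ltnP j n.+1) => h.
  by rewrite (big_pred1 (Ordinal h)) // => i; rewrite -(inj_eq val_inj).
rewrite big_pred0 ?bin_small // => i; apply/eqP => e; have := ltn_ord i; lia.
Qed.

Lemma gl2_action_low n (c k : int) (q : {poly int}) (T : nat -> {poly int}) :
  \sum_(i < n.+1) (c *: 'X^n + k *: q)`_i *: T i =
  c *: T n + k *: \sum_(i < n.+1) q`_i *: T i.
Proof.
have -> : c *: T n = \sum_(i < n.+1) (c * (i == n :> nat)%:R) *: T i.
  rewrite big_ord_recr /= eqxx mulr1 big1 ?add0r // => i _.
  by rewrite ltn_eqF // mulr0 scale0r.
rewrite scaler_sumr -big_split; apply: eq_bigr => i _.
by rewrite /= coefD !coefZ coefXn scalerDl scalerA.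
Qed.

(** Modulo c the polynomial f is the constant k, whose GL_2(Z)-transforms are
    k (r X + s)^n, with leading coefficient k r^n. *)
Lemma properly_nonmonic_mod n (c k : int) (f y : {poly int}) :
  has_degree n f -> f = k%:P + c *: y ->
  (forall x : int, ~~ (c %| k * x ^+ n - 1)%Z && ~~ (c %| k * x ^+ n + 1)%Z) ->
  properly_nonmonic n f.
Proof.
move=> sz ef nk [h mh] gl; have [_ szh _] := gl.
have [a [b [r [s [e [_ eh]]]]]] := gl2_equiv_poly gl.
have : h`_n = 1 by move/monicP: mh; rewrite lead_coefE szh.
rewrite eh; set T := fun i : nat => (a *: 'X + b%:P) ^+ i * (r *: 'X + s%:P) ^+ (n - i).
pose Y : {poly int} := \sum_(i < n.+1) y`_i *: T i.
have -> : \sum_(i < n.+1) f`_i *: ((a *: 'X + b%:P) ^+ i * (r *: 'X + s%:P) ^+ (n - i)) =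
   k *: T 0%N + c *: Y.
  rewrite /Y scaler_sumr big_ord_recl [in RHS]big_ord_recl addrA; congr (_ + _).
    by rewrite ef coefD coefC coefZ scalerDl scalerA.
  by apply: eq_bigr => i _; rewrite ef coefD coefC coefZ /= add0r scalerA.
rewrite coefZ coefD !coefZ {1}/T expr0 mul1r subn0 coef_lin_pow subnn binn mulr1 mulr1n.
set z := Y`_n; have /andP[n1 n2] := nk r.
clear eh; case: e => /=; rewrite ?expr0 ?mul1r ?expr1 ?mulN1r => e1.
  by case/negP: n2; apply/dvdzP; exists (- z); rewrite -e1; ring.
by case/negP: n1; apply/dvdzP; exists (- z); rewrite -e1; ring.
Qed.

(** The linear relation determines N r in terms of a and s; inserted into the
    quadratic one, all terms become multiples of a^2 and of s^2, and multiplication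
    by a^2 removes s^2, as (a s)^2 = 1. *)
Lemma gl2_residue (F : fieldType) (N c a r s t1 t2 u1 u2 w1 w2 C2 : F) :
  c != 0 -> t1 * s = 1 -> t2 * s ^+ 2 = 1 -> (a * s) ^+ 2 = 1 ->
  2 * C2 = N * (N - 1) -> u1 = - (N - 2) -> 2 * u2 = N ^+ 2 - 5 * N + 8 ->
  w1 = - (2 * N - 2) -> w2 = (2 * N - 3) * (N - 2) ->
  w1 * c = t1 * (N * r + u1 * c * a) ->
  w2 * c ^+ 2 = t2 * (C2 * r ^+ 2 + (N - 1) * u1 * c * a * r + u2 * c ^+ 2 * a ^+ 2) ->
  4 * a ^+ 4 = 4 - 2 * N ^+ 2.
Proof.
move=> c0 h1 h2 h3 hC hu1 hu2 hw1 hw2 e1 e2.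
have X : N * r = c * (w1 * s - u1 * a).
  have : w1 * c * s = t1 * s * (N * r + u1 * c * a) by rewrite e1; ring.
  by rewrite h1 mul1r => e; rewrite -[LHS](addrK (u1 * c * a)) -e; ring.
have Y : w2 * c ^+ 2 * s ^+ 2 =
    C2 * r ^+ 2 + (N - 1) * u1 * c * a * r + u2 * c ^+ 2 * a ^+ 2.
  by rewrite e2 mulrAC h2 mul1r.
have Z : c ^+ 2 * (4 * a ^+ 2) = c ^+ 2 * ((4 - 2 * N ^+ 2) * s ^+ 2).
  apply/eqP; rewrite -subr_eq0; apply/eqP.
  transitivity (2 * N * (C2 * r ^+ 2 + (N - 1) * u1 * c * a * r + u2 * c ^+ 2 * a ^+ 2)
                - 2 * N * (w2 * c ^+ 2 * s ^+ 2)); last by rewrite Y subrr.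
  transitivity ((2 * C2) * N * r ^+ 2 + 2 * (N - 1) * u1 * c * a * (N * r)
     + N * (2 * u2) * c ^+ 2 * a ^+ 2 - 2 * N * (w2 * c ^+ 2 * s ^+ 2)); last by ring.
  rewrite hC hu2.
  transitivity ((N - 1) * (N * r) ^+ 2 + 2 * (N - 1) * u1 * c * a * (N * r)
     + N * (N ^+ 2 - 5 * N + 8) * c ^+ 2 * a ^+ 2 - 2 * N * (w2 * c ^+ 2 * s ^+ 2)).
    by rewrite X hu1 hw1 hw2; ring.
  by ring.
have {}Z := mulfI (expf_neq0 2 c0) Z.
transitivity (4 * a ^+ 2 * a ^+ 2); first by ring.
by rewrite Z -mulrA -exprMn [s * a]mulrC h3 mulr1.
Qed.

(** The terms of (a X + b)^n of degree below n - 1 contain b^2, where p divides b, so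
    a factor p survives in them after division by p. *)
Lemma scaled_coef_identity (eps c A b p z k S : int) M :
  eps * (c * (A * (b * p * (b * p * z)) *+ M) + k * p * S) =
  eps * (c * (A * (b * (b * p * z)) *+ M) + k * S) * p.
Proof.
rewrite -[A * (b * p * _) *+ M]mulr_natr -[A * (b * _) *+ M]mulr_natr.
by move: (M%:R : int) => N; ring.
Qed.

Section NotGL2.
Variables (n m : nat) (p : nat) (c k : int).
Hypothesis en : n = m.+4.
Hypotheses (pp : prime p) (pbig : ((n ^ 2 - 2) ^ n + 2 ^ n < p)%N).
Hypotheses (pc : ~~ (p %| c)%Z) (pk : (p %| k)%Z) (pk2 : ~~ (p ^+ 2 %| k)%Z).

Local Notation phi z := (z%:~R : 'F_p).
Let phi0 z : (phi z == 0) = (p %| z)%Z.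
Proof. by rewrite -(dvdz_pcharf (pchar_Fp pp)). Qed.
Let n0 : (0 < n)%N. Proof. by rewrite en. Qed.

(** Modulo p both polynomials are c X^n, so the substitution has b = 0 modulo p and
    eps a^n = 1.  The coefficients of degree at most 2 of both sides are divisible
    by p; divided by k they give three more congruences, where only the first
    three coefficients of the lower part of f enter.  The resulting
    2 a^4 = 2 - n^2, raised to the n-th power, contradicts the size of p. *)
Lemma fam_not_gl2 : ~ gl2_equiv n (fam_f n c k) (fam_g n c k).
Proof.
move=> /gl2_equiv_poly[a [b [r [s [e [det]]]]]].
pose T := fun i : nat => (a *: 'X + b%:P) ^+ i * (r *: 'X + s%:P) ^+ (n - i).
pose q := fam_q n c; pose w := fam_r n c k.
pose S : {poly int} := \sum_(i < n.+1) q`_i *: T i.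
rewrite {1}/fam_f (gl2_action_low n c k q T) -/S => E.
have [eps eps2 Ec] : exists2 eps : int, eps ^+ 2 = 1 & forall j,
    c * (j == n)%:R + k * w`_j = eps * (c * ((a *: 'X + b%:P) ^+ n)`_j + k * S`_j).
  exists ((-1) ^+ e) => [|j]; first by rewrite sqrr_sign.
  have := congr1 (fun P : {poly int} => P`_j) E.
  by rewrite /fam_g coefZ !coefD !coefZ coefXn /T subnn expr0 mulr1.
clear E e.
have [kk ek] := dvdzP pk.
have pkk : phi kk != 0.
  rewrite phi0; apply: contra pk2; rewrite ek => /dvdzP[z ->].
  by apply/dvdzP; exists z; rewrite -mulrA expr2.
have p0 : (p%:Z != 0) by rewrite eqz_nat; case: (p) pp.
have eps0 : phi eps ^+ 2 = 1 by rewrite -rmorphXn eps2 rmorph1.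
have epsU : phi eps != 0 by apply: contra_eq_neq eps0 => ->; rewrite expr0n eq_sym oner_eq0.
have pc0 : phi c != 0 by rewrite phi0.
have pk0 : phi k = 0 by apply/eqP; rewrite phi0.
have pb : phi b = 0.
  have := Ec 0%N; rewrite coef_lin_pow subn0 bin0 mulr1n expr0 mul1r ltn_eqF // mulr0 add0r.
  move=> /(congr1 (fun z => phi z)); rewrite !(rmorphM, rmorphD, rmorphXn) /= pk0.
  rewrite !mul0r addr0 -[LHS](mulr0 (phi eps)) => /(mulfI epsU).
  by rewrite -[LHS](mulr0 (phi c)) => /(mulfI pc0)/esym/eqP; rewrite expf_eq0 n0 => /eqP.
have an : phi eps * phi a ^+ n = 1.
  have := Ec n; rewrite coef_lin_pow subnn binn mulr1n expr0 mulr1 eqxx mulr1.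
  move=> /(congr1 (fun z => phi z)); rewrite !(rmorphM, rmorphD, rmorphXn) /= pk0.
  by rewrite !mul0r !addr0 mulrCA -[LHS]mulr1 => /(mulfI pc0).
(* The coefficients of degree at most 2, divided by k, modulo p. *)
have cj j : (j <= 2)%N -> phi (w`_j) = phi eps * phi (S`_j).
  move=> j2; have := Ec j; rewrite coef_lin_pow ltn_eqF ?(leq_ltn_trans j2) ?en // -en mulr0 add0r.
  have /dvdzP[b' eb] : (p %| b)%Z by rewrite -phi0 pb.
  have -> : (n - j = (n - j).-2.+2)%N by move: j2; rewrite en; clear; lia.
  rewrite eb ek !exprS; set z := (b' * p%:Z) ^+ _ => e.
  have : kk * w`_j = eps * (c * (a ^+ j * (b' * (b' * p%:Z * z)) *+ 'C(n, j)) + kk * S`_j).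
    by apply: (mulIf p0); rewrite mulrAC e; exact: scaled_coef_identity.
  move=> /(congr1 (fun z => phi z)); rewrite -mulrnAr !(rmorphM, rmorphD, rmorphXn, rmorphMn) /=.
  have -> : phi p%:Z = 0 by apply/eqP; rewrite phi0 dvdzz.
  by rewrite !(mulr0, mul0r) mul0rn !mulr0 add0r mulrCA => /(mulfI pkk).
have Tj i j : phi ((T i)`_j) = if (j < i)%N then 0 else
    phi a ^+ i * (phi r ^+ (j - i) * phi s ^+ (n - i - (j - i)) *+ 'C(n - i, j - i)).
  rewrite -(coef_map (intr : int -> 'F_p)) /T rmorphM !rmorphXn !rmorphD /=.
  rewrite !linearZ /= !map_polyC /= !map_polyX pb addr0 exprZn -scalerAl coefZ coefXnM.
  by rewrite coef_lin_pow; case: ifP => _; rewrite ?mulr0.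
have Sj j : phi (S`_j) = \sum_(i < n.+1) phi q`_i * phi ((T i)`_j).
  by rewrite /S coef_sum rmorph_sum; apply: eq_bigr => i _; rewrite coefZ rmorphM.
have sum3 (F : nat -> 'F_p) : (forall i, (2 < i)%N -> F i = 0) ->
    \sum_(i < n.+1) F i = F 0%N + F 1%N + F 2%N.
  move=> F0; rewrite en; do 3 rewrite big_ord_recl; rewrite big1 /= => [|i _]; last by rewrite F0.
  by rewrite addr0 !addrA.
have S0 : phi (S`_0) = phi q`_0 * phi s ^+ n.
  rewrite Sj (sum3 (fun i => phi q`_i * phi ((T i)`_0))); last first.
    by move=> i i2; rewrite Tj ifT ?mulr0 // (leq_ltn_trans _ i2).
  rewrite !Tj /= ?mulr0 ?addr0.
  by rewrite !subn0 !expr0 !mul1r bin0.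
have S1 : phi (S`_1) = phi q`_0 * (phi r * phi s ^+ (n - 1) * n%:R) +
    phi q`_1 * (phi a * phi s ^+ (n - 1)).
  rewrite Sj (sum3 (fun i => phi q`_i * phi ((T i)`_1))); last first.
    by move=> i i2; rewrite Tj ifT ?mulr0 // (leq_ltn_trans _ i2).
  rewrite !Tj /= ?mulr0 ?addr0.
  by rewrite !subn0 !subnn !expr0 !expr1 !mul1r ?subn0 bin0 bin1 mulr1n mulr_natr.
have S2 : phi (S`_2) = phi q`_0 * (phi r ^+ 2 * phi s ^+ (n - 2) * ('C(n, 2))%:R) +
    phi q`_1 * (phi a * (phi r * phi s ^+ (n - 2) * (n - 1)%:R)) +
    phi q`_2 * (phi a ^+ 2 * phi s ^+ (n - 2)).
  rewrite Sj (sum3 (fun i => phi q`_i * phi ((T i)`_2))); last first.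
    by move=> i i2; rewrite Tj ifT ?mulr0 // (leq_ltn_trans _ i2).
  rewrite !Tj /= ?mulr0 ?addr0.
  rewrite !subn0 !subnn -!subnDA /= !expr0 !expr1 !mul1r bin0 bin1 mulr1n.
  by rewrite !mulr_natr.
have [q0 q1 q2] := fam_q_coef m.+1 c; have [y1 [y2 [w0 w1 w2]]] := fam_r_coef m.+1 c k.
rewrite -en -/q in q0 q1 q2; rewrite -en -/w in w0 w1 w2.
have eM1 : (m.+1%:R : int) = m%:R + 1 by rewrite natr1.
have eM2 : (m.+2%:R : int) = m%:R + 2 by rewrite -addn2 natrD.
have {}q1 : q`_1 = - (c * (m%:R + 2)) by rewrite q1 eM2.
have {}q2 : 2 * q`_2 = c ^+ 2 * ((m%:R + 1) * m%:R + 2 * (m%:R + 2)).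
  by rewrite mulr_natl q2 eM1 eM2; move: (m%:R : int) => M; ring.
have {}w1 : w`_1 = - (c * (2 * (m%:R + 3))) + k * y1.
  by rewrite w1 natrM -(natrD _ m 3) addn3.
have {}w2 : w`_2 = c ^+ 2 * ((m%:R + 2) * (2 * m%:R + 5)) + k * y2.
  rewrite w2 natrM eM2 (_ : m.+1.*2.+3 = 2 * m + 5)%N; last by clear; lia.
  by rewrite natrD natrM.
pose N : 'F_p := n%:R; pose M : 'F_p := m%:R.
have eN : N = M + 4 by rewrite /N en -addn4 natrD.
have [MM rM eMM] : exists2 MM : int, phi MM = M & m%:R = MM.
  by exists m%:R => //; rewrite rmorph_nat.
rewrite eMM in q1 q2 w1 w2.
have [F eF] : exists F : {rmorphism int -> 'F_p}, forall z, phi z = F z by exists intr.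
have rq1 : phi q`_1 = - (phi c * (M + 2)) by rewrite q1 -rM !eF; ring.
have rq2 : 2 * phi q`_2 = phi c ^+ 2 * ((M + 1) * M + 2 * (M + 2)).
  transitivity (phi (2 * q`_2)); first by rewrite !eF; ring.
  by rewrite q2 -?rM !eF; ring.
have rw1 : phi w`_1 = - (phi c * (2 * (M + 3))).
  by rewrite w1 rmorphD rmorphM /= pk0 -rM !eF; ring.
have rw2 : phi w`_2 = phi c ^+ 2 * ((M + 2) * (2 * M + 5)).
  by rewrite w2 rmorphD [X in _ + X]rmorphM /= pk0 -rM !eF; ring.
have es : phi eps * phi s ^+ n = 1.
  have := cj 0%N isT; rewrite w0 S0 q0 mul1r => <-.
  by rewrite rmorphD rmorphM /= pk0 mulr0 addr0.
have es1 : phi eps * phi s ^+ (n - 1) * phi s = 1.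
  by rewrite -mulrA -exprSr subn1 prednK.
have es2 : phi eps * phi s ^+ (n - 2) * phi s ^+ 2 = 1.
  by rewrite -mulrA -exprD subnK // en.
have as2 : (phi a * phi s) ^+ 2 = 1.
  have := congr1 (fun z => phi z) det; rewrite rmorphXn rmorphB !rmorphM /= pb mul0r subr0.
  by rewrite rmorph1.
have key : 4 * phi a ^+ 4 = 4 - 2 * N ^+ 2.
  apply: (@gl2_residue _ N (phi c) (phi a) (phi r) (phi s)
    (phi eps * phi s ^+ (n - 1)) (phi eps * phi s ^+ (n - 2))
    (- (N - 2)) (phi q`_2 / phi c ^+ 2) (- (2 * N - 2)) ((2 * N - 3) * (N - 2)) ('C(n, 2))%:R) => //.
  - have : (2 * 'C(n, 2) = n * n.-1)%N by rewrite -mul_bin_diag bin1.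
    move/(congr1 (fun z => z%:R : 'F_p)); rewrite !natrM => ->; congr (_ * _).
    by rewrite /N -subn1 natrB.
  - rewrite mulrA rq2 eN; move: (M) => M'; field; exact: pc0.
  - have := cj 1%N isT; rewrite rw1 S1 q0 rq1 rmorph1 -/N eN => e.
    transitivity (- (phi c * (2 * (M + 3)))); first by ring.
    by rewrite e; ring.
  - have := cj 2%N isT; rewrite rw2 S2 q0 rq1 rmorph1 natrB // -/N eN => e.
    transitivity (phi c ^+ 2 * ((M + 2) * (2 * M + 5))); first by ring.
    rewrite e; set CC := ('C(n, 2))%:R; move: (M) (CC) => M' CC'; field; exact: pc0.
have p2 : (2 < p)%N.
  apply: leq_ltn_trans pbig; rewrite (leq_trans _ (leq_addl _ _)) // en.
  by rewrite (@leq_exp2l 2 1).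
have two0 : (2 : 'F_p) != 0.
  rewrite -(dvdn_pcharf (pchar_Fp pp)); apply/negP => /dvdn_leq; lia.
have {}key : 2 * phi a ^+ 4 = 2 - N ^+ 2.
  apply: (mulfI two0); rewrite mulrA -natrM key; ring.
have a4 : (phi a ^+ n) ^+ 4 = 1.
  have : (phi eps ^+ 2 * (phi a ^+ n) ^+ 2) ^+ 2 = 1 by rewrite -exprMn an !expr1n.
  by rewrite eps0 mul1r -exprM.
have n16 : (16 <= n ^ 2)%N by rewrite -[16%N]/(4 ^ 2)%N leq_exp2r // en.
pose A := ((n ^ 2 - 2) ^ n)%N; pose B := (2 ^ n)%N.
(* Squaring absorbs the sign of a^n. *)
have AB : (A%:R : 'F_p) ^+ 2 = B%:R ^+ 2.
  have eA : (A%:R : 'F_p) = (- (2 - N ^+ 2)) ^+ n.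
    by rewrite /A natrX natrB ?(leq_trans _ n16) // natrX -/N opprB.
  rewrite eA -key /B natrX exprNn exprMn sqrr_sign mul1r exprMn.
  by rewrite [phi a ^+ 4 ^+ n]exprAC a4 mulr1.
have BA : (B < A)%N.
  by rewrite ltn_exp2r //; move: n16; clear; lia.
move/eqP: AB; rewrite eqf_sqr -subr_eq0 -[X in _ || X]subr_eq0 opprK.
rewrite -natrB ?(ltnW BA) // -natrD -!(dvdn_pcharf (pchar_Fp pp)).
have pb2 : (A + B < p)%N := pbig.
case/orP => h.
  have : (p <= A - B)%N by apply: dvdn_leq h; rewrite subn_gt0.
  by move: pb2; clear; lia.
have : (p <= A + B)%N by apply: dvdn_leq h; rewrite (leq_trans _ (leq_addr _ _)) ?(leq_ltn_trans _ BA).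
by move: pb2; clear; lia.
Qed.
End NotGL2.

(** * Infinitely many split classes of irreducible polynomials *)

Lemma comp_const_mod (p q : {poly int}) (c : int) :
  exists y, p \Po (c *: q) = (p`_0)%:P + c *: y.
Proof.
have [p' ep _] := poly_split0 p; exists (q * (p' \Po (c *: q))).
by rewrite {1}ep comp_polyD comp_polyC comp_polyM comp_polyX scalerAl.
Qed.

Lemma fam_f_mod n c k : (0 < n)%N -> exists y, fam_f n c k = k%:P + c *: y.
Proof.
move=> n0; rewrite /fam_f /fam_q.
have -> : c *: 'X - c ^+ 2 *: 'X^2 = c *: ('X - c *: 'X^2) :> {poly int}.
  by rewrite scalerBr scalerA.
have [y ->] := comp_const_mod (lucU n) ('X - c *: 'X^2) c.
exists ('X^n + k *: y); rewrite -(prednK n0) lucU_coef0 prednK //.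
by rewrite !scalerDr !scalerA polyC1 alg_polyC addrCA mulrC.
Qed.

Lemma fam_g_mod n c k : (1 < n)%N -> exists y, fam_g n c k = k%:P + c *: y.
Proof.
move=> n1; rewrite /fam_g /fam_r.
set P := lucU n * _ + _; have [y ->] := comp_const_mod P 'X c.
have -> : P`_0 = 1 + c * (c ^+ (n - 2) * k).
  rewrite /P; have -> : n = (n - 2).+2 by lia.
  rewrite coefD coefZ expr2 !coef0M !lucU_coef0 lucV_coef0 /= exprS !mulr1.
  by rewrite !subSS subn0 mulrA.
exists ('X^n + k *: (c ^+ (n - 2) * k)%:P + k *: y).
by rewrite -!mul_polyC !(polyCD, polyCM); ring.
Qed.

Lemma fam_r_coef0 n c k : (1 < n)%N -> (fam_r n c k)`_0 = 1 + c ^+ n.-1 * k.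
Proof.
case: n => [|[|n]] // _; rewrite -horner_coef0 /fam_r horner_comp hornerZ hornerX mulr0 horner_coef0.
by rewrite coefD coefZ expr2 !coef0M !lucU_coef0 lucV_coef0 !mulr1.
Qed.

Section Witness.
Variables (n : nat) (p : nat) (c k : int).
Hypotheses (n4 : (4 <= n)%N) (pp : prime p) (cop : coprimez c k).
Hypotheses (pc : ~~ (p %| c)%Z) (pk : (p %| k)%Z) (pk2 : ~~ (p ^+ 2 %| k)%Z).
Let f := fam_f n c k.
Let g := fam_g n c k.
Let n1 : (1 < n)%N. Proof. lia. Qed.
Let n0 : (0 < n)%N. Proof. lia. Qed.

Let fq0 : (fam_q n c)`_0 = 1.
Proof. by have := fam_q_coef (n - 3) c; rewrite (_ : (n - 3).+3 = n) => [[]|]; last lia. Qed.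

Lemma fam_f_irr : irreducible_poly f /\ irreducible_Z f.
Proof.
split; [apply: (@low_irreducible _ p) | apply: (@low_irreducible_Z _ p)];
  by rewrite ?size_fam_q ?fq0 ?mulr1.
Qed.

(** The constant coefficient of g is k (1 + c^(n-1) k): the second factor is congruent
    to 1 modulo p and modulo c. *)
Lemma fam_g_irr : irreducible_Z g.
Proof.
have [z ez] : exists z, (fam_r n c k)`_0 = 1 + c * k * z.
  exists (c ^+ (n - 2)); rewrite fam_r_coef0 //.
  by rewrite (_ : n.-1 = (n - 2).+1) ?exprS; [ring|lia].
apply: (@low_irreducible_Z _ p) => //; first exact: size_fam_r.
  rewrite ez mulrDr mulr1; apply: contra pk2 => h.
  have [kk ek] := dvdzP pk.
  have : (p ^+ 2 %| k * (c * k * z))%Z.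
    by apply/dvdzP; exists (kk * c * kk * z); rewrite ek; ring.
  by move=> h2; rewrite -(rpredDr _ h2).
rewrite coprimezMr cop /= ez.
rewrite /coprimez addrC -mulrA mulrC.
by rewrite gcdzMDl gcdz1.
Qed.
End Witness.

Lemma fam_witness n p (c k : int) (S : set {poly int}) :
  (4 <= n)%N -> prime p -> ((n ^ 2 - 2) ^ n + 2 ^ n < p)%N ->
  0 < c -> 0 < k -> coprimez c k -> ~~ (p %| c)%Z -> (p %| k)%Z -> ~~ (p ^+ 2 %| k)%Z ->
  S (fam_f n c k) -> S (fam_g n c k) ->
  exists f g : {poly int}, [/\ S f /\ S g, hermite_equiv n g f, ~ gl2_equiv n f g
    & k%:~R <= `|disc f|].
Proof.
move=> n4 pp pbig c0 k0 cop pc pk pk2 Sf Sg.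
have n0 : (2 <= n)%N by lia.
have hf := complex_roots_has_roots (fam_f_degree k n0 c0).
have inj : injective (fun i : 'I_n => (complex_roots (fam_f n c k))`_i).
  apply: (irreducible_roots_inj (fam_f_degree k n0 c0) _ hf).
  by have [] := fam_f_irr n4 pp cop pc pk pk2.
exists (fam_f n c k), (fam_g n c k); split=> //.
- exact: fam_hermite hf inj.
- by apply: (@fam_not_gl2 n (n - 4) p) => //; lia.
exact: fam_disc hf inj.
Qed.

(** Here c = 1 and k is the large prime itself. *)
Lemma monic_irreducible_split n : (4 <= n)%N ->
  infinite_set (split_classes n
    [set f : {poly int} | [/\ has_degree n f, f \is monic & irreducible_Z f]]).
Proof.
move=> n4; have n2 : (2 <= n)%N by lia.
apply: infinite_split_classes => N.
have [p hp pp] := prime_above (N + ((n ^ 2 - 2) ^ n + 2 ^ n)).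
have wit := fun c k S => @fam_witness n p c k S n4 pp (leq_ltn_trans (leq_addl N _) hp).
have {hp} pN : (N < p)%N := leq_ltn_trans (leq_addr _ N) hp.
have p0 := prime_gt0 pp; have p1 := prime_gt1 pp.
have pp2 : ~~ (p ^+ 2 %| p%:Z)%Z.
  by rewrite dvdzE !absz_nat natrXE -[X in (_ %| X)%N]expn1 dvdn_Pexp2l.
have pc : ~~ (p %| 1)%Z by rewrite dvdz1 absz_nat; lia.
have cop : coprimez 1 p by rewrite /coprimez gcd1z.
have [||f [g [h1 h2 h3 h4]]] := @wit 1 p
    [set f : {poly int} | [/\ has_degree n f, f \is monic & irreducible_Z f]]
    isT p0 cop pc (dvdzz _) pp2.
- split; first exact: fam_f_degree.
    by rewrite monicE fam_f_lead.
  by have [] := fam_f_irr n4 pp cop pc (dvdzz _) pp2.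
- split; first exact: fam_g_degree.
    by rewrite monicE fam_g_lead.
  exact: (fam_g_irr n4 pp cop pc (dvdzz _) pp2).
exists f, g; split=> //; apply: lt_le_trans h4.
by rewrite -pmulrn ltr_nat; lia.
Qed.

(** Binomial expansion: the linear term carries the factor q twice. *)
Lemma sqr_dvd_exp (q : nat) (u v : int) : prime q ->
  (q%:Z %| u - v)%Z -> (q%:Z ^+ 2 %| u ^+ q - v ^+ q)%Z.
Proof.
move=> pq /dvdzP[t /eqP]; rewrite subr_eq => /eqP ->.
rewrite [_ + v]addrC exprDn big_ord_recl /= subn0 expr0 mulr1 bin0 mulr1n addrC addrA addNr add0r.
apply: rpred_sum => i _; rewrite /bump /= add1n exprMn.
case: i => [[|i] hi] /=.
  rewrite bin1 expr1; apply/dvdzP; exists (v ^+ (q - 1) * t).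
  by rewrite -mulr_natr natz; ring.
apply: rpredMn; rewrite mulrA; apply: dvdz_mull.
by apply/dvdzP; exists (q%:Z ^+ i); rewrite -exprD addn2.
Qed.

(** Squares modulo 5 are 0, 1, 4, so twice a square is never 1 or -1.  For odd n and
    a prime q dividing n, take c = q^2 and k = 1 + q: if k y^q = e = 1 or -1 modulo
    q^2, then y = e modulo q by Fermat, so y^q = e modulo q^2 and q^2 divides q e. *)
Lemma power_residue_obstruction n : (2 <= n)%N -> exists c k : nat,
  [/\ (1 < c)%N, coprime k c
    & forall x : int, ~~ (c%:Z %| k%:Z * x ^+ n - 1)%Z && ~~ (c%:Z %| k%:Z * x ^+ n + 1)%Z].
Proof.
move=> n2; have [odn|evn] := boolP (odd n); last first.
  exists 5%N, 2%N; split=> // x.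
  have -> : x ^+ n = (x ^+ n./2) ^+ 2.
    by rewrite -exprM muln2 -[in LHS](odd_double_half n) (negbTE evn).
  move: (x ^+ _) => y.
  have nd (e : int) : e = 1 \/ e = -1 -> ~~ (5%:Z %| 2%:Z * y ^+ 2 - e)%Z.
    move=> he; apply/negP => /dvdzP[z ez].
    have [d [m [ey m0 m5]]] : exists d m : int, [/\ y = d * 5 + m, 0 <= m & m < 5].
      by exists (y %/ 5)%Z, (y %% 5)%Z; split; [exact: divz_eq|exact: modz_ge0|exact: ltz_pmod].
    have [z' ez'] : exists z' : int, 2 * m ^+ 2 - e = z' * 5.
      by exists (z - 2 * (d ^+ 2 * 5 + 2 * d * m)); rewrite mulrBl -ez ey; ring.
    have hm : m = 0 \/ m = 1 \/ m = 2 \/ m = 3 \/ m = 4 by clear -m0 m5; lia.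
    rewrite expr2 in ez'; by clear -he hm ez'; case: he hm ez' => -> [->|[->|[->|[->|->]]]]; lia.
  by rewrite nd /=; [rewrite -[1]opprK nd //; right|left].
pose q := pdiv n; have pq : prime q by rewrite pdiv_prime.
have oq : odd q by have := pdiv_dvd n; move/dvdn_odd; apply.
have q1 := prime_gt1 pq.
have [l el] : exists l, n = (l * q)%N by have /dvdnP[l] := pdiv_dvd n; exists l.
exists (q ^ 2)%N, (1 + q)%N; split.
- by rewrite -[1%N](exp1n 2) ltn_exp2r.
- by rewrite coprimeXr // add1n coprimeSn.
move=> x; have -> : x ^+ n = (x ^+ l) ^+ q by rewrite -exprM el.
move: (x ^+ l) => y.
have nd (e : int) : e = 1 \/ e = -1 ->
    ~~ ((q ^ 2)%N%:Z %| (1 + q)%N%:Z * y ^+ q - e)%Z.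
  move=> he; apply/negP; rewrite PoszM -expr2 PoszD => h.
  have hq : (q%:Z %| (1 + q%:Z) * y ^+ q - e)%Z.
    apply: dvdz_trans h; rewrite expr2; exact: dvdz_mulr.
  have fermat : (q%:Z %| y ^+ q - y)%Z.
    rewrite (dvdz_pcharf (pchar_Fp pq)) rmorphB rmorphXn /=.
    by rewrite -[q in _ ^+ q](card_Fp pq) expf_card subrr.
  have hy : (q%:Z %| y - e)%Z.
    have -> : y - e = ((1 + q%:Z) * y ^+ q - e) - (y ^+ q - y) - q%:Z * y ^+ q by ring.
    by apply: rpredB; [exact: rpredB|exact: dvdz_mulr].
  have := sqr_dvd_exp pq hy.
  have -> : e ^+ q = e.
    by case: he => ->; rewrite ?expr1n // -signr_odd oq.
  move=> hs; have : (q%:Z ^+ 2 %| q%:Z * e)%Z.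
    have -> : q%:Z * e = ((1 + q%:Z) * y ^+ q - e) - (1 + q%:Z) * (y ^+ q - e) by ring.
    by rewrite rpredB ?dvdz_mull.
  have q0 : q%:Z != 0 by rewrite eqz_nat; lia.
  rewrite expr2 dvdz_mul2l // => qe; move: qe.
  by case: he => ->; rewrite dvdzE ?abszN !absz_nat dvdn1; lia.
by rewrite nd /=; [rewrite -[1]opprK nd //; right|left].
Qed.

(** The prime p is to divide k exactly once while k keeps the residue class k0 modulo
    c; hence k = p m, with m congruent to k0 p^-1 and smaller than p. *)
Lemma nonmonic_irreducible_split n : (4 <= n)%N ->
  infinite_set (split_classes n
    [set f : {poly int} | [/\ has_degree n f, properly_nonmonic n f & irreducible_Z f]]).
Proof.
move=> n4; have n2 : (2 <= n)%N by lia.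
apply: infinite_split_classes => N.
have [c [k0 [c1 cop0 nd]]] := power_residue_obstruction n2.
have [p hp pp] := prime_above (N + c + ((n ^ 2 - 2) ^ n + 2 ^ n)).
have wit := fun c k S => @fam_witness n p c k S n4 pp (leq_ltn_trans (leq_addl _ _) hp).
have {hp} pNc : (N + c < p)%N := leq_ltn_trans (leq_addr _ _) hp.
have p0 := prime_gt0 pp; have p1 := prime_gt1 pp.
have copc : coprime p c.
  by rewrite prime_coprime //; apply/negP => /dvdn_leq; lia.
(* p^(totient c - 1) is an inverse of p modulo c. *)
pose m := ((k0 * p ^ (totient c).-1) %% c)%N; pose k := (p * m)%N.
have kc : k = k0 %[mod c].
  rewrite /k /m modnMmr mulnCA -expnS prednK ?totient_gt0 1?ltnW //.
  by rewrite -modnMmr Euler_exp_totient // modnMmr muln1.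
have mc : (m < c)%N by rewrite ltn_mod; lia.
have copk : coprime k c by rewrite -coprime_modl kc coprime_modl.
have m0 : (0 < m)%N.
  rewrite lt0n; apply: contraTneq copk; rewrite /k => ->.
  by rewrite muln0 /coprime gcd0n; lia.
have pm : ~~ (p %| m)%N by apply/negP => /dvdn_leq; lia.
have cop : coprimez c k by rewrite coprimez_sym /coprimez /gcdz !absz_nat eqz_nat.
have pc : ~~ (p %| c%:Z)%Z.
  by rewrite dvdzE !absz_nat -prime_coprime.
have pk : (p %| k%:Z)%Z by rewrite dvdzE !absz_nat dvdn_mulr.
have pk2 : ~~ (p ^+ 2 %| k%:Z)%Z.
  by rewrite dvdzE !absz_nat natrXE /k expnS expn1 dvdn_pmul2l.
have ndk (x : int) : ~~ (c%:Z %| k%:Z * x ^+ n - 1)%Z && ~~ (c%:Z %| k%:Z * x ^+ n + 1)%Z.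
  have /dvdzP[z ez] : (c%:Z %| k%:Z - k0%:Z)%Z.
    by rewrite -eqz_mod_dvd; apply/eqP; rewrite !modz_nat kc.
  have ek : k%:Z = k0%:Z + z * c%:Z by rewrite -ez addrC subrK.
  have /andP[n1 n3] := nd x; rewrite ek; apply/andP; split.
    apply: contra n1 => /dvdzP[t et]; apply/dvdzP; exists (t - z * x ^+ n).
    by rewrite mulrBl -et; ring.
  apply: contra n3 => /dvdzP[t et]; apply/dvdzP; exists (t - z * x ^+ n).
  by rewrite mulrBl -et; ring.
have c0 : 0 < c%:Z by rewrite ltz_nat; lia.
have k1 : 0 < k%:Z by rewrite ltz_nat muln_gt0 p0.
have [||f [g [h1 h2 h3 h4]]] := @wit c k
    [set f : {poly int} | [/\ has_degree n f, properly_nonmonic n f & irreducible_Z f]]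
    c0 k1 cop pc pk pk2.
- have sz : has_degree n (fam_f n c k) by apply: fam_f_degree.
  split=> //; last by have [] := fam_f_irr n4 pp cop pc pk pk2.
  have [y ey] := @fam_f_mod n c k (ltnW n2).
  exact: properly_nonmonic_mod sz ey ndk.
- have sz : has_degree n (fam_g n c k) by apply: fam_g_degree.
  split=> //; last exact: (fam_g_irr n4 pp cop pc pk pk2).
  have [y ey] := @fam_g_mod n c k n2.
  exact: properly_nonmonic_mod sz ey ndk.
exists f, g; split=> //; apply: lt_le_trans h4.
have Nk : (N < k)%N.
  by rewrite (leq_trans _ (leq_pmulr p m0)) // (leq_trans _ pNc) // ltnS leq_addr.
by move: Nk; clear; rewrite -pmulrn ltr_nat.
Qed.

(** * Split classes of reducible polynomials: reciprocal roots *)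

(** For monic polynomials the powers of an integral polynomial in al reduce to degree
    below n, and two mutually inverse substitutions have unimodular matrices. *)
Lemma monic_hermite_equiv n f g (al be : 'I_n -> algC) (h h' : {poly int}) :
  has_degree n f -> has_degree n g -> f \is monic -> g \is monic ->
  has_roots f al -> has_roots g be -> injective al ->
  (forall i, be i = ev h (al i)) -> (forall i, al i = ev h' (be i)) ->
  hermite_equiv n g f.
Proof.
have mx F (a b : 'I_n -> algC) (k : {poly int}) : has_degree n F -> F \is monic ->
    has_roots F a -> (forall i, b i = ev k (a i)) ->
    exists W : 'M[int]_n, rootmx b = rootmx a *m map_mx intr W.
  move=> sF mF hF hb.
  have [W eW] : exists W : 'M[int]_n,
      diag_mx (\row_(i < n) 1) *m rootmx b = rootmx a *m map_mx intr W.
    apply: (@rootmx_poly n (fun=> 1)) => j _.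
    have [w sw ew] := poly_mod_monic (k ^+ j) sF mF.
    exists w => // i; rewrite mul1r -ew ?(has_roots_root i hF) //.
    by rewrite evXn hb.
  exists W; rewrite -eW -[LHS]mul1mx; congr (_ *m _).
  by rewrite -diag_const_mx; congr diag_mx; apply/rowP=> i; rewrite !mxE.
move=> sf sg mf mg hf hg inj hab hba.
have [W eW] := mx _ _ _ _ sf mf hf hab; have [W' eW'] := mx _ _ _ _ sg mg hg hba.
apply: (hermite_equiv_roots sf sg hf hg _ (unitmx_of_inverse inj eW eW') eW).
by rewrite (monicP mf) (monicP mg).
Qed.

Lemma has_roots_of_distinct n g (be : 'I_n -> algC) : has_degree n g ->
  injective be -> (forall i, ev g (be i) = 0) -> has_roots g be.
Proof.
move=> sg inj rt; rewrite /has_roots.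
have eg : size (map_poly intr g : {poly algC}) = n.+1.
  by rewrite size_map_inj_poly //; exact: intr_inj.
rewrite [LHS](all_roots_prod_XsubC (rs := codom be)).
- by rewrite lead_coef_map_inj ?big_image //; exact: intr_inj.
- by rewrite eg size_codom card_ord.
- by apply/allP => _ /codomP[i ->]; rewrite rootE rt.
by rewrite uniq_rootsE; apply/injectiveP.
Qed.

Section Reciprocal.
Variables (d a : nat).
Let n := d.+2.
Hypotheses (d2 : (2 <= d)%N) (abig : (d.+1 ^ d.+1 < a)%N) (da : ~~ (d.+1 %| a)%N).
Definition recip_f : {poly int} := 'X^(d.+2) + a%:Z *: 'X^2 + 'X.
Definition recip_g : {poly int} := 'X^(d.+2) + a%:Z *: 'X^(d.+1) + 'X.
Let f := recip_f.
Let g := recip_g.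

Lemma monic_low (q : {poly int}) : (size q <= n)%N ->
  has_degree n ('X^n + q) /\ 'X^n + q \is monic.
Proof.
move=> sq; have lt : (size q < size ('X^n : {poly int})%R)%N by rewrite size_polyXn.
by rewrite /has_degree size_polyDl // size_polyXn monicE lead_coefDl // lead_coefXn.
Qed.

Lemma recip_f_monic : has_degree n f /\ f \is monic.
Proof.
rewrite /f /recip_f -addrA; apply: monic_low; apply: leq_trans (size_polyD _ _) _.
by rewrite geq_max size_polyX (leq_trans (size_scale_leq _ _)) // size_polyXn !ltnS ltnW.
Qed.
Lemma recip_g_monic : has_degree n g /\ g \is monic.
Proof.
rewrite /g /recip_g -addrA; apply: monic_low; apply: leq_trans (size_polyD _ _) _.
by rewrite geq_max size_polyX (leq_trans (size_scale_leq _ _)) // size_polyXn.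
Qed.

Lemma X_mul_reducible (q : {poly int}) : (1 < size q)%N -> reducible_Z ('X * q).
Proof.
move=> sq; have q0 : q != 0 by rewrite -size_poly_gt0 ltnW.
have x0 : 'X != 0 :> {poly int} by rewrite polyX_eq0.
split; rewrite ?mulf_neq0 //.
  rewrite poly_unitE size_mul // size_polyX; apply/negP => /andP[/eqP e _].
  have {}e : (size q).+1 = 1%N := e.
  by rewrite ltnNge -ltnS e in sq.
move=> [_ _ /(_ 'X q erefl)]; rewrite !poly_unitE size_polyX /=.
by case=> [//|/andP[/eqP e _]]; rewrite e in sq.
Qed.

Lemma recip_f_reducible : reducible_Z f.
Proof.
have e : f = 'X * ('X^(d.+1) + (a%:Z *: 'X + 1)).
  by rewrite /f /recip_f !mulrDr -exprS mulr1 -scalerAr -expr2 addrA.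
rewrite e; apply: X_mul_reducible.
have [] := recip_f_monic; rewrite /has_degree e.
set q := _ + _ => sz _.
have q0 : q != 0 by apply: contra_eq_neq sz => ->; rewrite mulr0 size_poly0.
have : (size q).+1 = d.+3 by rewrite -sz size_mul ?polyX_eq0 // size_polyX.
by move=> [->].
Qed.
Lemma recip_g_reducible : reducible_Z g.
Proof.
have e : g = 'X * ('X^(d.+1) + (a%:Z *: 'X^d + 1)).
  by rewrite /g /recip_g !mulrDr -exprS mulr1 -scalerAr -exprS addrA.
rewrite e; apply: X_mul_reducible.
have [] := recip_g_monic; rewrite /has_degree e.
set q := _ + _ => sz _.
have q0 : q != 0 by apply: contra_eq_neq sz => ->; rewrite mulr0 size_poly0.
have : (size q).+1 = d.+3 by rewrite -sz size_mul ?polyX_eq0 // size_polyX.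
by move=> [->].
Qed.

Let A : algC := a%:R.
Let recip_ev x : ev f x = x * (x ^+ d.+1 + A * x + 1).
Proof. by rewrite /f /recip_f !evE /A pmulrn !exprS; ring. Qed.
Let recip_gev x : ev g x = x * (x ^+ d.+1 + A * x ^+ d + 1).
Proof. by rewrite /g /recip_g !evE /A pmulrn !exprS; ring. Qed.

Let D : algC := d.+1%:R ^+ d.+1 + A * (- (d%:R * A)) ^+ d.

Lemma recip_D_large : a%:R - (d.+1 ^ d.+1)%N%:R <= `|D|.
Proof.
have -> : a%:R - (d.+1 ^ d.+1)%N%:R = A - d.+1%:R ^+ d.+1 by rewrite natrX.
have h : A <= `|A * (- (d%:R * A)) ^+ d|.
  rewrite normrM normrX normrN normrM !ger0_norm ?ler0n //.
  by rewrite ler_peMr ?ler0n // exprn_ege1 // -natrM ler1n muln_gt0; move: d2 abig; clear; lia.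
apply: le_trans (_ : `|A * (- (d%:R * A)) ^+ d| - d.+1%:R ^+ d.+1 <= _).
  by rewrite lerB.
rewrite /D [X in _ <= `|X|]addrC; apply: le_trans (lerB_normD _ _).
by rewrite normrX [`|d.+1%:R|]ger0_norm ?ler0n.
Qed.

Lemma recip_D_neq0 : D != 0.
Proof.
rewrite -normr_gt0; apply: lt_le_trans recip_D_large.
by rewrite subr_gt0 ltr_nat.
Qed.

(** x is the point where the derivative of f, reduced by the equation of the nonzero
    roots, vanishes; this evaluates the product of the derivatives in closed form. *)
Lemma recip_disc_core (x : algC) : - (d%:R * A) * x = d.+1%:R ->
  (- (d%:R * A)) ^+ d.+1 * (x ^+ d.+1 + A * x + 1) = D.
Proof.
move=> e; rewrite !mulrDr -exprMn e mulr1 -addrA /D; congr (_ + _).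
have -> : (- (d%:R * A)) ^+ d.+1 * (A * x) + (- (d%:R * A)) ^+ d.+1 =
    (- (d%:R * A)) ^+ d * (A * (- (d%:R * A) * x) - d%:R * A).
  by rewrite exprS; ring.
by rewrite e -natr1; ring.
Qed.

Lemma recip_deriv x : ev f^`() x = d.+2%:R * x ^+ d.+1 + 2 * A * x + 1.
Proof.
rewrite /f /recip_f !derivD derivZ !derivXn derivX evD evD evMn evZ evMn !ev_Xn ev1.
by rewrite -pmulrn -/A expr1 mulr_natl; congr (_ + _ + _); ring.
Qed.

Section Roots.
Variable al : 'I_n -> algC.
Hypothesis hf : has_roots f al.

Lemma recip_root i : al i = 0 \/ al i ^+ d.+1 = - (A * al i + 1).
Proof.
have := has_roots_root i hf; rewrite recip_ev => /eqP; rewrite mulf_eq0.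
case/orP => /eqP h; [by left|right].
by apply/eqP; rewrite -subr_eq0 opprK addrA h.
Qed.

Lemma recip_deriv_root i : al i != 0 ->
  ev f^`() (al i) = - (d.+1%:R + d%:R * A * al i).
Proof.
move=> a0; have [e|e] := recip_root i; first by rewrite e eqxx in a0.
by rewrite recip_deriv e -!natr1; ring.
Qed.

Lemma recip_inj : injective al.
Proof.
move=> i j eij; apply/eqP/negPn/negP => ij.
have d0 : ev f^`() (al i) = 0.
  by rewrite (has_roots_deriv i hf) (bigD1 j) /= 1?eq_sym // eij subrr mul0r mulr0.
have [a0|a0] := eqVneq (al i) 0.
  by move/eqP: d0; rewrite recip_deriv a0 expr0n /= !mulr0 !add0r oner_eq0.
move: d0; rewrite recip_deriv_root // => /eqP; rewrite oppr_eq0 addr_eq0 => /eqP e.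
have := recip_disc_core (x := al i); rewrite mulNr -e => /(_ erefl).
have [e0|er] := recip_root i; first by rewrite e0 eqxx in a0.
by rewrite er -addrA addNr mulr0 => /esym/eqP; apply/negP; exact: recip_D_neq0.
Qed.

Lemma recip_disc : `|disc f| = `|D|.
Proof.
have [sf mf] := recip_f_monic.
rewrite (norm_disc _ sf hf) // (monicP mf) normr1 expr1n mul1r.
have [i0 e0] : exists i0, al i0 = 0.
  have := has_roots_horner 0 hf; rewrite recip_ev mul0r (monicP mf) mul1r => /esym/eqP.
  by case/prodf_eq0 => i _; rewrite sub0r oppr_eq0 => /eqP; exists i.
have ali i : i != i0 -> al i != 0 by move=> h; rewrite -e0 (inj_eq recip_inj).
rewrite (bigD1 i0) //= recip_deriv e0 expr0n /= !mulr0 !add0r normr1 mul1r.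
(* The common zero of the linear forms to which f' reduces at the nonzero roots. *)
pose x := - (d.+1%:R / (d%:R * A)) : algC.
have dA : d%:R * A != 0 by rewrite -natrM pnatr_eq0 muln_eq0; move: d2 abig; clear; lia.
have ex : - (d%:R * A) * x = d.+1%:R by rewrite /x mulrNN mulrCA divff // mulr1.
have x0 : x != 0 by rewrite oppr_eq0 mulf_neq0 ?invr_eq0 // pnatr_eq0.
rewrite -(recip_disc_core ex) normrM normrX normrN.
have -> : x ^+ d.+1 + A * x + 1 = \prod_(i | i != i0) (x - al i).
  apply: (mulfI x0); rewrite -recip_ev (has_roots_horner x hf) (monicP mf) mul1r.
  by rewrite (bigD1 i0) //= e0 subr0.
rewrite normr_prod.
have -> : `|d%:R * A| ^+ d.+1 = \prod_(i : 'I_n | i != i0) `|d%:R * A|.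
  by rewrite prodr_const; congr (_ ^+ _); rewrite cardC1 card_ord.
rewrite -big_split; apply: eq_bigr => i /ali ai; rewrite /= recip_deriv_root // -normrM.
by rewrite mulrBr /x mulrN mulrCA divff // mulr1 -opprD.
Qed.

Let be i := (al i)^-1.

(** From al^(n-1) + a al + 1 = 0 the inverse of al is an integral polynomial in al,
    and it can be adjusted to vanish at 0 too, where the convention 0^-1 = 0 matches
    the two zero roots. *)
Lemma recip_hermite : hermite_equiv n g f.
Proof.
have [sf mf] := recip_f_monic; have [sg mg] := recip_g_monic.
pose h : {poly int} := a%:Z *: ('X^(d.+1) + a%:Z *: 'X) - 'X^d.
pose h' : {poly int} := - ('X^d + a%:Z *: 'X^(d.-1)).
have hbe i : be i = ev h (al i).
  rewrite /h /be !evE -pmulrn -/A; have [e|e] := recip_root i.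
    by rewrite e invr0 !expr0n (gtn_eqF (ltnW d2)) /= !mulr0 !addr0 !mulr0 subr0.
  have [e0|a0] := eqVneq (al i) 0.
    by rewrite e0 invr0 !expr0n (gtn_eqF (ltnW d2)) /= !mulr0 !addr0 !mulr0 subr0.
  apply: (mulfI a0); rewrite divff // e mulrDr.
  transitivity (- (al i * al i ^+ d) - A * al i); last by ring.
  by rewrite -exprS e; ring.
have rtb i : be i = 0 \/ be i ^+ d.+1 + A * be i ^+ d + 1 = 0.
  rewrite /be; have [a0|a0] := eqVneq (al i) 0; first by left; rewrite a0 invr0.
  right; have [e|e] := recip_root i; first by rewrite e eqxx in a0.
  apply: (mulfI (expf_neq0 d.+1 a0)); rewrite mulr0 !mulrDr mulr1 -exprMn divff // expr1n.
  rewrite mulrCA [in X in _ + A * X]exprS -mulrA -exprMn divff // expr1n mulr1 e; ring.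
have hal i : al i = ev h' (be i).
  rewrite -[LHS]invrK -/(be i) /h' !evE -pmulrn -/A; have [e|e] := rtb i.
    rewrite e invr0 !expr0n (gtn_eqF (ltnW d2)) /=.
    have -> : (d.-1 == 0)%N = false by move: d2; clear; lia.
    by rewrite mulr0 addr0 oppr0.
  have [e0|b0] := eqVneq (be i) 0.
    move: e; rewrite e0 !expr0n (gtn_eqF (ltnW d2)) /= mulr0 !add0r => /eqP.
    by rewrite oner_eq0.
  apply: (mulfI b0); rewrite divff // mulrN mulrDr -exprS mulrCA -exprS.
  rewrite prednK ?(ltnW d2) //.
  by move/eqP: e; rewrite addrC addr_eq0 => /eqP.
have bin : injective be by move=> i j /invr_inj/recip_inj.
apply: (monic_hermite_equiv sf sg mf mg hf _ recip_inj hbe hal).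
apply: has_roots_of_distinct => // i; rewrite recip_gev.
by have [->|->] := rtb i; rewrite ?mul0r ?mulr0.
Qed.
End Roots.

(** The constant coefficient of the transform of f vanishes.  If b <> 0, coprimality of
    b and s makes both units, and then a <= 2.  If b = 0, the coefficient of X^2
    gives a = - u r (n - 1). *)
Lemma recip_not_gl2 : ~ gl2_equiv n f g.
Proof.
move=> /gl2_equiv_poly[u [b [r [s [e [det]]]]]].
pose T := fun i : nat => (u *: 'X + b%:P) ^+ i * (r *: 'X + s%:P) ^+ (n - i).
have sumX j : (j <= n)%N -> \sum_(i < n.+1) ('X^j : {poly int})`_i *: T i = T j.
  move=> jn; rewrite (bigD1 (inord j)) //= inordK ?ltnS // coefXn eqxx scale1r.
  rewrite big1 ?addr0 // => i; rewrite -(inj_eq val_inj) /= inordK ?ltnS // => h.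
  by rewrite coefXn (negbTE h) scale0r.
have -> : \sum_(i < n.+1) f`_i *: ((u *: 'X + b%:P) ^+ i * (r *: 'X + s%:P) ^+ (n - i)) =
    T n + a%:Z *: T 2 + T 1%N.
  rewrite -!sumX // scaler_sumr -!big_split; apply: eq_bigr => i _.
  by rewrite /= /f /recip_f !coefD coefZ -['X]expr1 !scalerDl scalerA.
move=> E.
have Ec j : g`_j = (-1) ^+ e * ((T n)`_j + a%:Z * (T 2)`_j + (T 1%N)`_j).
  by rewrite E coefZ !coefD coefZ.
have g0 : g`_0 = 0 by rewrite /g /recip_g !coefD coefZ !coefXn coefX /= mulr0.
have g2 : g`_2 = 0.
  by rewrite /g /recip_g !coefD coefZ !coefXn coefX; case: (d) d2 => [|[|d']] //=; rewrite mulr0.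
have {Ec}C j : g`_j = 0 -> (T n)`_j + a%:Z * (T 2)`_j + (T 1%N)`_j = 0.
  by rewrite Ec => /eqP; rewrite mulf_eq0 signr_eq0 /= => /eqP.
have cl k l m : ((k *: 'X + l%:P) ^+ m : {poly int})`_0 = l ^+ m.
  by rewrite coef_lin_pow expr0 mul1r subn0 bin0.
have T0 i : (T i)`_0 = b ^+ i * s ^+ (n - i) by rewrite /T coef0M !cl.
have := C _ g0; rewrite !T0 expr1 => c0.
have cop : coprimez b s.
  apply/coprimezP; exists (- r * (u * s - b * r), u * (u * s - b * r)) => /=.
  by rewrite -[RHS]det; ring.
have n1 : (n - 1 = d.+1)%N by rewrite subn1.
have n2' : (n - 2 = d)%N by rewrite subn2.
have b0 : b = 0.
  apply/eqP/negPn/negP => nb.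
  have {}c0 : b ^+ d.+1 + a%:Z * (b * s ^+ d) + s ^+ d.+1 = 0.
    apply: (mulfI nb); rewrite mulr0 -[RHS]c0 n1 n2' subnn expr0 /n !exprS; ring.
  have unitE (z : int) : (z %| 1)%Z -> z = 1 \/ z = -1.
    by rewrite dvdz1; clear; lia.
  have ub : b = 1 \/ b = -1.
    apply: unitE; have : (b %| s ^+ d.+1)%Z.
      apply/dvdzP; exists (- (b ^+ d + a%:Z * s ^+ d)).
      by apply/eqP; rewrite -subr_eq0 -[X in _ == X]c0 !exprS; apply/eqP; ring.
    by rewrite -[s ^+ d.+1]mul1r Gauss_dvdzl // coprimezXr.
  have us : s = 1 \/ s = -1.
    apply: unitE; have : (s %| b ^+ d.+1)%Z.
      apply/dvdzP; exists (- (a%:Z * b * s ^+ d.-1 + s ^+ d)).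
      apply/eqP; rewrite -subr_eq0 -[X in _ == X]c0; apply/eqP.
      have ed : s ^+ d = s * s ^+ d.-1 by rewrite -exprS prednK // ltnW.
      by rewrite !exprS ed; ring.
    by rewrite -[b ^+ d.+1]mul1r Gauss_dvdzl // coprimezXr // coprimez_sym.
  have pw (z : int) m : z = 1 \/ z = -1 -> z ^+ m = 1 \/ z ^+ m = -1.
    by case=> ->; [left; rewrite expr1n|rewrite -signr_odd; case: odd; [right|left]].
  have a2 : (2 < a)%N.
    apply: leq_ltn_trans abig; apply: leq_trans (_ : d.+1 <= _)%N; first lia.
    by rewrite -[X in (X <= _)%N]expn1 leq_exp2l ?ltnS ?(ltnW d2).
  have [] := pw _ d.+1 ub; have [] := pw _ d.+1 us; have [] := pw _ d us; move=> e1 e2 e3; move: c0; rewrite e1 e2 e3;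
  case: ub => ->; move: a2; clear; lia.
have us : s = 1 \/ s = -1 by move: cop; rewrite b0 /coprimez gcd0z; clear; lia.
have Tj i : (i <= 2)%N -> (T i)`_2 = u ^+ i * ((r *: 'X + s%:P) ^+ (n - i))`_(2 - i).
  by move=> i2; rewrite /T b0 addr0 exprZn -scalerAl coefZ coefXnM ltnNge i2.
have Tn : (T n)`_2 = 0.
  by rewrite /T b0 addr0 exprZn -scalerAl coefZ coefXnM ifT ?mulr0 // /n !ltnS ltnW.
have := C _ g2; rewrite Tn add0r !Tj // n1 n2' cl coef_lin_pow bin1 !expr1 subn1 /= => e2.
have su : s ^+ d != 0 by apply: expf_neq0; case: us => ->.
have u2 : u ^+ 2 = 1.
  by have := det; rewrite b0 mul0r subr0 exprMn; case: us => ->; rewrite ?sqrrN expr1n mulr1.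
have {}e2 : a%:Z = - (u * r) * d.+1%:Z.
  apply: (mulIf su); apply/eqP; rewrite -subr_eq0 -[X in _ == X]e2 u2 mul1r -mulr_natr natz.
  apply/eqP; rewrite subSS subn0; move: (Posz d.+1) => dd; ring.
by case/negP: da; have : (d.+1%:Z %| a%:Z)%Z by rewrite e2 dvdz_mull.
Qed.
End Reciprocal.

Lemma monic_reducible_split n : (4 <= n)%N ->
  infinite_set (split_classes n
    [set f : {poly int} | [/\ has_degree n f, f \is monic & reducible_Z f]]).
Proof.
move=> n4; apply: infinite_split_classes => N.
have {n4}[d d2 ->] : exists2 d, (2 <= d)%N & n = d.+2 by exists (n - 2)%N; lia.
(* Congruent to 1 modulo n - 1, and large enough for the discriminant to exceed N. *)
pose a := ((d.+1 ^ d.+1 + N).+1 * d.+1 + 1)%N.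
have big : (d.+1 ^ d.+1 + N < a)%N by rewrite /a; nia.
have abig : (d.+1 ^ d.+1 < a)%N by lia.
have da : ~~ (d.+1 %| a)%N by rewrite /a dvdn_addr ?dvdn_mull // dvdn1; lia.
have [sf mf] := @recip_f_monic d a d2; have [sg mg] := @recip_g_monic d a.
have hf := complex_roots_has_roots sf.
exists (recip_f d a), (recip_g d a); split.
- split; [have rd := recip_f_reducible a d2 | have rd := recip_g_reducible d a]; by split.
- exact: recip_hermite hf.
- exact: recip_not_gl2.
rewrite (recip_disc d2 abig hf); apply: lt_le_trans (recip_D_large d2 abig).
by rewrite ltrBrDr -natrD ltr_nat addnC.
Qed.

(** * The norm form of a quartic order *)

(** Laplace expansion along the first two rows: a closed formula, which computes on
    integers. *)
Definition det4 (R : comNzRingType) (r0 r1 r2 r3 : R * R * R * R) : R :=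
  let: (a0, a1, a2, a3) := r0 in let: (b0, b1, b2, b3) := r1 in
  let: (c0, c1, c2, c3) := r2 in let: (d0, d1, d2, d3) := r3 in
  let m i j k l := i * l - j * k in
  m a0 a1 b0 b1 * m c2 c3 d2 d3 - m a0 a2 b0 b2 * m c1 c3 d1 d3
  + m a0 a3 b0 b3 * m c1 c2 d1 d2 + m a1 a2 b1 b2 * m c0 c3 d0 d3
  - m a1 a3 b1 b3 * m c0 c2 d0 d2 + m a2 a3 b2 b3 * m c0 c1 d0 d1.

(** The rows are the coordinates, on X^3, X^2, X, 1 modulo a X^4 + ... + e, of
    P = x0 X^3 + ... + x3 multiplied by 1, a X, a X^2 + b X and a X^3 + b X^2 + c X.
    As these multipliers have determinant a^3, the value is a^3 times the norm of P,
    and no denominators occur. *)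
Definition quartic_cubic_res (R : comNzRingType) (a b c d e x0 x1 x2 x3 : R) : R :=
  let y1 := a * x2 - c * x0 + b * x1 in
  let y2 := a * x3 - d * x0 + b * x2 in
  let y3 := - e * x0 + b * x3 in
  let r20 := y1 - b * x1 in let r21 := y2 - c * x1 in let r22 := y3 - d * x1 in
  let r23 := - e * x1 in
  let w1 := r21 + c * x1 in let w2 := r22 + c * x2 in let w3 := r23 + c * x3 in
  det4 (x0, x1, x2, x3) (a * x1 - b * x0, a * x2 - c * x0, a * x3 - d * x0, - e * x0)
   (r20, r21, r22, r23) (w1 - b * x2, w2 - c * x2, w3 - d * x2, - e * x2).

Section Rmorph.
Variables (R S : comNzRingType) (f : {rmorphism R -> S}).
Let f4 (r : R * R * R * R) : S * S * S * S :=
  let: (a, b, c, d) := r in (f a, f b, f c, f d).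

Lemma rmorph_det4 r0 r1 r2 r3 : f (det4 r0 r1 r2 r3) = det4 (f4 r0) (f4 r1) (f4 r2) (f4 r3).
Proof.
case: r0 => [[[? ?] ?] ?]; case: r1 => [[[? ?] ?] ?].
case: r2 => [[[? ?] ?] ?]; case: r3 => [[[? ?] ?] ?].
by rewrite /det4 /= !(rmorphD, rmorphB, rmorphN, rmorphM); reflexivity.
Qed.

Lemma rmorph_quartic_cubic_res a b c d e x0 x1 x2 x3 :
  f (quartic_cubic_res a b c d e x0 x1 x2 x3) =
  quartic_cubic_res (f a) (f b) (f c) (f d) (f e) (f x0) (f x1) (f x2) (f x3).
Proof. by rewrite /quartic_cubic_res rmorph_det4 /= !(rmorphD, rmorphB, rmorphM, rmorphN); reflexivity. Qed.
End Rmorph.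

Lemma quartic_cubic_res_roots (R : comNzRingType) (a z0 z1 z2 z3 x0 x1 x2 x3 : R) :
  a ^+ 3 * ((x0 * z0 ^+ 3 + x1 * z0 ^+ 2 + x2 * z0 + x3) *
    (x0 * z1 ^+ 3 + x1 * z1 ^+ 2 + x2 * z1 + x3) *
    (x0 * z2 ^+ 3 + x1 * z2 ^+ 2 + x2 * z2 + x3) *
    (x0 * z3 ^+ 3 + x1 * z3 ^+ 2 + x2 * z3 + x3)) =
  quartic_cubic_res a (- a * (z0 + z1 + z2 + z3))
    (a * (z0 * z1 + z0 * z2 + z0 * z3 + z1 * z2 + z1 * z3 + z2 * z3))
    (- a * (z0 * z1 * z2 + z0 * z1 * z3 + z0 * z2 * z3 + z1 * z2 * z3))
    (a * (z0 * z1 * z2 * z3)) x0 x1 x2 x3.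
Proof. by rewrite /quartic_cubic_res /det4; ring. Qed.

(** The Hermite form of 2 X^4 + X^3 + 4 X^2 + X + 3. *)
Definition nonmonic_form (R : comNzRingType) : R -> R -> R -> R -> R := quartic_cubic_res 2 1 4 1 3.

Section Real.
Variable (R : realFieldType).
Implicit Types p q r s : R.

Definition redu p q (x0 x1 x2 x3 : R) := x0 * (p ^+ 2 - q) - x1 * p + x2.
Definition redv p q (x0 x1 x2 x3 : R) := x0 * (p * q) - x1 * q + x3.
(** The norm of x0 X^3 + x1 X^2 + x2 X + x3 modulo X^2 + p X + q, where its remainder
    is u X + v; [redu] and [redv] are u and v. *)
Definition qnorm p q x0 x1 x2 x3 :=
  let u := redu p q x0 x1 x2 x3 in let v := redv p q x0 x1 x2 x3 in
  v ^+ 2 - p * u * v + q * u ^+ 2.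

Lemma quartic_cubic_res_quadratics p q r s x0 x1 x2 x3 :
  8 * (qnorm p q x0 x1 x2 x3 * qnorm r s x0 x1 x2 x3) =
  quartic_cubic_res 2 (2 * (p + r)) (2 * (q + s + p * r)) (2 * (p * s + q * r)) (2 * (q * s)) x0 x1 x2 x3.
Proof. by rewrite /qnorm /redu /redv /quartic_cubic_res /det4; ring. Qed.

(** The norm of the unit 2 X^2 - X + 2 modulo X^2 + p X + q. *)
Definition unit_norm p q := (2 - 2 * q) ^+ 2 + (2 - 2 * q) * (2 * p + 1) * p + (2 * p + 1) ^+ 2 * q.

Variables (p q r s : R).
Hypotheses (e1 : p + r = 2^-1) (e2 : q + s + p * r = 2) (e3 : p * s + q * r = 2^-1) (e4 : q * s = 3 / 2).

Lemma form_qnorm x0 x1 x2 x3 :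
  nonmonic_form x0 x1 x2 x3 = 8 * (qnorm p q x0 x1 x2 x3 * qnorm r s x0 x1 x2 x3).
Proof.
rewrite quartic_cubic_res_quadratics e1 e2 e3 e4 /nonmonic_form.
have -> : 2 * 2^-1 = 1 :> R by field.
have -> : 2 * 2 = 4 :> R by ring.
by have -> : 2 * (3 / 2) = 3 :> R by field.
Qed.

(** The coordinates on the left are those of the product with the unit 2 X^2 - X + 2
    modulo the quartic (X^2 + p X + q)(X^2 + r X + s). *)
Lemma qnorm_unit x0 x1 x2 x3 :
  qnorm p q (- x0 - 2 * x1 + 2 * x2) (3 * x0 - 2 * x1 - x2 + 2 * x3)
    (- 2 * x0 - x1 + 2 * x2 - x3) (3 * x0 - 3 * x1 + 2 * x3) =
  unit_norm p q * qnorm p q x0 x1 x2 x3.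
Proof.
pose B := p + r; pose C := q + s + p * r; pose D := p * s + q * r; pose E := q * s.
pose y0 := x1 - B * x0; pose y1 := x2 - C * x0; pose y2 := x3 - D * x0; pose y3 := - E * x0.
pose z0 := y1 - B * y0; pose z1 := y2 - C * y0; pose z2 := y3 - D * y0; pose z3 := - E * y0.
have <- : 2 * z0 - y0 + 2 * x0 = - x0 - 2 * x1 + 2 * x2.
  by rewrite /z0 /y0 /y1 /B /C e1 e2; field.
have <- : 2 * z1 - y1 + 2 * x1 = 3 * x0 - 2 * x1 - x2 + 2 * x3.
  by rewrite /z1 /y0 /y1 /y2 /B /C /D e1 e2 e3; field.
have <- : 2 * z2 - y2 + 2 * x2 = - 2 * x0 - x1 + 2 * x2 - x3.
  by rewrite /z2 /y0 /y2 /y3 /B /D /E e1 e3 e4; field.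
have <- : 2 * z3 - y3 + 2 * x3 = 3 * x0 - 3 * x1 + 2 * x3.
  by rewrite /z3 /y0 /y3 /B /E e1 e4; field.
rewrite /z0 /z1 /z2 /z3 /y0 /y1 /y2 /y3 /B /C /D /E /qnorm /redu /redv /unit_norm; ring.
Qed.
End Real.

(** * Real factors of the norm form *)

Lemma sqrtr_bounds (R : rcfType) (x a b : R) :
  0 <= a -> 0 <= b -> a ^+ 2 <= x <= b ^+ 2 -> a <= Num.sqrt x <= b.
Proof.
move=> a0 b0 /andP[ax xb]; rewrite -(ger0_norm a0) -(ger0_norm b0) -!sqrtr_sqr.
by rewrite !ler_wsqrtr.
Qed.

(** For the factorization of X^4 + X^3/2 + 2 X^2 + X/2 + 3/2 into X^2 + p X + q and
    X^2 + r X + s, the sum t = q + s is a root of the resolvent cubic, and d = p - r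
    and n = q - s are then square roots.  The cubic changes sign between two fractions
    close to its root; t^2 is close to 6, so n needs this precision. *)
Lemma quadratic_factors (R : rcfType) : exists d n : R,
  [/\ 7 / 5 <= d <= 3 / 2, 1 / 10 <= n <= 1 / 5 &
   exists t : R, [/\ 76 / 31 <= t <= 86 / 35,
    d ^+ 2 = 4 * t - 31 / 4, n ^+ 2 = t ^+ 2 - 6 & d * n = t / 2 - 1]].
Proof.
pose F : {poly R} := (4 *: 'X - (31 / 4)%:P) * ('X ^+ 2 - 6%:P) - (2^-1 *: 'X - 1) ^+ 2.
have FE t : F.[t] = (4 * t - 31 / 4) * (t ^+ 2 - 6) - (t / 2 - 1) ^+ 2.
  by rewrite /F !(hornerD, hornerN, hornerM, horner_exp, hornerZ, hornerX, hornerC); ring.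
have [||t /andP[t1 t2]] := @poly_ivt _ F (76 / 31) (86 / 35); first by lra.
  by rewrite !FE; apply/andP; split; rewrite ?expr2; lra.
rewrite rootE FE subr_eq0 => /eqP et.
have t0 : 0 <= 4 * t - 31 / 4 by lra.
have t3 : 6 <= t ^+ 2 by rewrite expr2; nra.
have ed : Num.sqrt (4 * t - 31 / 4) ^+ 2 = 4 * t - 31 / 4 by rewrite sqr_sqrtr.
have en : Num.sqrt (t ^+ 2 - 6) ^+ 2 = t ^+ 2 - 6 by rewrite sqr_sqrtr // subr_ge0.
have edn : Num.sqrt (4 * t - 31 / 4) * Num.sqrt (t ^+ 2 - 6) = t / 2 - 1.
  rewrite -sqrtrM // et sqrtr_sqr ger0_norm //; lra.
exists (Num.sqrt (4 * t - 31 / 4)), (Num.sqrt (t ^+ 2 - 6)); split.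
- by apply: sqrtr_bounds; rewrite ?expr2; lra.
- by apply: sqrtr_bounds; [lra..|rewrite !expr2; nra].
by exists t; split=> //; apply/andP.
Qed.

Lemma real_factors (R : rcfType) : exists p q r s : R,
  [/\ p + r = 2^-1, q + s + p * r = 2, p * s + q * r = 2^-1 & q * s = 3 / 2] /\
  [/\ 9 / 10 <= p <= 1, 6 / 5 <= q <= 7 / 5, - (1 / 2) <= r <= - (2 / 5) &
   [/\ 11 / 10 <= s <= 6 / 5, 7 / 5 <= p - r <= 3 / 2 & 1 / 10 <= q - s <= 1 / 5]].
Proof.
have [d [n [bd bn [t [bt ed en edn]]]]] := quadratic_factors R.
exists (4^-1 + d / 2), ((t + n) / 2), (4^-1 - d / 2), ((t - n) / 2); split; split.
- by field.
- have -> : (t + n) / 2 + (t - n) / 2 + (4^-1 + d / 2) * (4^-1 - d / 2) =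
    t + 1 / 16 - d ^+ 2 / 4 by field.
  by rewrite ed; field.
- have -> : (4^-1 + d / 2) * ((t - n) / 2) + (t + n) / 2 * (4^-1 - d / 2) =
    t / 4 - d * n / 2 by field.
  by rewrite edn; field.
- have -> : (t + n) / 2 * ((t - n) / 2) = (t ^+ 2 - n ^+ 2) / 4 by field.
  by rewrite en; field.
- clear -bd; lra.
- clear -bt bn; lra.
- clear -bd; lra.
split; clear -bt bd bn; lra.
Qed.

Lemma unit_norm_bounds (R : realFieldType) (p q : R) :
  9 / 10 <= p <= 1 -> 6 / 5 <= q <= 7 / 5 ->
  7 <= unit_norm p q <= 13.
Proof.
move=> /andP[p1 p2] /andP[q1 q2].
pose y := 2 * q - 2; pose w := 2 * p + 1.
have -> : unit_norm p q = y * y - y * (w * p) + w * w * q.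
  by rewrite /unit_norm /y /w; ring.
have [y1 y2] : 2 / 5 <= y /\ y <= 4 / 5 by rewrite /y; lra.
have [w1 w2] : 14 / 5 <= w /\ w <= 3 by rewrite /w; lra.
clearbody y w.
have h1 : 4 / 25 <= y * y <= 16 / 25 by clear -y1 y2; nra.
have h2 : 63 / 25 <= w * p <= 3 by clear -w1 w2 p1 p2; nra.
have h3 : 196 / 25 <= w * w <= 9 by clear -w1 w2; nra.
move: (w * p) (w * w) h2 h3 => z x h2 h3.
have h4 : 126 / 125 <= y * z <= 12 / 5 by clear -y1 y2 h2; nra.
have h5 : 235 / 25 <= x * q <= 63 / 5 by clear -q1 q2 h3; nra.
clear -h1 h4 h5; lra.
Qed.

Lemma qnorm_ge0 (R : realFieldType) (p q x0 x1 x2 x3 : R) :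
  p ^+ 2 <= 4 * q -> 0 <= qnorm p q x0 x1 x2 x3.
Proof.
rewrite /qnorm; move: (redu _ _ _ _ _ _) (redv _ _ _ _ _ _) => u v pq.
have -> : v ^+ 2 - p * u * v + q * u ^+ 2 = (v - p * u / 2) ^+ 2 + (4 * q - p ^+ 2) * (u / 2) ^+ 2.
  by field.
by rewrite addr_ge0 ?sqr_ge0 // mulr_ge0 ?sqr_ge0 // subr_ge0.
Qed.

Lemma factors_definite (R : realFieldType) (p q r s : R) :
  9 / 10 <= p <= 1 -> 6 / 5 <= q <= 7 / 5 ->
  - (1 / 2) <= r <= - (2 / 5) -> 11 / 10 <= s <= 6 / 5 ->
  p ^+ 2 <= 4 * q /\ r ^+ 2 <= 4 * s.
Proof. by move=> bp bq br bs; rewrite !expr2; split; [clear -bp bq|clear -br bs]; nra. Qed.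

Lemma sqr_le_abs (R : realFieldType) (u c : R) : 0 <= c -> u ^+ 2 <= c ^+ 2 -> - c <= u <= c.
Proof.
move=> c0 uc; rewrite -ler_norml -(@ler_pXn2r _ 2) ?nnegrE //.
by rewrite real_normK ?num_real.
Qed.

(** Completing the square in either variable. *)
Lemma qform_bounds (R : realFieldType) (P Q u v m M c d : R) : 0 <= c -> 0 <= d -> 0 < m ->
  m <= 4 * Q - P ^+ 2 -> 0 <= Q -> v ^+ 2 - P * u * v + Q * u ^+ 2 <= M ->
  4 * M <= m * c ^+ 2 -> 4 * Q * M <= m * d ^+ 2 -> (- c <= u <= c) /\ (- d <= v <= d).
Proof.
move=> c0 d0 m0 mle Q0; set N := (X in X <= M) => NM hc hd.
have E1 : 4 * N = (2 * v - P * u) ^+ 2 + (4 * Q - P ^+ 2) * u ^+ 2 by rewrite /N; ring.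
have E2 : 4 * Q * N = (2 * Q * u - P * v) ^+ 2 + (4 * Q - P ^+ 2) * v ^+ 2 by rewrite /N; ring.
have h (y z : R) : 0 <= z -> m * y ^+ 2 <= m * z ^+ 2 -> - z <= y <= z.
  by move=> z0; rewrite ler_pM2l //; apply: sqr_le_abs.
split; apply: h => //.
  apply: (le_trans _ hc); apply: (@le_trans _ _ (4 * N)); last by rewrite ler_pM2l.
  rewrite E1; apply: (@le_trans _ _ ((4 * Q - P ^+ 2) * u ^+ 2)).
    by rewrite ler_wpM2r ?sqr_ge0.
  by rewrite lerDr sqr_ge0.
apply: (le_trans _ hd); apply: (@le_trans _ _ (4 * Q * N)).
  rewrite E2; apply: (@le_trans _ _ ((4 * Q - P ^+ 2) * v ^+ 2)).
    by rewrite ler_wpM2r ?sqr_ge0.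
  by rewrite lerDr sqr_ge0.
by rewrite ler_wpM2l // mulr_ge0.
Qed.

Lemma mul_bounds (R : realFieldType) (a b x y : R) : -a <= x <= a -> -b <= y <= b -> - (a * b) <= x * y <= a * b.
Proof. by rewrite -!ler_norml normrM => xa yb; apply: ler_pM. Qed.

(** Small values of both quadratic forms bound the four remainder coefficients u, v, u',
    v'.  The differences u - u' and v - v' are linear in x0 and x1 alone, with
    determinant D bounded away from 0; then x2 and x3 follow. *)
Lemma balanced_box (R : realFieldType) (p q r s x0 x1 x2 x3 : R) :
  p + r = 2^-1 ->
  9 / 10 <= p <= 1 -> 6 / 5 <= q <= 7 / 5 ->
  - (1 / 2) <= r <= - (2 / 5) -> 11 / 10 <= s <= 6 / 5 ->
  7 / 5 <= p - r <= 3 / 2 -> 1 / 10 <= q - s <= 1 / 5 ->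
  qnorm p q x0 x1 x2 x3 <= 13 / 9 -> qnorm r s x0 x1 x2 x3 <= 9 / 8 ->
  [/\ - 3 < x0 < 3, - 4 < x1 < 4, - 7 < x2 < 7 & - 11 < x3 < 11].
Proof.
move=> e1 /andP[p1 p2] /andP[q1 q2] /andP[r1 r2] /andP[s1 s2] bd bn N1 N2.
have hp : 4 / 5 <= p ^+ 2 <= 1 by rewrite expr2; clear -p1 p2; nra.
have hr : r ^+ 2 <= 1 / 4 by rewrite expr2; clear -r1 r2; nra.
pose u := redu p q x0 x1 x2 x3; pose v := redv p q x0 x1 x2 x3.
pose u' := redu r s x0 x1 x2 x3; pose v' := redv r s x0 x1 x2 x3.
have [bu bv] : (- (5 / 4) <= u <= 5 / 4) /\ (- (3 / 2) <= v <= 3 / 2).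
  apply: (@qform_bounds R p q u v (19 / 5)) N1 _ _; rewrite ?expr2 //;
    clear -q1 q2 hp; lra.
have [bu' bv'] : (- (11 / 10) <= u' <= 11 / 10) /\ (- (6 / 5) <= v' <= 6 / 5).
  apply: (@qform_bounds R r s u' v' 4) N2 _ _; rewrite ?expr2 //;
    clear -s1 s2 hr; lra.
clear N1 N2.
have pq1 : 1 <= p * q <= 7 / 5 by clear -p1 p2 q1 q2; nra.
have rs1 : - (3 / 5) <= r * s <= - (11 / 25) by clear -r1 r2 s1 s2; nra.
pose A := p * q - r * s; pose c := p ^+ 2 - q - (r ^+ 2 - s).
have ec : c = (p - r) / 2 - (q - s).
  have er : r = 2^-1 - p by rewrite -e1; ring.
  by rewrite /c er; field.
have A1 : 7 / 5 <= A <= 2 by rewrite /A; clear -pq1 rs1; lra.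
have c1 : 1 / 2 <= c <= 13 / 20 by rewrite ec; clear -bd bn; lra.
have x0D : x0 * ((p - r) * A - c * (q - s)) = (p - r) * (v - v') - (q - s) * (u - u').
  by rewrite /A /c /u /v /u' /v' /redu /redv; ring.
have x1D : x1 * ((p - r) * A - c * (q - s)) = c * (v - v') - A * (u - u').
  by rewrite /A /c /u /v /u' /v' /redu /redv; ring.
have ex2 : x2 = u - x0 * (p ^+ 2 - q) + x1 * p by rewrite /u /redu; ring.
have ex3 : x3 = v - x0 * (p * q) + x1 * q by rewrite /v /redv; ring.
have du : - (12 / 5) <= u - u' <= 12 / 5 by clear -bu bu'; lra.
have dv : - (27 / 10) <= v - v' <= 27 / 10 by clear -bv bv'; lra.
clear bu' bv' ec e1 r1 r2 s1 s2 rs1 hr.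
move: (p - r) (q - s) (u - u') (v - v') bd bn du dv x0D x1D.
clearbody A c u v; clear u' v' => d n du dv bd bn hdu hdv x0D x1D.
have D1 : 9 / 5 <= d * A - c * n.
  have h1 : 7 / 5 * (7 / 5) <= d * A by apply: ler_pM; clear -bd A1; lra.
  have h2 : c * n <= 13 / 20 * (1 / 5) by apply: ler_pM; clear -c1 bn; lra.
  clear -h1 h2; lra.
have y0 : - (453 / 100) <= x0 * (d * A - c * n) <= 453 / 100.
  rewrite x0D.
  have h1 : - (3 / 2 * (27 / 10)) <= d * dv <= 3 / 2 * (27 / 10).
    by apply: mul_bounds => //; clear -bd; lra.
  have h2 : - (1 / 5 * (12 / 5)) <= n * du <= 1 / 5 * (12 / 5).
    by apply: mul_bounds => //; clear -bn; lra.
  clear -h1 h2; lra.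
have y1 : - (33 / 5) <= x1 * (d * A - c * n) <= 33 / 5.
  rewrite x1D.
  have h1 : - (13 / 20 * (27 / 10)) <= c * dv <= 13 / 20 * (27 / 10).
    by apply: mul_bounds => //; clear -c1; lra.
  have h2 : - (2 * (12 / 5)) <= A * du <= 2 * (12 / 5).
    by apply: mul_bounds => //; clear -A1; lra.
  clear -h1 h2; lra.
move: D1 y0 y1; set D := d * A - c * n; clearbody D => D1 y0 y1.
have z0 : - (13 / 5) <= x0 <= 13 / 5 by clear -D1 y0; apply/andP; split; nra.
have z1 : - (37 / 10) <= x1 <= 37 / 10 by clear -D1 y1; apply/andP; split; nra.
split; [clear -z0; lra | clear -z1; lra | rewrite ex2 | rewrite ex3].
  have h1 : - (13 / 5 * (3 / 5)) <= x0 * (p ^+ 2 - q) <= 13 / 5 * (3 / 5).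
    by apply: mul_bounds => //; clear -hp q1 q2; lra.
  have h2 : - (37 / 10 * 1) <= x1 * p <= 37 / 10 * 1.
    by apply: mul_bounds => //; clear -p1 p2; lra.
  clear -h1 h2 bu; lra.
have h1 : - (13 / 5 * (7 / 5)) <= x0 * (p * q) <= 13 / 5 * (7 / 5).
  by apply: mul_bounds => //; clear -pq1; lra.
have h2 : - (37 / 10 * (7 / 5)) <= x1 * q <= 37 / 10 * (7 / 5).
  by apply: mul_bounds => //; clear -q1 q2; lra.
clear -h1 h2 bv; lra.
Qed.

(** * The norm form avoids 1 and -1 *)

Local Notation int4 := (int * int * int * int)%type.
Definition form4 (x : int4) : int := let: (x0, x1, x2, x3) := x in nonmonic_form x0 x1 x2 x3.
(** Multiplication by the unit 2 X^2 - X + 2 and by its inverse, on coordinates. *)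
Definition unit_act (x : int4) : int4 := let: (x0, x1, x2, x3) := x in
  (- x0 - 2 * x1 + 2 * x2, 3 * x0 - 2 * x1 - x2 + 2 * x3,
   - 2 * x0 - x1 + 2 * x2 - x3, 3 * x0 - 3 * x1 + 2 * x3).
Definition unit_inv (x : int4) : int4 := let: (x0, x1, x2, x3) := x in
  (- x0 - 2 * x1 + 2 * x3, x0 - 2 * x1 - 2 * x2 + x3,
   x0 - 3 * x1 - 2 * x2 + 2 * x3, 3 * x0 - 3 * x2 - x3).
Definition qnorm4 (R : realFieldType) (p q : R) (x : int4) : R :=
  let: (x0, x1, x2, x3) := x in qnorm p q x0%:~R x1%:~R x2%:~R x3%:~R.

Lemma unit_actK x : unit_act (unit_inv x) = x.
Proof.
case: x => [[[x0 x1] x2] x3]; rewrite /unit_act /unit_inv.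
by congr (_, _, _, _); ring.
Qed.

Lemma form4_act x : form4 (unit_act x) = form4 x.
Proof.
case: x => [[[x0 x1] x2] x3]; rewrite /unit_act /form4 /nonmonic_form /quartic_cubic_res /det4.
by ring.
Qed.

(** Binary integers, on which the search through the box computes. *)
Definition zrange (n : nat) : seq Z := [seq Z_of_int (i%:Z - n%:Z) | i <- iota 0 (n.*2).+1].

Lemma mem_zrange n (x : int) : - n.+1%:Z < x < n.+1%:Z -> Z_of_int x \in zrange n.
Proof.
move=> /andP[x1 x2]; apply/mapP; exists (absz (x + n%:Z)); first by rewrite mem_iota; lia.
by congr Z_of_int; lia.
Qed.

Lemma form4_box x0 x1 x2 x3 : - 3 < x0 < 3 -> - 4 < x1 < 4 -> - 7 < x2 < 7 -> - 11 < x3 < 11 ->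
  form4 (x0, x1, x2, x3) != 1.
Proof.
have box : all (fun x0 => all (fun x1 => all (fun x2 => all (fun x3 =>
    nonmonic_form x0 x1 x2 x3 != 1 :> Z) (zrange 10)) (zrange 6)) (zrange 3)) (zrange 2).
  by vm_compute.
move=> b0 b1 b2 b3.
have {box} := allP (allP (allP (allP box _ (@mem_zrange 2 x0 b0)) _ (@mem_zrange 3 x1 b1))
  _ (@mem_zrange 6 x2 b2)) _ (@mem_zrange 10 x3 b3).
apply: contraNneq => /(congr1 Z_of_int).
rewrite /form4 /nonmonic_form rmorph_quartic_cubic_res => ->.
exact/eqP.
Qed.

Section Descent.
Variables (R : archiRealFieldType) (p q r s : R).
Hypotheses (e1 : p + r = 2^-1) (e2 : q + s + p * r = 2) (e3 : p * s + q * r = 2^-1)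
  (e4 : q * s = 3 / 2).
Hypotheses (bp : 9 / 10 <= p <= 1) (bq : 6 / 5 <= q <= 7 / 5)
  (br : - (1 / 2) <= r <= - (2 / 5)) (bs : 11 / 10 <= s <= 6 / 5)
  (bd : 7 / 5 <= p - r <= 3 / 2) (bn : 1 / 10 <= q - s <= 1 / 5).

Lemma form4_qnorm x : (form4 x)%:~R = 8 * (qnorm4 p q x * qnorm4 r s x).
Proof.
case: x => [[[x0 x1] x2] x3]; rewrite /form4 /qnorm4 -(form_qnorm e1 e2 e3 e4).
exact: rmorph_quartic_cubic_res.
Qed.

Lemma qnorm4_act x : qnorm4 p q (unit_act x) = unit_norm p q * qnorm4 p q x.
Proof.
case: x => [[[x0 x1] x2] x3]; rewrite /qnorm4 -(qnorm_unit e1 e2 e3 e4 x0%:~R).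
have h0 : (- x0 - 2 * x1 + 2 * x2)%:~R = - x0%:~R - 2 * x1%:~R + 2 * x2%:~R :> R by ring.
have h1 : (3 * x0 - 2 * x1 - x2 + 2 * x3)%:~R =
  3 * x0%:~R - 2 * x1%:~R - x2%:~R + 2 * x3%:~R :> R by ring.
have h2 : (- 2 * x0 - x1 + 2 * x2 - x3)%:~R =
  - 2 * x0%:~R - x1%:~R + 2 * x2%:~R - x3%:~R :> R by ring.
have h3 : (3 * x0 - 3 * x1 + 2 * x3)%:~R = 3 * x0%:~R - 3 * x1%:~R + 2 * x3%:~R :> R by ring.
by rewrite /= h0 h1 h2 h3.
Qed.

Lemma form4_ge0 x : 0 <= form4 x.
Proof.
rewrite -(ler0z R) form4_qnorm; case: x => [[[x0 x1] x2] x3].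
have [pq rs] := factors_definite bp bq br bs.
by rewrite mulr_ge0 // mulr_ge0 //; apply: qnorm_ge0.
Qed.

Lemma qnorm4_ge0 x : 0 <= qnorm4 p q x.
Proof. by case: x => [[[x0 x1] x2] x3]; apply: qnorm_ge0; case: (factors_definite bp bq br bs). Qed.

(** Division by the unit shrinks the first form by a factor between 7 and 13, which
    cannot jump over the interval from 1/9 to 13/9. *)
Lemma divide_by_unit m x : form4 x = 1 -> 1 / 9 <= qnorm4 p q x <= 13 / 9 * 7 ^+ m ->
  exists2 y, form4 y = 1 & 1 / 9 <= qnorm4 p q y <= 13 / 9.
Proof.
elim: m x => [|m IHm] x Fx; first by rewrite expr0 mulr1; exists x.
move=> /andP[lx ux]; have [hx|hx] := leP (qnorm4 p q x) (13 / 9).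
  by exists x => //; apply/andP.
apply: (IHm (unit_inv x)); first by rewrite -form4_act unit_actK.
have := qnorm4_act (unit_inv x); rewrite unit_actK.
move/andP: (unit_norm_bounds bp bq) => [].
have := qnorm4_ge0 (unit_inv x); move: (qnorm4 _ _ _) (unit_norm _ _) => N l N0 l1 l2 e.
have h1 : 7 * N <= qnorm4 p q x by rewrite e ler_wpM2r.
have h2 : qnorm4 p q x <= 13 * N by rewrite e ler_wpM2r.
move: ux h1 h2 hx lx; rewrite exprS; move: (qnorm4 _ _ _) (7 ^+ m) => M k.
lra.
Qed.

Lemma multiply_by_unit m x : form4 x = 1 -> qnorm4 p q x <= 13 / 9 -> 1 <= 9 * 7 ^+ m * qnorm4 p q x ->
  exists2 y, form4 y = 1 & 1 / 9 <= qnorm4 p q y <= 13 / 9.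
Proof.
elim: m x => [|m IHm] x Fx ux lx.
  exists x => //; rewrite ux andbT; move: lx; rewrite expr0; move: (qnorm4 _ _ _) => N.
  lra.
have [hx|hx] := leP (1 / 9) (qnorm4 p q x); first by exists x; rewrite ?hx.
apply: (IHm (unit_act x)); rewrite ?form4_act // qnorm4_act.
  have h2 : unit_norm p q * qnorm4 p q x <= 13 * qnorm4 p q x.
    by rewrite ler_wpM2r ?qnorm4_ge0 //; case/andP: (unit_norm_bounds bp bq).
  by move: hx h2; move: (unit_norm p q * qnorm4 p q x) => M; move: (qnorm4 _ _ _) => N; lra.
apply: (le_trans lx); rewrite exprS mulrA -!mulrA ler_wpM2l // mulrCA.
rewrite ler_wpM2l ?exprn_ge0 // ler_wpM2r ?qnorm4_ge0 //.
by case/andP: (unit_norm_bounds bp bq).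
Qed.

(** As the product of the two forms is 1/8, balancing the first one between 1/9 and
    13/9 bounds the second by 9/8. *)
Lemma form4_neq1 x : form4 x != 1.
Proof.
apply/eqP => Fx.
have N8 y : form4 y = 1 -> 8 * (qnorm4 p q y * qnorm4 r s y) = 1.
  by move=> Fy; rewrite -form4_qnorm Fy.
have [y Fy /andP[ly uy]] : exists2 y, form4 y = 1 & 1 / 9 <= qnorm4 p q y <= 13 / 9.
  have [hx|hx] := leP (qnorm4 p q x) (1 / 9).
    have hx' : qnorm4 p q x <= 13 / 9 by move: hx; move: (qnorm4 _ _ _) => N; lra.
    pose i := Num.bound (qnorm4 r s x); apply: (@multiply_by_unit i _ Fx hx').
    have : qnorm4 r s x <= 7 ^+ i.
      rewrite ltW // (lt_le_trans (upper_nthrootP (leqnn _))) //.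
      by rewrite lerXn2r ?nnegrE ?ler_nat.
    move=> /(ler_wpM2l (qnorm4_ge0 x)); have := N8 _ Fx.
    have : 0 <= qnorm4 p q x * 7 ^+ i by rewrite mulr_ge0 ?exprn_ge0 ?qnorm4_ge0.
    by move: (qnorm4 _ _ _) (qnorm4 _ _ _) (7 ^+ i) => M N K; lra.
  pose i := Num.bound (qnorm4 p q x); apply: (@divide_by_unit i _ Fx); rewrite (ltW hx) /=.
  have : qnorm4 p q x <= 7 ^+ i.
    rewrite ltW // (lt_le_trans (upper_nthrootP (leqnn _))) //.
    by rewrite lerXn2r ?nnegrE ?ler_nat.
  have : 0 <= 7 ^+ i :> R by rewrite exprn_ge0.
  by move: (qnorm4 _ _ _) (7 ^+ i) => M N; lra.
have : qnorm4 r s y <= 9 / 8.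
  have := N8 _ Fy; move: ly; move: (qnorm4 _ _ _) (qnorm4 _ _ _) => M N; nra.
case: y Fy ly uy => [[[x0 x1] x2] x3] Fy _ uy uy'.
have [b0 b1 b2 b3] := balanced_box e1 bp bq br bs bd bn uy uy'.
have := @form4_box x0 x1 x2 x3; rewrite Fy eqxx.
have int_bound n (z : int) : - n%:R < (z%:~R : R) < n%:R -> - n%:Z < z < n%:Z.
  by rewrite -[n%:R]/((n%:Z)%:~R) -rmorphN !ltr_int.
by move=> /(_ (int_bound 3%N _ b0) (int_bound 4%N _ b1) (int_bound 7%N _ b2) (int_bound 11%N _ b3)).
Qed.
End Descent.

Lemma nonmonic_form_neq_sign x0 x1 x2 x3 (e : bool) : nonmonic_form x0 x1 x2 x3 != (-1) ^+ e :> int.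
Proof.
have [p [q [r [s [[e1 e2 e3 e4] [bp bq br [bs bd bn]]]]]]] := real_factors algR.
case: e.
  apply: contraTneq (form4_ge0 e1 e2 e3 e4 bp bq br bs (x0, x1, x2, x3)) => h.
  by rewrite /form4 h.
exact: (form4_neq1 e1 e2 e3 e4 bp bq br bs bd bn (x0, x1, x2, x3)).
Qed.

(** * Two quartics of discriminant 7537 *)

Lemma quartic_prod (R : comNzRingType) (a z0 z1 z2 z3 : R) :
  let b := - a * (z0 + z1 + z2 + z3) in
  let c := a * (z0 * z1 + z0 * z2 + z0 * z3 + z1 * z2 + z1 * z3 + z2 * z3) in
  let d := - a * (z0 * z1 * z2 + z0 * z1 * z3 + z0 * z2 * z3 + z1 * z2 * z3) in
  let e := a * (z0 * z1 * z2 * z3) in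
  a *: (('X - z0%:P) * ('X - z1%:P) * ('X - z2%:P) * ('X - z3%:P)) = Poly [:: e; d; c; b; a].
Proof.
move=> b c d e; rewrite -mul_polyC /= !cons_poly_def /b /c /d /e.
by rewrite !(polyCM, polyCD, polyCN) polyC0; ring.
Qed.

Lemma quartic_vieta (f : {poly int}) (al : 'I_4 -> algC) :
  has_degree 4 f -> has_roots f al ->
  let z k := al (inord k) in let a : algC := (f`_4)%:~R in
  [/\ (f`_3)%:~R = - a * (z 0%N + z 1%N + z 2%N + z 3%N),
   (f`_2)%:~R = a * (z 0%N * z 1%N + z 0%N * z 2%N + z 0%N * z 3%N + z 1%N * z 2%N + z 1%N * z 3%N + z 2%N * z 3%N),
   (f`_1)%:~R = - a * (z 0%N * z 1%N * z 2%N + z 0%N * z 1%N * z 3%N + z 0%N * z 2%N * z 3%N + z 1%N * z 2%N * z 3%N)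
   & (f`_0)%:~R = a * (z 0%N * z 1%N * z 2%N * z 3%N)].
Proof.
move=> sz; rewrite /has_roots lead_coefE (sz : size f = _) /=.
have -> : \prod_(i < 4) ('X - (al i)%:P) =
    \prod_(i < 4) ('X - (al (inord i))%:P : {poly algC}).
  by apply: eq_bigr => i _; rewrite inord_val.
rewrite !big_ord_recl big_ord0 mulr1 => h; rewrite !mulrA in h.
pose z k := al (inord k).
have {}h := etrans h (quartic_prod _ (z 0%N) (z 1%N) (z 2%N) (z 3%N)).
have c k : (f`_k)%:~R = (map_poly intr f : {poly algC})`_k by rewrite coef_map.
by split; rewrite c h coef_Poly.
Qed.

(** 27 times the discriminant of a quartic, as 4 I^3 - J^2 in its classical
    invariants I and J. *)
Definition disc27 (R : comNzRingType) (a b c d e : R) : R :=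
  4 * (12 * a * e - 3 * b * d + c ^+ 2) ^+ 3 -
  (72 * a * c * e + 9 * b * c * d - 27 * a * d ^+ 2 - 27 * e * b ^+ 2 - 2 * c ^+ 3) ^+ 2.

Lemma rmorph_disc27 (R S : comNzRingType) (f : {rmorphism R -> S}) a b c d e :
  f (disc27 a b c d e) = disc27 (f a) (f b) (f c) (f d) (f e).
Proof.
by rewrite /disc27 !(rmorph_nat, rmorphB, rmorphXn, rmorphM, rmorphD).
Qed.

Lemma disc27_roots (R : comNzRingType) (a z0 z1 z2 z3 : R) :
  27 * (a ^+ 6 * ((z0 - z1) ^+ 2 * (z0 - z2) ^+ 2 * (z0 - z3) ^+ 2 *
    (z1 - z2) ^+ 2 * (z1 - z3) ^+ 2 * (z2 - z3) ^+ 2)) =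
  disc27 a (- a * (z0 + z1 + z2 + z3))
    (a * (z0 * z1 + z0 * z2 + z0 * z3 + z1 * z2 + z1 * z3 + z2 * z3))
    (- a * (z0 * z1 * z2 + z0 * z1 * z3 + z0 * z2 * z3 + z1 * z2 * z3))
    (a * (z0 * z1 * z2 * z3)).
Proof. by rewrite /disc27; ring. Qed.

(** The identity is checked on binary integers. *)
Lemma quartic_disc (f : {poly int}) (D : int) : has_degree 4 f ->
  27 * Z_of_int D = disc27 (Z_of_int f`_4) (Z_of_int f`_3) (Z_of_int f`_2)
    (Z_of_int f`_1) (Z_of_int f`_0) -> disc f = D%:~R.
Proof.
move=> sz eDZ; have eD : 27 * D = disc27 f`_4 f`_3 f`_2 f`_1 f`_0.
  by apply: (can_inj Z_of_intK); rewrite [RHS]rmorph_disc27 -eDZ [LHS]rmorphM.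
have h := complex_roots_has_roots sz.
set al := fun i => _ in h; pose z k := al (inord k).
have [eb ec ed ee] := quartic_vieta sz h.
have n27 : (27 : algC) != 0 by rewrite pnatr_eq0.
apply: (mulfI n27); rewrite (discE sz h) det_rootmx_sqr lead_coefE (sz : size f = _) /=.
have -> : \prod_(i < 4) \prod_(j < 4 | (i < j)%N) (al i - al j) ^+ 2 =
    \prod_(i < 4) \prod_(j < 4 | (i < j)%N) (z i - z j) ^+ 2.
  by apply: eq_bigr => i _; apply: eq_bigr => j _; rewrite /z !inord_val.
rewrite !big_ord_recl !big_ord0.
rewrite !(big_mkcond (fun j : 'I__ => (_ < _)%N)) /= !big_ord_recl !big_ord0 /= !mulr1 !mul1r.
have := congr1 (fun k : int => k%:~R : algC) eD.
rewrite rmorph_disc27 rmorphM rmorph_nat /= eb ec ed ee => ->.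
by have := disc27_roots (f`_4)%:~R (z 0%N) (z 1%N) (z 2%N) (z 3%N); rewrite !mulrA.
Qed.

Lemma prime_squarefree (p : nat) : prime p -> squarefree p%:Z.
Proof.
move=> pr m; rewrite /squarefree dvdzE abszX /= => dm.
have m1 : (`|m|%N %| p)%N by apply: dvdn_trans dm; rewrite dvdn_mulr.
have : `|m|%N = 1%N.
  move: (pr) => /primeP[p1 /(_ _ m1)/orP[/eqP//|/eqP em]].
  by move: dm; rewrite em pfactor_dvdn ?prime_gt0 // lognE pr prime_gt0 // dvdnn divnn prime_gt0 //= logn1.
by rewrite qualifE /=; lia.
Qed.

Definition monic_quartic : {poly int} := Poly [:: 4; 1; 5; 0; 1].
Definition nonmonic_quartic : {poly int} := Poly [:: 3; 1; 4; 1; 2].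

Lemma has_degree_monic_quartic : has_degree 4 monic_quartic.
Proof. by rewrite /has_degree (@PolyK _ 0). Qed.

Lemma has_degree_nonmonic_quartic : has_degree 4 nonmonic_quartic.
Proof. by rewrite /has_degree (@PolyK _ 0). Qed.

Lemma squarefree_disc_monic_quartic : squarefree_disc monic_quartic.
Proof.
exists 7537%:Z; last exact: prime_squarefree.
by apply: (quartic_disc has_degree_monic_quartic); rewrite !coef_Poly; vm_compute.
Qed.

Lemma squarefree_disc_nonmonic_quartic : squarefree_disc nonmonic_quartic.
Proof.
exists 7537%:Z; last exact: prime_squarefree.
by apply: (quartic_disc has_degree_nonmonic_quartic); rewrite !coef_Poly; vm_compute.
Qed.

(** The Hermite form of a monic quartic is 1 at (0, 0, 0, 1), whose image under the
    substitution is the last column of U. *)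
Lemma quartics_not_hermite_equiv : ~ hermite_equiv 4 monic_quartic nonmonic_quartic.
Proof.
pose v : 'cV[algC]_4 := delta_mx (inord 3) 0.
case=> sf sg [U _ [e]] /(congr1 (fun p : {mpoly algC[4]} => p.@[fun i => v i 0])).
have hf := complex_roots_has_roots sf; have hg := complex_roots_has_roots sg.
set al := fun i => _ in hf; set be := fun i => _ in hg.
pose x k := U (inord k) (inord 3).
rewrite lin_subst_eval (hermite_form_eval (map_mx intr U *m v) sg hg) mevalZ.
rewrite (hermite_form_eval v sf hf).
have -> : \prod_(i < 4) (rootmx al *m v) i 0 = 1.
  by apply: big1 => i _; rewrite -colE !mxE inordK // subnn expr0.
have -> : lead_coef monic_quartic = 1 by rewrite lead_coefE (sf : size _ = _) coef_Poly.
have -> : lead_coef nonmonic_quartic = 2 by rewrite lead_coefE (sg : size _ = _) coef_Poly.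
rewrite expr1n !mulr1 -colE /=.
have -> : \prod_(i < 4) (rootmx be *m col (inord 3) (map_mx intr U)) i 0 =
    \prod_(i < 4) (fun z => (x 0%N)%:~R * z ^+ 3 + (x 1%N)%:~R * z ^+ 2 +
      (x 2%N)%:~R * z + (x 3%N)%:~R : algC) (be (inord i)).
  apply: eq_bigr => i _; rewrite inord_val mxE.
  rewrite -[LHS]/(\sum_j _) !big_ord_recl big_ord0 addr0 !mxE /=.
  have xE (k : 'I_4) : U k (inord 3) = x k by rewrite /x inord_val.
  rewrite !xE /= -!addrA; congr (_ + (_ + (_ + _))); rewrite mulrC //.
  by rewrite /bump subnn mulr1.
have [eb ec ed ee] := quartic_vieta sg hg; rewrite !coef_Poly /= in eb ec ed ee.
have := quartic_cubic_res_roots 2%:~R (be (inord 0)) (be (inord 1)) (be (inord 2)) (be (inord 3))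
  (x 0%N)%:~R (x 1%N)%:~R (x 2%N)%:~R (x 3%N)%:~R.
rewrite -eb -ec -ed -ee !big_ord_recl big_ord0 mulr1 !mulrA /= => -> h.
have /eqP[] := nonmonic_form_neq_sign (x 0%N) (x 1%N) (x 2%N) (x 3%N) e.
apply: (@intr_inj algC); rewrite rmorphXn rmorphN1 -h /nonmonic_form.
exact: rmorph_quartic_cubic_res.
Qed.

(** * The isomorphism of invariant orders *)

(** The element with coordinates c0, ..., c3 on the basis of the invariant order of
    f0 X^4 + f1 X^3 + f2 X^2 + .... *)
Definition order_elt (A : comNzRingType) (f0 f1 f2 : A) (a : A) (c0 c1 c2 c3 : A) : A :=
  c0 + f0 * a * c1 + (f0 * a ^+ 2 + f1 * a) * c2 + (f0 * a ^+ 3 + f1 * a ^+ 2 + f2 * a) * c3.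

Definition monic_val (A : comNzRingType) (a : A) : A := a ^+ 4 + 5 * a ^+ 2 + a + 4.
Definition nonmonic_val (A : comNzRingType) (a : A) : A :=
  2 * a ^+ 4 + a ^+ 3 + 4 * a ^+ 2 + a + 3.

Lemma rmorph_monic_val (A B : comNzRingType) (f : {rmorphism A -> B}) a :
  f (monic_val a) = monic_val (f a).
Proof. by rewrite /monic_val !(rmorph_nat, rmorphD, rmorphM, rmorphXn). Qed.

Lemma rmorph_nonmonic_val (A B : comNzRingType) (f : {rmorphism A -> B}) a :
  f (nonmonic_val a) = nonmonic_val (f a).
Proof. by rewrite /nonmonic_val !(rmorph_nat, rmorphD, rmorphM, rmorphXn). Qed.

(** The image of the root of the monic quartic. *)
Definition theta (A : comNzRingType) (a : A) : A := 2 * a ^+ 2 + a + 2.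

(** The coordinate change is unimodular.  The multiplier in the proof is the quotient in
    the division of the difference by the quartic. *)
Lemma order_elt_subst (A : comNzRingType) (a c0 c1 c2 c3 : A) :
  nonmonic_val a = 0 ->
  order_elt 1 0 5 (theta a) c0 c1 c2 c3 =
  order_elt 2 1 4 a (c0 + 2 * c1 - 2 * c2 + 3 * c3) (- c2 - c3) (c1 + 2 * c3) c2.
Proof.
move=> e; apply: (subr0_eq).
transitivity (nonmonic_val a *
  (2 * c2 + (5 + 4 * a + 4 * a ^+ 2) * c3)); last by rewrite e mul0r.
by rewrite /order_elt /nonmonic_val /theta; ring.
Qed.

Lemma order_elt_substz (A : comNzRingType) (a : A) (c0 c1 c2 c3 : int) :
  nonmonic_val a = 0 ->
  order_elt 1 0 5%:~R (theta a) c0%:~R c1%:~R c2%:~R c3%:~R =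
  order_elt 2 1 4 a (c0 + 2 * c1 - 2 * c2 + 3 * c3)%:~R (- c2 - c3)%:~R
    (c1 + 2 * c3)%:~R c2%:~R.
Proof.
move=> e; have -> : 5%:~R = 5 :> A by [].
rewrite (order_elt_subst _ _ _ _ e); congr order_elt; ring.
Qed.

Lemma monic_val_theta (A : comNzRingType) (a : A) :
  nonmonic_val a = 0 ->
  monic_val (theta a) = 0.
Proof.
move=> e.
transitivity (nonmonic_val a *
  (14 + 13 * a + 22 * a ^+ 2 + 12 * a ^+ 3 + 8 * a ^+ 4)); last by rewrite e mul0r.
by rewrite /monic_val /nonmonic_val /theta; ring.
Qed.

Lemma in_qpoly_val (R : comNzRingType) (F : {poly R}) (x : {poly %/ F}) : in_qpoly F x = x.
Proof. by apply: val_inj; apply: in_qpoly_small; apply: size_mk_monic. Qed.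

Lemma in_qpoly_eq0 (R : fieldType) (F : {poly R}) p : in_qpoly F (p * mk_monic F) = 0.
Proof. by apply/val_inj; rewrite /= Pdiv.RingMonic.rmodp_mull ?monic_mk_monic. Qed.

(** A homomorphism out of K[X]/(F) is evaluation at a root of F. *)
Lemma in_qpoly_horner (R : fieldType) (F G : {poly R}) (y : {poly %/ G}) : 
  in_qpoly G (mk_monic F \Po (y : {poly R})) = 0 ->
  exists phi : {rmorphism {poly %/ F} -> {poly %/ G}}, phi (qpolyX F) = y.
Proof.
move=> Fy; pose phi (x : {poly %/ F}) := in_qpoly G ((x : {poly R}) \Po (y : {poly R})).
have phiE p : phi (in_qpoly F p) = in_qpoly G (p \Po (y : {poly R})).
  have e := Pdiv.RingMonic.rdivp_eq (monic_mk_monic F) p.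
  by rewrite [in RHS]e comp_polyD comp_polyM in_qpolyD in_qpolyM Fy mulr0 add0r.
have phiB : zmod_morphism phi.
  by move=> u v; rewrite /phi /= comp_polyB raddfB.
have phiM : monoid_morphism phi.
  split=> [|u v]; first by rewrite -(in_qpoly1 F) phiE comp_polyC in_qpoly1.
  by rewrite -{1}(in_qpoly_val u) -{1}(in_qpoly_val v) -in_qpolyM phiE comp_polyM in_qpolyM.
pose mB := GRing.isZmodMorphism.Build _ _ phi phiB.
pose mM := GRing.isMonoidMorphism.Build _ _ phi phiM.
pose f : {rmorphism _ -> _} := HB.pack phi mB mM.
by exists f; rewrite /= /qpolyX phiE comp_polyX in_qpoly_val.
Qed.

Lemma rmorph_order_elt (A B : comNzRingType) (f : {rmorphism A -> B}) f0 f1 f2 a c0 c1 c2 c3 :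
  f (order_elt f0 f1 f2 a c0 c1 c2 c3) =
  order_elt (f f0) (f f1) (f f2) (f a) (f c0) (f c1) (f c2) (f c3).
Proof. by rewrite /order_elt !(rmorphD, rmorphM, rmorphXn). Qed.

Lemma order_elt_sum (A : comNzRingType) (f0 f1 f2 : int) (a : A) (c : nat -> int) :
  1 *~ c 0%N + ((a *~ f0) *~ c 1%N + ((a ^+ 2 *~ f0 + a *~ f1) *~ c 2%N +
    (a ^+ 3 *~ f0 + (a ^+ 2 *~ f1 + a *~ f2)) *~ c 3%N)) =
  order_elt f0%:~R f1%:~R f2%:~R a (c 0%N)%:~R (c 1%N)%:~R (c 2%N)%:~R (c 3%N)%:~R.
Proof.
rewrite /order_elt -(mulrzr a f0) -(mulrzr a f1) -(mulrzr a f2).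
rewrite -(mulrzr (a ^+ 2) f0) -(mulrzr (a ^+ 2) f1) -(mulrzr (a ^+ 3) f0).
rewrite -(mulrzr _ (c 1%N)) -(mulrzr _ (c 2%N)) -(mulrzr _ (c 3%N)).
by ring.
Qed.

Lemma quartic_orderP (f : {poly int}) x : has_degree 4 f ->
  invariant_order f x <-> exists c0 c1 c2 c3 : int,
    x = order_elt (f`_4)%:~R (f`_3)%:~R (f`_2)%:~R (alpha f) c0%:~R c1%:~R c2%:~R c3%:~R.
Proof.
move=> sz; have e (c : nat -> int) : \sum_(i < (size f).-1) omega f i *~ c i =
    order_elt (f`_4)%:~R (f`_3)%:~R (f`_2)%:~R (alpha f)
      (c 0%N)%:~R (c 1%N)%:~R (c 2%N)%:~R (c 3%N)%:~R.
  rewrite (sz : size f = _) /= !big_ord_recl big_ord0 addr0 -order_elt_sum.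
  by rewrite /omega /= (sz : size f = _) /= !big_ord_recl !big_ord0 /= !addr0.
split=> [[c ->]|[c0 [c1 [c2 [c3 ->]]]]].
  pose c' k := oapp c 0 (insub k).
  exists (c' 0%N), (c' 1%N), (c' 2%N), (c' 3%N); rewrite -e.
  by apply: eq_bigr => i _; rewrite /c' valK.
by exists (fun i => [:: c0; c1; c2; c3]`_i); rewrite (e (nth 0 [:: c0; c1; c2; c3])).
Qed.

Lemma in_qpoly_map_monic_rat n f : (0 < n)%N -> has_degree n f ->
  in_qpoly (monic_rat f) (map_poly intr f) = 0.
Proof.
move=> n0 sz; have f0 : (lead_coef f)%:~R != 0 :> rat.
  by rewrite intr_eq0 lead_coef_eq0 -size_poly_eq0 sz.
rewrite -(in_qpoly_eq0 (monic_rat f) ((lead_coef f)%:~R)%:P) (mk_monic_rat n0 sz).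
by rewrite /monic_rat mul_polyC scalerA divff ?scale1r.
Qed.

Lemma size_mk_monic_rat n f : (0 < n)%N -> has_degree n f ->
  size (mk_monic (monic_rat f)) = n.+1.
Proof.
move=> n0 sz; rewrite (mk_monic_rat n0 sz) /monic_rat size_scale.
  by rewrite size_map_inj_poly //; exact: intr_inj.
by rewrite invr_eq0 intr_eq0 lead_coef_eq0 -size_poly_eq0 sz.
Qed.

Lemma monic_quarticE : monic_quartic = monic_val 'X.
Proof.
by rewrite /monic_quartic /= !cons_poly_def !(polyC_natr, polyC1, polyC0) /monic_val; ring.
Qed.

Lemma nonmonic_quarticE : nonmonic_quartic = nonmonic_val 'X.
Proof.
by rewrite /nonmonic_quartic /= !cons_poly_def !(polyC_natr, polyC1, polyC0) /nonmonic_val; ring.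
Qed.

Lemma nonmonic_quartic_root : nonmonic_val (alpha nonmonic_quartic) = 0.
Proof.
have := @in_qpoly_map_monic_rat 4 _ isT has_degree_nonmonic_quartic.
by rewrite nonmonic_quarticE !rmorph_nonmonic_val /= map_polyX.
Qed.

(** The basis elements have representatives of degrees 0, 1, 2, 3. *)
Lemma nonmonic_order_elt_inj (a := alpha nonmonic_quartic) (c0 c1 c2 c3 d0 d1 d2 d3 : int) :
  order_elt 2%:R 1 4%:R a c0%:~R c1%:~R c2%:~R c3%:~R =
  order_elt 2%:R 1 4%:R a d0%:~R d1%:~R d2%:~R d3%:~R ->
  [/\ c0 = d0, c1 = d1, c2 = d2 & c3 = d3].
Proof.
pose P (z0 z1 z2 z3 : int) : {poly rat} :=
  order_elt 2%:R 1 4%:R 'X z0%:~R z1%:~R z2%:~R z3%:~R.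
have PE z0 z1 z2 z3 : P z0 z1 z2 z3 =
    Poly [:: z0%:~R; 2 * z1%:~R + z2%:~R + 4 * z3%:~R; 2 * z2%:~R + z3%:~R; 2 * z3%:~R].
  have cz (z : int) : (z%:~R : rat)%:P = z%:~R := rmorph_int _ z.
  rewrite /P /= !cons_poly_def !(polyCD, polyCM, polyC_natr, polyC0) !cz /order_elt.
  by move: (z0%:~R) (z1%:~R) (z2%:~R) (z3%:~R) => y0 y1 y2 y3; ring.
have inP z0 z1 z2 z3 : order_elt 2%:R 1 4%:R a z0%:~R z1%:~R z2%:~R z3%:~R =
    in_qpoly (monic_rat nonmonic_quartic) (P z0 z1 z2 z3).
  by rewrite /P rmorph_order_elt /= !rmorph_int !rmorph_nat rmorph1.
have szP z0 z1 z2 z3 : (size (P z0 z1 z2 z3) < size (mk_monic (monic_rat nonmonic_quartic)))%N.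
  by rewrite (@size_mk_monic_rat 4 _ isT has_degree_nonmonic_quartic) ltnS PE; apply: size_Poly.
rewrite !inP => /(congr1 (@polyn _ _)).
rewrite (in_qpoly_small (szP c0 c1 c2 c3)) (in_qpoly_small (szP d0 d1 d2 d3)) !PE => /polyP e.
have e0 := e 0%N; have e1 := e 1%N; have e2 := e 2%N; have e3 := e 3%N.
rewrite !coef_Poly /= in e0 e1 e2 e3.
have {}e3 : c3 = d3 by apply: (@intr_inj rat); move: e3; clear; lra.
move: e1 e2; rewrite e3 => e1 e2.
have {}e2 : c2 = d2 by apply: (@intr_inj rat); move: e2; clear; lra.
move: e1; rewrite e2 => e1.
have {}e1 : c1 = d1 by apply: (@intr_inj rat); move: e1; clear; lra.
by split=> //; apply: (@intr_inj rat).
Qed.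

(** Surjectivity and injectivity follow by inverting the unimodular coordinate change. *)
Lemma quartics_orders_isomorphic :
  invariant_orders_isomorphic monic_quartic nonmonic_quartic.
Proof.
pose a := alpha nonmonic_quartic.
have [phi phiX] : exists phi : {rmorphism Kalg monic_quartic -> Kalg nonmonic_quartic},
    phi (alpha monic_quartic) = theta a.
  apply: in_qpoly_horner; rewrite (@mk_monic_rat 4 _ isT has_degree_monic_quartic).
  have -> : monic_rat monic_quartic = monic_val 'X.
    rewrite /monic_rat lead_coefE (has_degree_monic_quartic : size _ = _) coef_Poly /=.
    by rewrite invr1 scale1r monic_quarticE rmorph_monic_val /= map_polyX.
  have := monic_val_theta nonmonic_quartic_root; move: (theta _) => y y0.
  rewrite (rmorph_monic_val (comp_poly _)) /= comp_polyX.
  by rewrite (rmorph_monic_val (in_qpoly _)) /= in_qpoly_val.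
have phiE c0 c1 c2 c3 : phi (order_elt (monic_quartic`_4)%:~R (monic_quartic`_3)%:~R
      (monic_quartic`_2)%:~R (alpha monic_quartic) c0%:~R c1%:~R c2%:~R c3%:~R) =
    order_elt 2 1 4 a (c0 + 2 * c1 - 2 * c2 + 3 * c3)%:~R (- c2 - c3)%:~R
      (c1 + 2 * c3)%:~R c2%:~R.
  rewrite rmorph_order_elt !rmorph_int phiX !coef_Poly.
  exact: order_elt_substz nonmonic_quartic_root.
exists phi; split; [| exact: rmorph1 | by move=> *; exact: rmorphD | by move=> *; exact: rmorphM].
have ng : nonmonic_quartic`_4 = 2 /\ nonmonic_quartic`_3 = 1 /\ nonmonic_quartic`_2 = 4.
  by rewrite !coef_Poly.
split.
- move=> x /(quartic_orderP _ has_degree_monic_quartic)[c0 [c1 [c2 [c3 ->]]]].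
  apply/(quartic_orderP _ has_degree_nonmonic_quartic); rewrite phiE !coef_Poly.
  by do 4 eexists.
- move=> x y /set_mem/(quartic_orderP _ has_degree_monic_quartic)[c0 [c1 [c2 [c3 ->]]]].
  move=> /set_mem/(quartic_orderP _ has_degree_monic_quartic)[d0 [d1 [d2 [d3 ->]]]].
  rewrite !phiE => /nonmonic_order_elt_inj[e0 e1 e2 e3].
  have -> : c2 = d2 by [].
  have -> : c3 = d3 by lia.
  have -> : c1 = d1 by lia.
  by have -> : c0 = d0 by lia.
- move=> y /(quartic_orderP _ has_degree_nonmonic_quartic)[d0 [d1 [d2 [d3 ->]]]].
  exists (order_elt (monic_quartic`_4)%:~R (monic_quartic`_3)%:~R
      (monic_quartic`_2)%:~R (alpha monic_quartic) (d0 - d1 - 2 * d2 + d3)%:~R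
      (d2 + 2 * d1 + 2 * d3)%:~R d3%:~R (- d1 - d3)%:~R).
    by apply/(quartic_orderP _ has_degree_monic_quartic); do 4 eexists.
  rewrite phiE !coef_Poly; congr order_elt; congr (_%:~R); lia.
Qed.

Theorem theorem1p4 :
  (exists f g : {poly int},
     [/\ has_degree 4 f /\ has_degree 4 g,
         squarefree_disc f /\ squarefree_disc g,
         invariant_orders_isomorphic f g
       & ~ hermite_equiv 4 f g])
  /\
  (forall n : nat, (4 <= n)%N ->
     [/\ infinite_set (split_classes n
           [set f : {poly int} |
             [/\ has_degree n f, properly_nonmonic n f & irreducible_Z f]]),
         infinite_set (split_classes n
           [set f : {poly int} |
             [/\ has_degree n f, f \is monic & irreducible_Z f]])
       & infinite_set (split_classes n
           [set f : {poly int} |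
             [/\ has_degree n f, f \is monic & reducible_Z f]])]).
Proof.
split; last first.
  move=> n n4; split; first exact: nonmonic_irreducible_split.
    exact: monic_irreducible_split.
  exact: monic_reducible_split.
exists monic_quartic, nonmonic_quartic; split.
- by split; [exact: has_degree_monic_quartic | exact: has_degree_nonmonic_quartic].
- by split; [exact: squarefree_disc_monic_quartic | exact: squarefree_disc_nonmonic_quartic].
- exact: quartics_orders_isomorphic.
- exact: quartics_not_hermite_equiv.
Qed.
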